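(* Let $g \ge 1$ be an integer, $k$ an algebraically closed field, and $\ell$ a prime number with $\ell \ne \mathrm{char}(k)$. Then $\bigcup_{A \in W_{\ell,g}} X^{(1)}_A$ is Zariski dense in $\mathcal{A}_1^g$.
   Context: $\mathcal{A}_1$ is the coarse moduli scheme over $k$ of elliptic curves. For $N\ge1$, $Y_0(N)$ is the modular curve parametrizing pairs $(E,C)$ with $E$ an elliptic curve and $C\subset E$ cyclic of order $N$. $W_{\ell,g}$ is the set of $g\times g$ diagonal matrices with diagonal entries $\ell^{n_1},\dots,\ell^{n_g}$ for positive integers $n_1,\dots,n_g$. For a diagonal matrix $A$ with positive integer diagonal entries $d_1,\dots,d_g$ and $N = \det A$ prime to $\mathrm{char}(k)$, define $\psi^{\mathrm{diag}}_A : Y_0(N) \to \mathcal{A}_1^g$ by $(E,C) \mapsto (E/\tfrac{N}{d_1}C, \dots, E/\tfrac{N}{d_g}C)$, and let $X^{(1)}_A = \psi^{\mathrm{diag}}_A(Y_0(N))$. *)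

(* Defs.v *)
From HB Require Import structures.
From mathcomp Require Import all_boot all_order all_algebra.
From mathcomp Require Import ring mpoly.
Set Implicit Arguments.
Unset Strict Implicit.
Unset Printing Implicit Defensive.
Import GRing.Theory.
Local Open Scope ring_scope.

(** The projective cubic y^2 + a1 x y + a3 y = x^3 + a2 x^2 + a4 x + a6, with
    origin its unique point at infinity. *)

Record weierstrass (k : fieldType) := Weierstrass {
  a1 : k; a2 : k; a3 : k; a4 : k; a6 : k }.

Section Invariants.
Variables (k : fieldType) (W : weierstrass k).

Definition b2 : k := a1 W ^+ 2 + 4 * a2 W.
Definition b4 : k := 2 * a4 W + a1 W * a3 W.
Definition b6 : k := a3 W ^+ 2 + 4 * a6 W.
Definition b8 : k :=
  a1 W ^+ 2 * a6 W + 4 * a2 W * a6 W - a1 W * a3 W * a4 W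
    + a2 W * a3 W ^+ 2 - a4 W ^+ 2.
Definition c4 : k := b2 ^+ 2 - 24 * b4.
Definition discriminant : k :=
  - b2 ^+ 2 * b8 - 8 * b4 ^+ 3 - 27 * b6 ^+ 2 + 9 * b2 * b4 * b6.

End Invariants.

Record elliptic_curve (k : fieldType) := EllipticCurve {
  equation :> weierstrass k;
  discriminant_neq0 : discriminant equation != 0 }.

Definition j_invariant (k : fieldType) (E : elliptic_curve k) : k :=
  c4 E ^+ 3 / discriminant E.

Section Points.
Variables (k : fieldType) (E : elliptic_curve k).

(* [None] is the point at infinity. *)
Definition on_curve (P : option (k * k)) : bool :=
  if P is Some (x, y) then
    y ^+ 2 + a1 E * x * y + a3 E * y
      == x ^+ 3 + a2 E * x ^+ 2 + a4 E * x + a6 E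
  else true.

Definition point : Type := {P : option (k * k) | on_curve P}.

Definition neg_y (x y : k) : k := - y - a1 E * x - a3 E.

(* The tangent case is only used for two equal points. *)
Definition slope (x1 y1 x2 y2 : k) : k :=
  if x1 == x2 then
    (3 * x1 ^+ 2 + 2 * a2 E * x1 + a4 E - a1 E * y1)
      / (2 * y1 + a1 E * x1 + a3 E)
  else (y2 - y1) / (x2 - x1).

Definition raw_add (P Q : option (k * k)) : option (k * k) :=
  match P, Q with
  | None, _ => Q
  | _, None => P
  | Some (x1, y1), Some (x2, y2) =>
      if (x1 == x2) && (y1 == neg_y x2 y2) then None else
      let s := slope x1 y1 x2 y2 in
      let x3 := s ^+ 2 + a1 E * s - a2 E - x1 - x2 in
      Some (x3, neg_y x3 (s * (x3 - x1) + y1))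
  end.

Lemma on_curve_add (P Q : point) : on_curve (raw_add (val P) (val Q)).
Proof.
case: P Q => -[[x1 y1]|] e1 [[[x2 y2]|] e2] //=.
case: ifPn => //; rewrite /slope /= in e1 e2 *.
rewrite -subr_eq0 in e1; move/eqP: e1; set w1 := _ - _ => e1.
rewrite -subr_eq0 in e2; move/eqP: e2; set w2 := _ - _ => e2.
case: eqVneq => [x12 /= ny|x12 _].
  have y12 : y1 = y2.
    apply/eqP; rewrite -subr_eq0.
    have : (y1 - y2) * (y1 - neg_y x2 y2) = 0.
      by transitivity (w1 - w2);
        [rewrite /w1 /w2 /neg_y x12; ring | rewrite e1 e2 subrr].
    by move/eqP; rewrite mulf_eq0 (subr_eq0 y1 (neg_y _ _)) (negPf ny) orbF.
  have d0 : 2 * y1 + a1 E * x1 + a3 E != 0.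
    move: ny; rewrite -subr_eq0 /neg_y -x12 -y12.
    by congr (_ != 0); ring.
  set s := _ / _.
  have sE : s * (2 * y1 + a1 E * x1 + a3 E)
            - (3 * x1 ^+ 2 + 2 * a2 E * x1 + a4 E - a1 E * y1) = 0.
    by rewrite /s divfK // subrr.
  rewrite -subr_eq0 -x12; apply/eqP.
  set x3 := s ^+ 2 + _ - _ - _ - _.
  transitivity (w1 + (x3 - x1) *
    (s * (2 * y1 + a1 E * x1 + a3 E)
            - (3 * x1 ^+ 2 + 2 * a2 E * x1 + a4 E - a1 E * y1))).
    by rewrite /w1 /neg_y /x3; ring.
  by rewrite e1 sE mulr0 addr0.
have d0 : x2 - x1 != 0 by rewrite subr_eq0 eq_sym.
set s := _ / _.
have y2E : y2 = y1 + s * (x2 - x1) by rewrite /s divfK // addrC subrK.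
rewrite -subr_eq0; apply/eqP/(mulfI d0).
set x3 := s ^+ 2 + _ - _ - _ - _.
transitivity ((x2 - x3) * w1 + (x3 - x1) * w2).
  by rewrite /w1 /w2 /neg_y y2E /x3; ring.
by rewrite e1 e2 !mulr0 addr0.
Qed.

Definition zerop : point := exist on_curve None isT.
Definition addp (P Q : point) : point := exist on_curve _ (on_curve_add P Q).
Definition mulnp (n : nat) (P : point) : point := iter n (addp P) zerop.

Definition cyclic_of_order (N : nat) (C : point -> Prop) : Prop :=
  exists P : point,
    [/\ forall Q, C Q <-> exists m, Q = mulnp m P,
        mulnp N P = zerop
      & forall m, (0 < m < N)%N -> mulnp m P <> zerop].

Definition multiple_subgroup (n : nat) (C : point -> Prop) : point -> Prop :=
  fun Q => exists2 P, C P & Q = mulnp n P.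

End Points.

Section Isogenies.
Variables (k : fieldType) (E E' : elliptic_curve k).
Implicit Type phi : point E -> point E'.

(* The inner variable is x, the outer one y. *)
Definition eval2 (F : {poly {poly k}}) (x y : k) : k := F.[y%:P].[x].

(* The two coordinates of phi are rational functions on E, written over a
   common denominator G that does not vanish identically on E (hence vanishes
   at finitely many points only, E being irreducible). A constant
   homomorphism, having no affine value, is excluded. *)
Definition rational_map phi : Prop :=
  exists X Y G : {poly {poly k}},
    (exists (P : point E) (x y : k),
        val P = Some (x, y) /\ eval2 G x y != 0) /\
    (forall (P : point E) (x y : k),
        val P = Some (x, y) -> eval2 G x y != 0 ->
        val (phi P) = Some (eval2 X x y / eval2 G x y,
                            eval2 Y x y / eval2 G x y)).

Definition isogeny phi : Prop :=
  (forall P Q, phi (addp P Q) = addp (phi P) (phi Q)) /\ rational_map phi.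

(* For an isogeny phi the function x' \o phi is invariant under P |-> - P, so
   it is a rational function r = p / q of x alone. The extensions k(E) / k(x)
   and k(E') / k(x') being separable, k(E) is separable over phi^* k(E') if and
   only if k(x) is separable over k(r), i.e., if and only if r' <> 0. *)
Definition separable phi : Prop :=
  exists p q : {poly k},
    [/\ q != 0,
        forall (P : point E) (x y : k), val P = Some (x, y) -> q.[x] != 0 ->
          exists y', val (phi P) = Some (p.[x] / q.[x], y')
      & p^`() * q - p * q^`() != 0].

(* E' is the quotient E / D: the target of a separable isogeny of kernel D,
   which is determined by D up to isomorphism. *)
Definition is_quotient (D : point E -> Prop) : Prop :=
  exists phi, [/\ isogeny phi, separable phi
                & forall P, D P <-> phi P = zerop E'].

End Isogenies.

(** Varieties over the algebraically closed field k are represented by their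
    k-points. The coarse moduli scheme A_1 is the affine line Spec k[j], a
    curve E giving the point j(E); so the points of A_1^g are the maps
    ['I_g -> k]. *)

Section Moduli.
Variable k : closedFieldType.

Record Y0 (N : nat) := Y0Point {
  Y0_curve : elliptic_curve k;
  Y0_subgroup : point Y0_curve -> Prop;
  Y0_cyclic : cyclic_of_order N Y0_subgroup }.

Variable g : nat.

Definition level (A : 'M[int]_g) : nat := `|\det A|%N.

(* Graph of psi^diag_A. It is meaningful for A diagonal with positive diagonal
   entries and level A prime to char(k): finite subgroup schemes of that order
   are then given by their points. *)
Definition psi_diag (A : 'M[int]_g) (z : Y0 (level A)) (x : 'I_g -> k) : Prop :=
  forall i : 'I_g, exists E' : elliptic_curve k,
    is_quotient E' (multiple_subgroup (level A %/ `|A i i|) (@Y0_subgroup _ z))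
    /\ x i = j_invariant E'.

Definition X1 (A : 'M[int]_g) (x : 'I_g -> k) : Prop :=
  exists z : Y0 (level A), psi_diag z x.

Definition zariski_closed (Z : ('I_g -> k) -> Prop) : Prop :=
  exists I : {mpoly k[g]} -> Prop,
    forall x, Z x <-> forall p, I p -> p.@[x] = 0.

Definition zariski_dense (S : ('I_g -> k) -> Prop) : Prop :=
  forall Z, zariski_closed Z -> (forall x, S x -> Z x) -> forall x, Z x.

End Moduli.

Definition W (l g : nat) (A : 'M[int]_g) : Prop :=
  exists n : 'I_g -> nat,
    (forall i, (0 < n i)%N) /\ A = diag_mx (\row_i (l ^ n i)%N%:Z).

(* Main.v *)
(** A nonzero polynomial p must be shown not to vanish at some tuple
    (j(E/C_1), ..., j(E/C_g)), where C is cyclic of order N = l^(n_1 + ... + n_g)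
    and C_i is its subgroup of order l^(n_i). We let E degenerate to a nodal
    cubic: on y^2 + x y = x^3 + a, in the role of the Tate curve with parameter
    q = - a, we take a point T of order N that behaves like q^(1/N). If s is a
    parameter of order 1/N with respect to a, the abscissa of i T has order i in
    s for i < N/2, and Velu's formulas give j(E/C_i) ~ s^(- N / l^(n_i)). When
    the n_i form an arithmetic progression of large difference, these exponents
    are the weights of the digits in a large base, so that distinct monomials of
    p have distinct orders in s, and p does not vanish for small s.

    The field k carries no topology. All orders are computed in the local ring
    at (s, al) = (0, -1) of the plane with coordinates s and al, where
    a / s^N = al + ...; the condition N T = 0 defines a curve through that
    point, not containing the line s = 0, and a k-point of it is chosen outside
    the zero locus of the finitely many functions that are units at (0, -1).

    The quotient E/C is given by Velu's formulas. That they define a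
    homomorphism onto a Weierstrass curve follows from a rigidity principle: a
    function on E that vanishes at infinity and has no other poles is zero, since
    this holds for its trace and its norm, which are rational functions of x. At
    the points of C, and at the other possible poles, regularity is deduced by
    translation from regularity at infinity. *)
Require Import Defs.
From HB Require Import structures.
From mathcomp Require Import all_boot all_order all_algebra.
From mathcomp Require Import ring zify mpoly.
Set Implicit Arguments.
Unset Strict Implicit.
Unset Printing Implicit Defensive.
Import GRing.Theory Num.Theory Order.Theory.
Local Open Scope ring_scope.

(** * The group law *)

(** On the Tate curve G_m / q^Z the subgroup of order d generated by q^(1/d) has the quotient G_m /
    q^(Z/d), whose j-invariant is about q^(-1/d); this is the source of the exponents - N / l^(n_i).
    The point (0, -1) comes from the same model: s^N = q = - a says that a / s^N is -1 to first
    order. The torsion condition is not solved for al as a power series in s; al stays an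
    independent variable until a point of the curve is chosen. Since i T and (N - i) T have the same
    abscissa, orders grow only up to the middle, and N T = 0 is tested there. Orders of abscissas
    are read off the product of the three abscissas on a line, because leading terms cancel in the
    sum formula. Additivity of Velu's map comes from an explicit slope for the line through two
    image points, a sum of slopes on E; it works because slopes satisfy a cocycle relation, proved
    along with associativity. General Weierstrass equations let the same formulas cover
    characteristics 2 and 3. *)

Section LinearCombination.
Variables (R : comNzRingType) (a b : R).

(** Certificates of ideal membership: the coefficients [c], [c'], ... supplied below are the
    cofactors of the hypotheses, and [ring] checks the identity. *)
Lemma lincomb1 (c u v : R) : u = v -> a - b = c * (u - v) -> a = b.
Proof. by move=> -> /eqP; rewrite subrr mulr0 subr_eq0 => /eqP. Qed.

Lemma lincomb2 (c u v c' u' v' : R) : u = v -> u' = v' ->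
  a - b = c * (u - v) + c' * (u' - v') -> a = b.
Proof. by move=> -> -> /eqP; rewrite !subrr !mulr0 addr0 subr_eq0 => /eqP. Qed.

Lemma lincomb3 (c u v c' u' v' c'' u'' v'' : R) : u = v -> u' = v' -> u'' = v'' ->
  a - b = c * (u - v) + c' * (u' - v') + c'' * (u'' - v'') -> a = b.
Proof.
by move=> -> -> -> /eqP; rewrite !subrr !mulr0 !addr0 subr_eq0 => /eqP.
Qed.

Lemma lincomb4 (c u v c' u' v' c'' u'' v'' d s t : R) :
    u = v -> u' = v' -> u'' = v'' -> s = t ->
  a - b = c * (u - v) + c' * (u' - v') + c'' * (u'' - v'') + d * (s - t) -> a = b.
Proof.
by move=> -> -> -> -> /eqP; rewrite !subrr !mulr0 !addr0 subr_eq0 => /eqP.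
Qed.

End LinearCombination.

Section GroupLaw.
Variables (k : fieldType) (E : elliptic_curve k).
Implicit Types (p q r : option (k * k)) (x y m n : k).

Local Notation A1 := (a1 E).
Local Notation A2 := (a2 E).
Local Notation A3 := (a3 E).
Local Notation A4 := (a4 E).
Local Notation A6 := (a6 E).
Local Notation ny := (neg_y E).
Local Notation slp := (slope E).

Lemma on_curveP x y : reflect (y ^+ 2 + A1 * x * y + A3 * y
  = x ^+ 3 + A2 * x ^+ 2 + A4 * x + A6) (on_curve E (Some (x, y))).
Proof. exact: eqP. Qed.

Lemma neg_yK x : involutive (ny x).
Proof. by move=> y; rewrite /neg_y; ring. Qed.

Lemma on_curve_neg x y : on_curve E (Some (x, ny x y)) = on_curve E (Some (x, y)).
Proof. by rewrite /= /neg_y; congr (_ == _); ring. Qed.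

(* The gradient of the equation does not vanish: otherwise the equation and its
   derivatives express a6, a4 and a3 in terms of the rest, and Delta = 0. *)
Lemma nonsingular x y : on_curve E (Some (x, y)) -> 2 * y + A1 * x + A3 = 0 ->
  3 * x ^+ 2 + 2 * A2 * x + A4 - A1 * y = 0 -> False.
Proof.
case: E => -[e1 e2 e3 e4 e6] /= D /eqP e psi g.
have e3E : e3 = - 2 * y - e1 * x by rewrite -[LHS]subr0 -psi; ring.
have e4E : e4 = e1 * y - 3 * x ^+ 2 - 2 * e2 * x by rewrite -[LHS]subr0 -g; ring.
have e6E : e6 = y ^+ 2 + e1 * x * y + e3 * y - (x ^+ 3 + e2 * x ^+ 2 + e4 * x).
  by rewrite e; ring.
move/eqP: D; apply; rewrite /discriminant /b2 /b4 /b6 /b8 /=.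
by rewrite e6E e4E e3E; ring.
Qed.

Lemma same_x x y y' : on_curve E (Some (x, y)) -> on_curve E (Some (x, y')) ->
  y = y' \/ y = ny x y'.
Proof.
move=> /on_curveP e /on_curveP e'.
have /eqP : (y - y') * (y - ny x y') = 0.
  by apply: (lincomb2 (c := 1) (c' := -1) e e'); rewrite /neg_y; ring.
by rewrite mulf_eq0 !subr_eq0 => /orP[] /eqP; [left | right].
Qed.

(** Chord and tangent at once. Subtracting the two curve equations gives (y1 - y2) (y1 + y2 + a1 x2
    + a3) = (x1 - x2) (...), so each equation is a form of the slope; for points that are not
    opposite, at least one of them determines m. *)
Definition slope_rel x1 y1 x2 y2 m : Prop :=
  m * (x1 - x2) = y1 - y2 /\
  m * (y1 + y2 + A1 * x2 + A3)
    = x1 ^+ 2 + x1 * x2 + x2 ^+ 2 + A2 * (x1 + x2) + A4 - A1 * y1.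

Lemma slope_relC x1 y1 x2 y2 m :
  slope_rel x1 y1 x2 y2 m -> slope_rel x2 y2 x1 y1 m.
Proof.
move=> [e1 e2]; split; first by rewrite -opprB mulrN e1 opprB.
by apply: (lincomb2 (c := 1) (c' := A1) e2 e1); ring.
Qed.

Lemma slopeP x1 y1 x2 y2 :
    on_curve E (Some (x1, y1)) -> on_curve E (Some (x2, y2)) ->
    ~ (x1 = x2 /\ y1 = ny x2 y2) ->
  slope_rel x1 y1 x2 y2 (slp x1 y1 x2 y2).
Proof.
move=> o1 o2 nopp; rewrite /slope_rel /slope; case: eqVneq => [x12|x12].
  subst x2; case: (same_x o1 o2) => [y12|y12]; last by case: nopp.
  subst y2; split; first by rewrite !subrr mulr0.
  have d0 : 2 * y1 + A1 * x1 + A3 != 0.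
    apply/eqP => d0; apply: nopp; split=> //.
    by rewrite /neg_y -[LHS]subr0 -d0; ring.
  by field; move: d0; congr (_ != 0); ring.
have d0 : x2 - x1 != 0 by rewrite subr_eq0 eq_sym.
move/on_curveP: o1 => o1; move/on_curveP: o2 => o2.
split; first by field.
apply: (mulIf d0); rewrite mulrAC divfK //.
by apply: (lincomb2 (c := 1) (c' := -1) o2 o1); ring.
Qed.

Lemma slope_uniq x1 y1 x2 y2 m n : ~ (x1 = x2 /\ y1 = ny x2 y2) ->
  slope_rel x1 y1 x2 y2 m -> slope_rel x1 y1 x2 y2 n -> m = n.
Proof.
move=> nopp [e1 e2] [f1 f2]; case: (eqVneq x1 x2) => [x12|x12]; last first.
  by apply: (@mulIf _ (x1 - x2)); rewrite ?subr_eq0 // e1 f1.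
apply: (@mulIf _ (y1 + y2 + A1 * x2 + A3)); last by rewrite e2 f2.
apply/eqP => d0; apply: nopp; split=> //.
by rewrite /neg_y -[LHS]subr0 -d0; ring.
Qed.

Variant add_spec x1 y1 x2 y2 : option (k * k) -> Type :=
| AddOpp of x1 = x2 & y1 = ny x2 y2 : add_spec x1 y1 x2 y2 None
| AddGen m of ~ (x1 = x2 /\ y1 = ny x2 y2) & m = slp x1 y1 x2 y2
    & slope_rel x1 y1 x2 y2 m :
    add_spec x1 y1 x2 y2 (Some (m ^+ 2 + A1 * m - A2 - x1 - x2,
      ny (m ^+ 2 + A1 * m - A2 - x1 - x2)
         (m * (m ^+ 2 + A1 * m - A2 - x1 - x2 - x1) + y1))).

Lemma raw_addP x1 y1 x2 y2 :
    on_curve E (Some (x1, y1)) -> on_curve E (Some (x2, y2)) ->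
  add_spec x1 y1 x2 y2 (raw_add E (Some (x1, y1)) (Some (x2, y2))).
Proof.
move=> o1 o2; rewrite /raw_add; case: ifPn => [/andP[/eqP ? /eqP ?]|nopp].
  exact: AddOpp.
have nopp' : ~ (x1 = x2 /\ y1 = ny x2 y2).
  by move=> [? ?]; move/negP: nopp; apply; apply/andP; split; apply/eqP.
exact: AddGen nopp' erefl (slopeP o1 o2 nopp').
Qed.

Lemma raw_addE x1 y1 x2 y2 m : ~ (x1 = x2 /\ y1 = ny x2 y2) ->
  on_curve E (Some (x1, y1)) -> on_curve E (Some (x2, y2)) ->
  slope_rel x1 y1 x2 y2 m ->
  raw_add E (Some (x1, y1)) (Some (x2, y2)) =
    Some (m ^+ 2 + A1 * m - A2 - x1 - x2,
      ny (m ^+ 2 + A1 * m - A2 - x1 - x2)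
         (m * (m ^+ 2 + A1 * m - A2 - x1 - x2 - x1) + y1)).
Proof.
move=> nopp o1 o2 r; case: raw_addP => // [? ?|n _ _ r']; first by case: nopp.
by rewrite (slope_uniq nopp r r').
Qed.

Lemma raw_addC p q : on_curve E p -> on_curve E q -> raw_add E p q = raw_add E q p.
Proof.
case: p q => [[x1 y1]|] [[x2 y2]|] // o1 o2.
case: raw_addP => // [e1 e2|m nopp _ rel].
  by case: raw_addP => // m []; rewrite e1 e2 neg_yK.
rewrite (raw_addE _ o2 o1 (slope_relC rel)); last first.
  by move=> [e1 e2]; apply: nopp; rewrite e1 e2 neg_yK.
case: rel => rel _; have -> : y1 = m * (x1 - x2) + y2 by rewrite rel; ring.
by congr (Some (_, _)); rewrite /neg_y; ring.
Qed.

Definition raw_neg p : option (k * k) := if p is Some (x, y) then Some (x,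
  ny x y) else None.

Lemma on_curve_raw_neg p : on_curve E (raw_neg p) = on_curve E p.
Proof. by case: p => [[x y]|] //; exact: on_curve_neg. Qed.

Lemma raw_negK : involutive raw_neg.
Proof. by case=> [[x y]|] //=; rewrite neg_yK. Qed.

Lemma raw_addN p : raw_add E (raw_neg p) p = None.
Proof. by case: p => [[x y]|] //=; rewrite !eqxx. Qed.

Lemma raw_add_eq0 p q : on_curve E p -> on_curve E q ->
  raw_add E p q = None -> p = raw_neg q.
Proof.
case: p q => [[x1 y1]|] [[x2 y2]|] // o1 o2.
by case: raw_addP => // -> -> _.
Qed.

Lemma on_curve_raw_add p q : on_curve E p -> on_curve E q -> on_curve E (raw_add E p q).
Proof. by move=> op oq; exact: (on_curve_add (exist _ p op) (exist _ q oq)). Qed.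

Lemma slope_relN x1 y1 x2 y2 m : slope_rel x1 y1 x2 y2 m ->
  slope_rel x1 (ny x1 y1) x2 (ny x2 y2) (- m - A1).
Proof.
move=> [e1 e2]; split; rewrite /neg_y.
  by rewrite mulrBl mulNr e1; ring.
by apply: (lincomb2 (c := 1) (c' := A1) e2 e1); ring.
Qed.

Lemma slope_rel_third x1 y1 x2 y2 m (x3 := m ^+ 2 + A1 * m - A2 - x1 - x2) :
  slope_rel x1 y1 x2 y2 m -> slope_rel x3 (m * (x3 - x1) + y1) x2 y2 m.
Proof.
move=> [e1 e2]; split.
  by apply: (lincomb1 (c := 1) e1); rewrite /x3; ring.
by apply: (lincomb1 (c := 1) e2); rewrite /x3; ring.
Qed.

Lemma raw_addKl p q : on_curve E p -> on_curve E q ->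
  raw_add E (raw_neg p) (raw_add E p q) = q.
Proof.
case: p q => [[x1 y1]|] [[x2 y2]|] // o1 o2; last exact: raw_addN (Some (x1, y1)).
have := on_curve_raw_add o1 o2.
case: raw_addP => // [-> -> _|m nopp _ rel oV]; first by rewrite /= neg_yK.
set x3 := _ - x1 - x2 in oV *.
have rel1 := slope_relC (slope_rel_third (slope_relC rel)).
have rel3 : slope_rel x1 (ny x1 y1) x3 (ny x3 (m * (x3 - x1) + y1)) (- m - A1).
  apply: slope_relN; have -> : x3 = m ^+ 2 + A1 * m - A2 - x2 - x1.
    by rewrite /x3; ring.
  move: rel1; set x3' := _ - x2 - x1.
  suff -> : m * (x3' - x2) + y2 = m * (x3' - x1) + y1 by [].
  by case: rel => e1 _; apply: (lincomb1 (c := 1) e1); ring.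
have oN1 : on_curve E (Some (x1, ny x1 y1)) by rewrite on_curve_neg.
(* Otherwise P + Q = P = - P, and the line through P and Q, of finite slope, meets the curve twice
   at P; both partial derivatives then vanish there. *)
have nopp3 : ~ (x1 = x3 /\ ny x1 y1 = ny x3 (ny x3 (m * (x3 - x1) + y1))).
  rewrite neg_yK => -[x13]; rewrite -x13 subrr mulr0 add0r => y1N.
  have psi0 : 2 * y1 + A1 * x1 + A3 = 0.
    by apply: (lincomb1 (c := -1) y1N); rewrite /neg_y; ring.
  apply: (nonsingular o1 psi0); case: rel1 => _; rewrite -/x3.
  have -> : m ^+ 2 + A1 * m - A2 - x2 - x1 = x3 by rewrite /x3; ring.
  case: rel => e1 _; rewrite -x13 => e2.
  by apply: (lincomb3 (c := -1) (c' := m) (c'' := m) e2 psi0 e1); ring.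
rewrite [raw_neg _]/= (raw_addE nopp3 oN1 oV rel3).
case: rel => e1 _; congr (Some (_, _)); first by rewrite /x3; ring.
by rewrite /neg_y; apply: (lincomb1 (c := -1) e1); rewrite /x3; ring.
Qed.

Lemma raw_addKr p q : on_curve E p -> on_curve E q ->
  raw_add E (raw_add E p q) (raw_neg q) = p.
Proof.
move=> op oq; rewrite raw_addC ?on_curve_raw_add ?on_curve_raw_neg //.
by rewrite (raw_addC op oq) raw_addKl.
Qed.

(* With Q moved to the origin the slopes m and n of the lines PQ and QR satisfy
   m (m p + a1 p + psi) = p^2 + c p + g, and likewise n and r = x_R, whether the
   lines are chords or tangents. *)
Lemma assoc_slope x1 y1 x2 y2 x3 y3 m n l
    (u1 := m ^+ 2 + A1 * m - A2 - x1 - x2) (u2 := ny u1 (m * (u1 - x1) + y1)) :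
    slope_rel x1 y1 x2 y2 m -> slope_rel x3 y3 x2 y2 n ->
    ~ (x3 = x2 /\ y3 = ny x2 y2) -> on_curve E (Some (x2, y2)) ->
    on_curve E (Some (x3, y3)) -> on_curve E (Some (u1, u2)) ->
    ~ (u1 = x3 /\ u2 = ny x3 y3) -> slope_rel u1 u2 x3 y3 l ->
  (m - n) * (l + m + A1) = x1 - x3.
Proof.
move=> [e1 e2] [f1 f2] noppQR o2 o3 oU noppUR [g1 g2].
have y1E : y1 = m * (x1 - x2) + y2 by rewrite e1; ring.
have y3E : y3 = n * (x3 - x2) + y2 by rewrite f1; ring.
case: (eqVneq u1 x3) => [ux|ux]; last first.
  apply: (@mulIf _ (u1 - x3)); first by rewrite subr_eq0.
  rewrite y1E in e2; rewrite y3E in f2.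
  apply: (lincomb3 (c := m - n) (c' := -1) (c'' := 1) g1 e2 f2).
  by rewrite /u2 /neg_y y1E y3E /u1; ring.
have uy : u2 = y3.
  rewrite ux in oU; case: (same_x oU o3) => // uN.
  by case: noppUR.
have nx32 : x3 - x2 != 0.
  apply/negP; rewrite subr_eq0 => /eqP x32; apply: noppQR; split=> //.
  rewrite -uy /u2 ux /neg_y y1E x32; ring.
apply: (mulIf nx32).
rewrite y1E in e2; rewrite y3E in f2.
have ux' : m ^+ 2 + A1 * m - A2 - x1 - x2 = x3 by [].
have uy' : ny x3 (m * (x3 - x1) + y1) = y3 by rewrite -uy /u2 ux.
rewrite ux uy in g2.
rewrite /neg_y y1E y3E in uy'.
rewrite y3E in g2.
by apply: (lincomb4 (c := -1) (c' := n - l) (c'' := x3 - x2) (d := 1)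
                    g2 uy' ux' f2); ring.
Qed.

(** [assoc_slope] for (P, Q, R) and for (R, Q, P) add up to (m - n) (m + l - n - h) = 0. The
    relation between the slopes is kept beside associativity for later use on Velu's map. *)
Lemma raw_add_assoc_gen x1 y1 x2 y2 x3 y3 m n l h
    (u1 := m ^+ 2 + A1 * m - A2 - x1 - x2) (u2 := ny u1 (m * (u1 - x1) + y1))
    (v1 := n ^+ 2 + A1 * n - A2 - x3 - x2) (v2 := ny v1 (n * (v1 - x3) + y3)) :
    slope_rel x1 y1 x2 y2 m -> slope_rel x3 y3 x2 y2 n ->
    ~ (x1 = x2 /\ y1 = ny x2 y2) -> ~ (x3 = x2 /\ y3 = ny x2 y2) ->
    on_curve E (Some (x1, y1)) -> on_curve E (Some (x2, y2)) ->
    on_curve E (Some (x3, y3)) ->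
    on_curve E (Some (u1, u2)) -> on_curve E (Some (v1, v2)) ->
    ~ (u1 = x3 /\ u2 = ny x3 y3) -> slope_rel u1 u2 x3 y3 l ->
    ~ (v1 = x1 /\ v2 = ny x1 y1) -> slope_rel v1 v2 x1 y1 h ->
  m + l = n + h /\
  raw_add E (Some (u1, u2)) (Some (x3, y3)) =
    raw_add E (Some (x1, y1)) (Some (v1, v2)).
Proof.
move=> r12 r32 n12 n32 o1 o2 o3 oU oV nU rU nV rV.
(* Equal slopes put P, Q and R on one line: R is P, or R = - (P + Q), which is excluded. *)
case: (eqVneq m n) => [mn|nmn].
  have [e2 f2] := (r12.2, r32.2); have [e1 f1] := (r12.1, r32.1).
  rewrite -mn in f2 f1.
  have y1E : y1 = m * (x1 - x2) + y2 by rewrite e1; ring.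
  have y3E : y3 = m * (x3 - x2) + y2 by rewrite f1; ring.
  have /eqP : (x3 - x1) * (x3 - u1) = 0.
    rewrite y1E in e2; rewrite y3E in f2.
    by apply: (lincomb2 (c := 1) (c' := -1) e2 f2); rewrite /u1; ring.
  rewrite mulf_eq0 !subr_eq0 => /orP[] /eqP x3E; last first.
    by case: nU; split=> //; rewrite /u2 x3E y3E y1E; congr (ny _ _); rewrite -x3E; ring.
  have y31 : y3 = y1 by rewrite y1E y3E x3E.
  have [uvx uvy] : u1 = v1 /\ u2 = v2.
    by rewrite /u2 /v2 /u1 /v1 x3E y31 mn.
  split; last by rewrite raw_addC // uvx uvy x3E y31.
  rewrite mn; congr (_ + _); apply: (slope_uniq nU rU).
  by rewrite uvx uvy x3E y31.
have k1 := assoc_slope r12 r32 n32 o2 o3 oU nU rU.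
have k2 := assoc_slope r32 r12 n12 o2 o1 oV nV rV.
have lh : m + l = n + h.
  apply: (@mulfI _ (m - n)); first by rewrite subr_eq0.
  by apply: (lincomb2 (c := 1) (c' := 1) k1 k2); ring.
split=> //; have hE : h = m + l - n by rewrite lh; ring.
rewrite (raw_addE nU oU o3 rU) (raw_addC o1 oV) (raw_addE nV oV o1 rV).
have y1E : y1 = m * (x1 - x2) + y2 by case: r12 => -> _; ring.
have y3E : y3 = n * (x3 - x2) + y2 by case: r32 => -> _; ring.
have XE : h ^+ 2 + A1 * h - A2 - v1 - x1 = l ^+ 2 + A1 * l - A2 - u1 - x3.
  by rewrite hE; apply: (lincomb1 (c := 2) k1); rewrite /u1 /v1; ring.
rewrite XE; congr (Some (_, ny _ _)).
set X := _ - x3.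
have -> : l * (X - u1) + u2 = l * (X - x3) + y3.
  by case: rU => e _; apply: (lincomb1 (c := -1) e); ring.
have -> : h * (X - v1) + v2 = h * (X - x1) + y1.
  by case: rV => e _; apply: (lincomb1 (c := -1) e); ring.
rewrite y1E y3E hE.
by apply: (lincomb1 (c := m - l) k1); rewrite /X /u1; ring.
Qed.

Lemma raw_add0 p : raw_add E p None = p.
Proof. by case: p => [[]|]. Qed.

Lemma raw_add_opp x1 y1 x2 y2 :
  raw_add E (Some (x1, y1)) (Some (x2, y2)) != None -> ~ (x1 = x2 /\ y1 = ny x2 y2).
Proof. by move=> /negP H [e1 e2]; apply: H; rewrite /raw_add e1 e2 !eqxx. Qed.

Lemma raw_addA_eq0 p q r : on_curve E p -> on_curve E q -> on_curve E r ->
  raw_add E (raw_add E p q) r = None -> raw_add E p (raw_add E q r) = None.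
Proof.
move=> op oq orr /(raw_add_eq0 (on_curve_raw_add op oq) orr) pqE.
have qE := raw_addKl op oq; rewrite pqE in qE.
have -> : raw_add E q r = raw_neg p.
  by rewrite -qE -{2}[r]raw_negK raw_addKr ?on_curve_raw_neg.
by rewrite raw_addC ?on_curve_raw_neg // raw_addN.
Qed.

(** Over the complex numbers the slope between u and v is, up to normalization, zeta(u + v) -
    zeta(u) - zeta(v) for the Weierstrass zeta function: a coboundary, hence a cocycle. *)
Lemma raw_add_cocycle x1 y1 x2 y2 x3 y3 u1 u2 v1 v2 z :
    on_curve E (Some (x1, y1)) -> on_curve E (Some (x2, y2)) ->
    on_curve E (Some (x3, y3)) ->
    raw_add E (Some (x1, y1)) (Some (x2, y2)) = Some (u1, u2) ->
    raw_add E (Some (x2, y2)) (Some (x3, y3)) = Some (v1, v2) ->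
    raw_add E (Some (u1, u2)) (Some (x3, y3)) = Some z ->
  slp x1 y1 x2 y2 + slp u1 u2 x3 y3 = slp x2 y2 x3 y3 + slp x1 y1 v1 v2 /\
  raw_add E (Some (x1, y1)) (Some (v1, v2)) = Some z.
Proof.
move=> o1 o2 o3 UE VE LE.
have oU := on_curve_raw_add o1 o2; have oV := on_curve_raw_add o2 o3.
rewrite UE in oU; rewrite VE in oV.
have nU : ~ (u1 = x3 /\ u2 = ny x3 y3) by apply: raw_add_opp; rewrite LE.
have n23 : ~ (x2 = x3 /\ y2 = ny x3 y3) by apply: raw_add_opp; rewrite VE.
have n32 : ~ (x3 = x2 /\ y3 = ny x2 y2).
  by move=> [e1 e2]; apply: n23; rewrite e1 e2 neg_yK.
have nV' : ~ (x1 = v1 /\ y1 = ny v1 v2).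
  apply: raw_add_opp; apply/negP => /eqP; rewrite raw_addC // => RE.
  suff : raw_add E (Some (u1, u2)) (Some (x3, y3)) = None by rewrite LE.
  rewrite raw_addC // -UE (raw_addC o1 o2) raw_addA_eq0 //.
  by rewrite (raw_addC o3 o2) VE.
have nV : ~ (v1 = x1 /\ v2 = ny x1 y1).
  by move=> [e1 e2]; apply: nV'; rewrite e1 e2 neg_yK.
have rU := slopeP oU o3 nU; have rV := slopeP oV o1 nV.
have r32 := slopeP o3 o2 n32; have r23 := slopeP o2 o3 n23.
have rV' := slopeP o1 oV nV'.
rewrite -(slope_uniq n32 r32 (slope_relC r23)).
rewrite -(slope_uniq nV rV (slope_relC rV')).
move: UE VE LE; rewrite (raw_addC o2 o3).
case: raw_addP => // m n12 mE r12 [u1E u2E].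
case: (raw_addP o3 o2) => // n _ nE _ [v1E v2E].
rewrite -mE -nE => <-; rewrite -nE in r32.
subst u1 u2 v1 v2.
by have [-> ->] := raw_add_assoc_gen r12 r32 n12 n32 o1 o2 o3 oU oV nU rU nV rV.
Qed.

Lemma raw_addA p q r : on_curve E p -> on_curve E q -> on_curve E r ->
  raw_add E p (raw_add E q r) = raw_add E (raw_add E p q) r.
Proof.
case: p => [[x1 y1]|] // o1; case: q => [[x2 y2]|] // o2.
case: r => [[x3 y3]|] // o3; last by rewrite !raw_add0.
have oU := on_curve_raw_add o1 o2.
case LE: (raw_add E (raw_add E (Some (x1, y1)) (Some (x2, y2))) (Some (x3, y3))) =>
  [z|]; last first.
  by apply: raw_addA_eq0.
case UE: (raw_add E (Some (x1, y1)) (Some (x2, y2))) => [[u1 u2]|]; last first.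
  rewrite (raw_add_eq0 o1 o2 UE) raw_addKl // -LE UE //.
case VE: (raw_add E (Some (x2, y2)) (Some (x3, y3))) => [[v1 v2]|]; last first.
  rewrite -LE -[Some (x2, y2)]raw_negK.
  rewrite -[Some (x3, y3) in RHS](raw_addKl o2 o3) VE raw_add0.
  by rewrite raw_negK raw_addKr.
by rewrite UE in LE; case: (raw_add_cocycle o1 o2 o3 UE VE LE).
Qed.
End GroupLaw.

Section PointGroup.
Variables (k : fieldType) (E : elliptic_curve k).

HB.instance Definition _ := Choice.copy (point E) {P | on_curve E P}.

Definition negp (P : point E) : point E :=
  exist _ (raw_neg E (val P)) (etrans (on_curve_raw_neg E (val P)) (valP P)).

Lemma addpA : associative (@addp k E).
Proof. by move=> P Q R; apply: val_inj; apply: raw_addA; apply: valP. Qed.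

Lemma addpC : commutative (@addp k E).
Proof. by move=> P Q; apply: val_inj; apply: raw_addC; apply: valP. Qed.

Lemma add0p : left_id (zerop E) (@addp k E).
Proof. by move=> P; apply: val_inj. Qed.

Lemma addNp : left_inverse (zerop E) negp (@addp k E).
Proof. by move=> P; apply: val_inj; apply: raw_addN. Qed.

HB.instance Definition _ := GRing.isZmodule.Build (point E) addpA addpC add0p addNp.

Lemma mulnpE n (P : point E) : mulnp n P = P *+ n.
Proof. by elim: n => //= n IH; rewrite mulrS -IH. Qed.
End PointGroup.

(** * Functions on the curve and their order at infinity *)

Section Weight.
Variable R : idomainType.
Implicit Types (u v : {poly R}) (w : int).

(* [2 deg u <= w]; the variable x of a Weierstrass equation has weight 2. *)
Definition weight_le w u : Prop := forall i : nat, w < (2 * i)%N%:Z -> u`_i = 0.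

Lemma weight_leW w w' u : w <= w' -> weight_le w u -> weight_le w' u.
Proof. by move=> le uw i wi; apply: uw; lia. Qed.

Lemma weight_le0 w : weight_le w 0.
Proof. by move=> i _; rewrite coef0. Qed.

Lemma weight_leD w u v : weight_le w u -> weight_le w v -> weight_le w (u + v).
Proof. by move=> uw vw i wi; rewrite coefD uw // vw // addr0. Qed.

Lemma weight_leN w u : weight_le w u -> weight_le w (- u).
Proof. by move=> uw i wi; rewrite coefN uw // oppr0. Qed.

Lemma weight_leM w w' u v : weight_le w u -> weight_le w' v -> weight_le (w + w') (u * v).
Proof.
move=> uw vw i wi; rewrite coefM big1 // => j _.
have [lt|le] := ltrP w (2 * j)%N%:Z; first by rewrite uw // mul0r.
by rewrite vw ?mulr0 //; have := ltn_ord j; lia.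
Qed.

Lemma weight_leC c : weight_le 0 c%:P.
Proof. by move=> i wi; rewrite coefC; case: i wi. Qed.

Lemma weight_leX : weight_le 2 'X.
Proof. by move=> i wi; rewrite coefX; case: i wi => [|[|]]. Qed.

Lemma weight_le_size u : weight_le (2 * (size u).-1)%N%:Z u.
Proof. move=> i; rewrite ltz_nat ltn_pmul2l // => wi.
by apply: nth_default; exact: leq_trans (leqSpred _) wi. Qed.

Lemma size_weight_le w u (n : nat) : w < (2 * n)%N%:Z -> weight_le w u -> (size u <= n)%N.
Proof. by move=> wn uw; apply/leq_sizeP => j nj; apply: uw; lia. Qed.
End Weight.
Arguments weight_leC {R} c.
Arguments weight_leX R : clear implicits.
Arguments weight_le_size {R} u.
Arguments weight_le0 {R} w.

Section Functions.
Variables (k : closedFieldType) (E : elliptic_curve k).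
Implicit Types (B : seq k) (f g h : point E -> k) (P Q S : point E) (m n : int).
Implicit Types (d u v : {poly k}).

Local Notation A1 := (a1 E).
Local Notation A2 := (a2 E).
Local Notation A3 := (a3 E).
Local Notation A4 := (a4 E).
Local Notation A6 := (a6 E).

Definition xc P : k := if val P is Some (x, _) then x else 0.
Definition yc P : k := if val P is Some (_, y) then y else 0.

Lemma val_affine P : P != 0 -> val P = Some (xc P, yc P).
Proof.
rewrite /xc /yc; case VP: (val P) => [[x y]|] // /eqP nP.
by case: nP; apply: val_inj.
Qed.

Lemma xcE P x y : val P = Some (x, y) -> xc P = x.
Proof. by rewrite /xc => ->. Qed.

Lemma ycE P x y : val P = Some (x, y) -> yc P = y.
Proof. by rewrite /yc => ->. Qed.

Lemma affine_neq0 P z : val P = Some z -> P != 0.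
Proof. by move=> VP; apply/eqP => P0; rewrite P0 in VP. Qed.

Lemma curve_eq P : P != 0 -> yc P ^+ 2 + A1 * xc P * yc P + A3 * yc P
  = xc P ^+ 3 + A2 * xc P ^+ 2 + A4 * xc P + A6.
Proof. by move=> /val_affine VP; have := valP P; rewrite /= VP => /eqP. Qed.

Lemma xcN P : xc (- P) = xc P.
Proof. by rewrite /xc /=; case: (val P) => [[]|]. Qed.

Lemma ycN P : P != 0 -> yc (- P) = - yc P - A1 * xc P - A3.
Proof. by move/val_affine => VP; rewrite {1}/yc /= VP. Qed.

Lemma point_ext P Q : P != 0 -> Q != 0 -> xc P = xc Q -> yc P = yc Q -> P = Q.
Proof.
move=> /val_affine VP /val_affine VQ ex ey.
by apply: val_inj; rewrite /= VP VQ ex ey.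
Qed.

Lemma same_xc P Q : P != 0 -> Q != 0 -> xc P = xc Q -> P = Q \/ P = - Q.
Proof.
move=> P0 Q0 ex.
have oP : on_curve E (Some (xc P, yc P)) by rewrite -(val_affine P0) (valP P).
have oQ : on_curve E (Some (xc P, yc Q)) by rewrite ex -(val_affine Q0) (valP Q).
case: (same_x oP oQ) => ey; [left; exact: point_ext | right].
by apply: point_ext; rewrite ?oppr_eq0 ?xcN // ycN // ey ex.
Qed.

Lemma point_at x : {P : point E | P != 0 & xc P = x}.
Proof.
pose q := 'X^2 + (A1 * x + A3) *: 'X - (x ^+ 3 + A2 * x ^+ 2 + A4 * x + A6)%:P : {poly k}.
have q1 : size q != 1.
  rewrite /q -addrA size_polyDl size_polyXn // ltnS.
  rewrite (leq_trans (size_polyD _ _)) // geq_max size_opp.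
  by rewrite (leq_trans (size_scale_leq _ _)) ?size_polyX // size_polyC; case: eqP.
have [y] := sigW (closed_rootP q q1).
rewrite /root /q !(hornerD, hornerN, hornerXn, hornerZ, hornerX, hornerC) => /eqP qy.
have o : on_curve E (Some (x, y)).
  by apply/on_curveP; apply: (lincomb1 (c := 1) qy); ring.
by exists (exist _ (Some (x, y)) o); [exact: affine_neq0|].
Qed.

Definition generically (T : point E -> Prop) : Prop :=
  exists L : seq (point E), forall P, P \notin L -> T P.

Lemma infinite_field (L : seq k) : {x | x \notin L}.
Proof.
case: L => [|a L]; first by exists 0.
apply: sigW; pose r := \prod_(b <- a :: L) ('X - b%:P) : {poly k}.
have sr : size r = (size L).+2 by rewrite size_prod_XsubC.
have /closed_rootP[x] : size (r + 1) != 1%N by rewrite size_polyDl ?size_poly1 sr.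
rewrite /root hornerD hornerC => /eqP xr.
exists x; apply/negP => xL; move: xr.
have /eqP -> : r.[x] == 0 by rewrite -/(root _ _) root_prod_XsubC.
by rewrite add0r => /eqP; rewrite oner_eq0.
Qed.

Lemma generically_point (T : point E -> Prop) : generically T -> exists P, T P.
Proof.
move=> [L LT]; have [x xL] := infinite_field (map xc L).
have [P _ Px] := point_at x; exists P; apply: LT.
by apply: contra xL => PL; rewrite -Px; apply: map_f.
Qed.

Lemma generically_impl (T U : point E -> Prop) :
  (forall P, T P -> U P) -> generically T -> generically U.
Proof. by move=> TU [L LT]; exists L => P /LT/TU. Qed.

Lemma generically_and (T U : point E -> Prop) :
  generically T -> generically U -> generically (fun P => T P /\ U P).
Proof.
move=> [L LT] [M MU]; exists (L ++ M) => P.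
by rewrite mem_cat negb_or => /andP[/LT ? /MU ?].
Qed.

Lemma generically_neq Q : generically (fun P => P != Q).
Proof. by exists [:: Q] => P; rewrite inE. Qed.

Lemma generically_xc B : generically (fun P => xc P \notin B).
Proof.
elim: B => [|b B IH]; first by exists [::].
have [Q Q0 Qb] := point_at b.
apply: (@generically_impl (fun P =>
  (xc P \notin B) /\ ((P != 0) /\ ((P != Q) /\ (P != - Q))))).
  move=> P [PB [P0 [PQ PQ']]]; rewrite inE negb_or PB andbT; apply/eqP => Pb.
  have [|e|e] := same_xc P0 Q0; first by rewrite Pb.
    by rewrite e eqxx in PQ.
  by rewrite e eqxx in PQ'.
by do 3![apply: generically_and; [exact: IH || exact: generically_neq|]];
  exact: generically_neq.
Qed.

Lemma generically_shift Q (T : point E -> Prop) :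
  generically T -> generically (fun P => T (P + Q)).
Proof.
move=> [L LT]; exists (map (fun P => P - Q) L) => P PL; apply: LT.
by apply: contra PL => PL; apply/mapP; exists (P + Q); rewrite ?addrK.
Qed.

Lemma generically_opp (T : point E -> Prop) :
  generically T -> generically (fun P => T (- P)).
Proof.
move=> [L LT]; exists (map -%R L) => P PL; apply: LT.
by apply: contra PL => PL; apply/mapP; exists (- P); rewrite ?opprK.
Qed.

Lemma finite_roots u : u != 0 -> exists L : seq k, forall x, root u x -> x \in L.
Proof.
move=> u0; have [L ->] := closed_field_poly_normal u.
exists L => x; rewrite rootZ ?lead_coef_eq0 //.
by rewrite root_prod_XsubC.
Qed.

Lemma generically_root u : u != 0 -> generically (fun P : point E => u.[xc P] != 0).
Proof.
move=> /finite_roots[L uL].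
by apply: generically_impl (generically_xc L) => P; apply: contra => /eqP u0;
  apply/uL/eqP.
Qed.

Local Notation dg d := ((size (d : {poly k})).-1).

Lemma dgM d d' : d \is monic -> d' \is monic -> dg (d * d') = (dg d + dg d')%N.
Proof.
move=> dm dm'; rewrite size_monicM ?monic_neq0 //.
have := monic_neq0 dm; have := monic_neq0 dm'; rewrite -!size_poly_gt0.
by case: (size d) (size d') => [|a] [|b] //= _ _; rewrite addnS.
Qed.

Definition linear_part : {poly k} := A1 *: 'X + A3%:P.
Definition cubic_part : {poly k} := 'X^3 + A2 *: 'X^2 + A4 *: 'X + A6%:P.

Lemma weight_linear : weight_le 2 linear_part.
Proof.
apply: weight_leD; last exact: weight_leW _ (weight_leC _).
rewrite -mul_polyC; exact: (weight_leM (weight_leC _) (weight_leX _)).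
Qed.

Lemma weight_cubic : weight_le 6 cubic_part.
Proof.
have X (n : nat) : weight_le (2 * n)%N%:Z ('X^n : {poly k}).
  by have := weight_le_size ('X^n : {poly k}); rewrite size_polyXn.
have ZX (c : k) (n : nat) : weight_le (2 * n)%N%:Z (c *: 'X^n : {poly k}).
  rewrite -mul_polyC; exact: (weight_leM (weight_leC _) (X _)).
do 2![apply: weight_leD;
  last exact: weight_leW _ (ZX _ 1%N) || exact: weight_leW _ (weight_leC _)].
by apply: weight_leD; [exact: (X 3%N) | apply: weight_leW (ZX _ 2%N)].
Qed.

Lemma linear_partE x : linear_part.[x] = A1 * x + A3.
Proof. by rewrite !(hornerD, hornerZ, hornerX, hornerC). Qed.

Lemma cubic_partE x : cubic_part.[x] = x ^+ 3 + A2 * x ^+ 2 + A4 * x + A6.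
Proof. by rewrite !(hornerD, hornerZ, hornerX, hornerXn, hornerC). Qed.

Lemma curve_eq2 P : P != 0 ->
  yc P ^+ 2 = cubic_part.[xc P] - linear_part.[xc P] * yc P.
Proof.
move/curve_eq => e; rewrite linear_partE cubic_partE.
by apply: (lincomb1 (c := 1) e); ring.
Qed.

(* [f] agrees, away from the points with abscissa in [B], with the rational
   function (u(x) + v(x) y) / d(x), which has a pole of order at most [m] at
   infinity and whose other poles lie above [B]. *)
Definition ord B f m : Prop := exists d u v,
  [/\ d \is monic, forall x, root d x -> x \in B,
      weight_le ((2 * dg d)%N%:Z + m) u /\ weight_le ((2 * dg d)%N%:Z + m - 3) v
    & forall P, P != 0 -> xc P \notin B ->
        f P * d.[xc P] = u.[xc P] + v.[xc P] * yc P].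

Lemma ord_ext B f h m : (forall P, P != 0 -> xc P \notin B -> f P = h P) ->
  ord B f m -> ord B h m.
Proof.
move=> fh [d [u [v [dm dB uv f_uv]]]]; exists d, u, v; split=> // P P0 PB.
by rewrite -fh // f_uv.
Qed.

Lemma ordW B f m n : m <= n -> ord B f m -> ord B f n.
Proof.
move=> mn [d [u [v [dm dB [uw vw] f_uv]]]]; exists d, u, v; split=> //.
by split; [apply: weight_leW _ uw | apply: weight_leW _ vw]; lia.
Qed.

Lemma ord_subset B B' f m : {subset B <= B'} -> ord B f m -> ord B' f m.
Proof.
move=> BB' [d [u [v [dm dB uv f_uv]]]]; exists d, u, v; split=> //.
  by move=> x /dB/BB'.
by move=> P P0 PB; apply: f_uv => //; apply: contra PB => /BB'.
Qed.

Lemma ordM B f h m n : ord B f m -> ord B h n -> ord B (fun P => f P * h P) (m + n).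
Proof.
move=> [d [u [v [dm dB [uw vw] fE]]]] [d' [u' [v' [dm' dB' [uw' vw'] hE]]]].
exists (d * d'), (u * u' + v * v' * cubic_part),
  (u * v' + u' * v - v * v' * linear_part); split.
- exact: rpredM.
- by move=> x; rewrite rootM => /orP[/dB|/dB'].
- rewrite dgM //; split.
    apply: weight_leD; first by apply: weight_leW _ (weight_leM uw uw'); lia.
    by apply: weight_leW _ (weight_leM (weight_leM vw vw') weight_cubic); lia.
  apply: weight_leD; last first.
    by apply/weight_leN/(weight_leW _ (weight_leM
      (weight_leM vw vw') weight_linear)); lia.
  by apply: weight_leD; [apply: weight_leW _ (weight_leM uw vw')
    | apply: weight_leW _ (weight_leM uw' vw)]; lia.
move=> P P0 PB; rewrite hornerM mulrACA fE // hE //.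
move: (curve_eq2 P0); move: cubic_part linear_part => C L e.
rewrite !(hornerD, hornerN, hornerM).
by apply: (lincomb1 (c := v.[xc P] * v'.[xc P]) e); ring.
Qed.

Lemma ordD B f h m : ord B f m -> ord B h m -> ord B (fun P => f P + h P) m.
Proof.
move=> [d [u [v [dm dB [uw vw] fE]]]] [d' [u' [v' [dm' dB' [uw' vw'] hE]]]].
exists (d * d'), (u * d' + u' * d), (v * d' + v' * d); split.
- exact: rpredM.
- by move=> x; rewrite rootM => /orP[/dB|/dB'].
- have dw : weight_le (2 * dg d)%N%:Z d := weight_le_size d.
  have dw' : weight_le (2 * dg d')%N%:Z d' := weight_le_size d'.
  rewrite dgM //; split; apply: weight_leD.
  + by apply: weight_leW _ (weight_leM uw dw'); lia.
  + by apply: weight_leW _ (weight_leM uw' dw); lia.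
  + by apply: weight_leW _ (weight_leM vw dw'); lia.
  + by apply: weight_leW _ (weight_leM vw' dw); lia.
move=> P P0 PB; rewrite hornerM mulrDl mulrA fE // (mulrC d.[_]) mulrA hE //.
by rewrite !(hornerD, hornerM); ring.
Qed.

Lemma ord_poly_x B u m : weight_le m u -> ord B (fun P => u.[xc P]) m.
Proof.
move=> uw; exists 1, u, 0; split.
- exact: rpred1.
- by move=> x; rewrite (negPf (root1 x)).
- by rewrite size_poly1 /= muln0 add0r; split=> //; apply: weight_le0.
by move=> P _ _; rewrite !hornerC; ring.
Qed.

Lemma ord_const B (c : k) : ord B (fun=> c) 0.
Proof.
apply: ord_ext (ord_poly_x B (weight_leC c)) => P _ _.
by rewrite hornerC.
Qed.

Lemma ord_xc B : ord B xc 2.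
Proof.
by apply: ord_ext (ord_poly_x B (weight_leX k)) => P _ _; rewrite hornerX.
Qed.

Lemma ord_yc B : ord B yc 3.
Proof.
exists 1, 0, 1; split.
- exact: rpred1.
- by move=> x; rewrite (negPf (root1 x)).
- rewrite size_poly1 /= muln0 add0r; split; first exact: weight_le0.
  exact: (weight_leC 1).
by move=> P _ _; rewrite !hornerC; ring.
Qed.

Lemma ord_inv B (a : k) : a \in B -> ord B (fun P => (xc P - a)^-1) (-2).
Proof.
move=> aB; exists ('X - a%:P), 1, 0; split.
- exact: monicXsubC.
- by move=> x; rewrite root_XsubC => /eqP ->.
- rewrite size_XsubC; split; last exact: weight_le0.
  exact: (weight_leC 1).
move=> P _ PB; rewrite !(hornerD, hornerN, hornerX, hornerC) mulVf; first by ring.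
by rewrite subr_eq0; apply: contraNneq PB => ->.
Qed.

Lemma ordN B f m : ord B f m -> ord B (fun P => - f P) m.
Proof.
move=> fm; have := ordM (ord_const B (-1)) fm; rewrite add0r.
by apply: ord_ext => P _ _; rewrite mulN1r.
Qed.

Lemma ordX B f m (n : nat) : ord B f m -> ord B (fun P => f P ^+ n) (m * n%:Z).
Proof.
move=> fm; elim: n => [|n IH].
  by rewrite mulr0; apply: ord_ext (ord_const B 1) => P; rewrite expr0.
have -> : m * n.+1%:Z = m + m * n%:Z by lia.
by apply: ord_ext (ordM fm IH) => P _ _; rewrite exprS.
Qed.

Lemma ord_sum B (I : eqType) (r : seq I) (F : I -> point E -> k) m :
  (forall i, i \in r -> ord B (F i) m) -> ord B (fun P => \sum_(i <- r) F i P) m.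
Proof.
elim: r => [|i r IH] Fm.
  apply: (@ord_ext _ (fun=> 0)) => [P _ _|]; first by rewrite big_nil.
  exists 1, 0, 0; split; [exact: rpred1 | by move=> x; rewrite (negPf (root1 x)) | |].
    by split; apply: weight_le0.
  by move=> P _ _; rewrite !hornerC; ring.
have Fi : ord B (F i) m by apply: Fm; rewrite inE eqxx.
have Fr : ord B (fun P => \sum_(i <- r) F i P) m.
  by apply: IH => j jr; apply: Fm; rewrite inE jr orbT.
by apply: ord_ext (ordD Fi Fr) => P _ _; rewrite big_cons.
Qed.

Lemma ord_opp B f m : ord B f m -> ord B (fun P => f (- P)) m.
Proof.
move=> [d [u [v [dm dB [uw vw] fE]]]].
exists d, (u - v * linear_part), (- v); split=> //.
  split; last exact: weight_leN.
  apply: weight_leD => //; apply: weight_leN.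
  by apply: weight_leW _ (weight_leM vw weight_linear); lia.
move=> P P0 PB; rewrite -(xcN P) fE ?oppr_eq0 ?xcN // ycN //; move: (linear_partE (xc P)).
move: linear_part => L LE; rewrite !(hornerD, hornerN, hornerM) LE; ring.
Qed.

Lemma ord_horner B f (q : {poly k}) : ord B f 0 -> ord B (fun P => q.[f P]) 0.
Proof.
move=> f0; apply: (@ord_ext _ (fun P => \sum_(i < size q) q`_i * f P ^+ i)).
  by move=> P _ _; rewrite horner_coef.
apply: ord_sum => i _; rewrite -[0 in X in ord _ _ X]addr0; apply: ordM.
  exact: ord_const.
by have := ordX i f0; rewrite mul0r.
Qed.
End Functions.

Section OrderAtInfinity.
Variables (k : closedFieldType) (E : elliptic_curve k).
Implicit Types (B : seq k) (f g h : point E -> k) (P Q S T : point E) (m n : int).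
Implicit Types (d u v q s : {poly k}).

Local Notation A1 := (a1 E).
Local Notation A2 := (a2 E).
Local Notation A3 := (a3 E).
Local Notation A4 := (a4 E).
Local Notation A6 := (a6 E).
Local Notation dg d := ((size (d : {poly k})).-1).

(** [f] has a pole of order exactly 2 deg q at infinity. Hence U^2 dominates in the norm of U + v y,
    which is a nonzero polynomial in x, and away from [B] the zeros of [f] lie above its roots. *)
Lemma generically_neq0 B f q : q != 0 ->
  ord B (fun P => f P - q.[xc P]) ((2 * dg q)%N%:Z - 1) ->
  generically (fun P => f P != 0).
Proof.
move=> q0 [d [u [v [dm dB [uw vw] fE]]]].
pose U := u + q * d; pose n := U ^+ 2 - U * v * linear_part E - v ^+ 2 * cubic_part E.
have qw : weight_le (2 * dg q)%N%:Z q := weight_le_size q.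
have dw : weight_le (2 * dg d)%N%:Z d := weight_le_size d.
have [N NE] : {N | N = dg q + dg d}%N by exists (dg q + dg d)%N.
have dq : weight_le (2 * N)%N%:Z (q * d).
  by apply: weight_leW _ (weight_leM qw dw); rewrite NE; lia.
have {}uw : weight_le ((2 * N)%N%:Z - 1) u by apply: weight_leW _ uw; rewrite NE; lia.
have {}vw : weight_le ((2 * N)%N%:Z - 4) v by apply: weight_leW _ vw; rewrite NE; lia.
have Uw : weight_le (2 * N)%N%:Z U.
  by apply: weight_leD => //; apply: weight_leW _ uw; lia.
have Ulead : U`_N != 0.
  rewrite coefD uw; last by lia.
  rewrite add0r; have -> : (q * d)`_N = lead_coef (q * d).
    rewrite lead_coefE size_Mmonic // NE; congr (_`_ _).
    move: q0 (monic_neq0 dm); rewrite -!size_poly_gt0.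
    by case: (size q) (size d) => [|a] [|b] //= _ _; rewrite addnS.
  by rewrite lead_coef_Mmonic // lead_coef_eq0.
have n0 : n != 0.
  apply/eqP => n0; have : n`_(2 * N) = 0 by rewrite n0 coef0.
  have t1 : (U * v * linear_part E)`_(2 * N) = 0.
    by apply: (weight_leM (weight_leM Uw vw) (weight_linear E)); lia.
  have t2 : (v ^+ 2 * cubic_part E)`_(2 * N) = 0.
    by rewrite expr2; apply: (weight_leM (weight_leM vw vw) (weight_cubic E)); lia.
  rewrite !coefB t1 t2 !subr0 expr2 coefM (bigD1 (inord N)) //= inordK; last by lia.
  rewrite big1 ?addr0 => [/eqP|i]; last first.
    rewrite -val_eqE /= inordK; last by lia.
    move=> ne; have [lt|le] := ltnP N i; first by rewrite Uw ?mul0r //; lia.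
    have {le ne}lt : (i < N)%N by rewrite ltn_neqAle ne le.
    by rewrite [X in _ * X]Uw ?mulr0 //; lia.
  have -> : (2 * N - N = N)%N by lia.
  by rewrite mulf_eq0 orbb (negPf Ulead).
apply: generically_impl (generically_and (generically_neq (0 : point E))
  (generically_and (generically_xc E B) (generically_root E n0))).
move=> P [P0 [PB nP]]; apply: contra nP => /eqP f0; have := fE P P0 PB.
rewrite f0 sub0r => e.
have e' : U.[xc P] = - v.[xc P] * yc P.
  by rewrite /U hornerD hornerM; apply: (lincomb1 (c := -1) e); ring.
move: (curve_eq2 P0); rewrite /n;
  move: (cubic_part E) (linear_part E) U e' {n n0 Uw Ulead} => C L U UE cE.
rewrite !(hornerD, hornerN, hornerM, hornerXn, horner_exp) UE; apply/eqP.
by apply: (lincomb1 (c := v.[xc P] ^+ 2) cE); ring.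
Qed.

(** * Translation by a fixed point, expanded at infinity *)

Section AdditionFormula.
Variables P T : point E.
Hypotheses (P0 : P != 0) (T0 : T != 0) (PT : xc P != xc T).

Let opp : ~ (xc P = xc T /\ yc P = neg_y E (xc T) (yc T)).
Proof. by move=> [e _]; move: PT; rewrite e eqxx. Qed.

Definition tangent_x S : k := 3 * xc S ^+ 2 + 2 * A2 * xc S + A4 - A1 * yc S.
Definition tangent_y S : k := 2 * yc S + A1 * xc S + A3.

Let chord := (yc P - yc T) / (xc P - xc T).

Lemma val_add_chord : val (P + T) =
  Some (chord ^+ 2 + A1 * chord - A2 - xc P - xc T,
   neg_y E (chord ^+ 2 + A1 * chord - A2 - xc P - xc T)
     (chord * (chord ^+ 2 + A1 * chord - A2 - xc P - xc T - xc P) + yc P)).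
Proof.
have oP : on_curve E (Some (xc P, yc P)) by rewrite -(val_affine P0) (valP P).
have oT : on_curve E (Some (xc T, yc T)) by rewrite -(val_affine T0) (valP T).
have := raw_addE opp oP oT (slopeP oP oT opp).
have -> : slope E (xc P) (yc P) (xc T) (yc T) = chord.
  rewrite /slope (negPf PT) /chord -(opprB (xc P)) invrN mulrN -mulNr opprB.
  by [].
by rewrite -(val_affine P0) -(val_affine T0).
Qed.

Lemma xc_add : xc (P + T) = chord ^+ 2 + A1 * chord - A2 - xc P - xc T.
Proof. exact: xcE val_add_chord. Qed.

(** Sorted by order at infinity: [i] counts for -2 and y for 3, so that x(P + T) - x(T) visibly
    vanishes as P tends to infinity. [yc_add_shift] has the same purpose. *)
Lemma xc_add_shift (i := (xc P - xc T)^-1) :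
  xc (P + T) = xc T + tangent_x T * i - tangent_y T * (yc P - yc T) * i ^+ 2.
Proof.
have d0 : xc P - xc T != 0 by rewrite subr_eq0.
rewrite xc_add /chord /i /tangent_x /tangent_y.
by apply: (lincomb2 (c := i ^+ 2) (c' := - i ^+ 2) (curve_eq P0) (curve_eq T0));
  rewrite /i; field.
Qed.

Lemma yc_add_shift (i := (xc P - xc T)^-1) (Y := yc P - yc T) :
  yc (P + T) = yc T - tangent_x T * Y * i ^+ 2 - A1 * tangent_x T * i
    + (3 * xc T + A2) * tangent_y T * i + tangent_y T * tangent_x T * i ^+ 2
    - tangent_y T ^+ 2 * Y * i ^+ 3.
Proof.
have d0 : xc P - xc T != 0 by rewrite subr_eq0.
rewrite (ycE val_add_chord) /neg_y /Y /chord /i /tangent_x /tangent_y.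
pose c := i ^+ 3 * (tangent_y T - Y) - A1 * i ^+ 2.
by apply: (lincomb2 (c := c) (c' := - c) (curve_eq P0) (curve_eq T0));
  rewrite /c /i /Y /tangent_y; field.
Qed.
End AdditionFormula.

Lemma ordD_max B f h m n : ord B f m -> ord B h n ->
  ord B (fun P => f P + h P) (Order.max m n).
Proof.
by move=> fm hn; apply: ordD; [apply: ordW _ fm | apply: ordW _ hn];
  rewrite le_max lexx ?orbT.
Qed.

Lemma ordB_max B f h m n : ord B f m -> ord B h n ->
  ord B (fun P => f P - h P) (Order.max m n).
Proof. by move=> fm /ordN; apply: ordD_max. Qed.

End OrderAtInfinity.

(** Bounds an order from the shape of the expression. Orders of other atoms are taken from the
    context, which is why they are introduced before each call; [ord_tac] then decides an inequality
    between integer constants by computation. *)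
Ltac ord_rec :=
  first
  [ eassumption | exact: ord_const | exact: ord_xc | exact: ord_yc
  | apply: ord_inv; rewrite ?inE ?eqxx ?orbT //; done
  | refine (ordX _ _); ord_rec
  | refine (ordN _); ord_rec
  | refine (ordM _ _); ord_rec
  | refine (ordB_max _ _); ord_rec
  | refine (ordD_max _ _); ord_rec ].

Ltac ord_tac := refine (ordW _ _); [ | ord_rec ]; [vm_compute; reflexivity].

(** * Rigidity: functions without poles that vanish at infinity *)

Section EvenRigidity.
Variables (k : closedFieldType) (E : elliptic_curve k).
Implicit Types (B : seq k) (f g h : point E -> k) (P Q S T : point E) (m n : int).
Implicit Types (d u v q s : {poly k}).

Local Notation A1 := (a1 E).
Local Notation A2 := (a2 E).
Local Notation A3 := (a3 E).
Local Notation A4 := (a4 E).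
Local Notation A6 := (a6 E).
Local Notation dg d := ((size (d : {poly k})).-1).

Lemma ord_xc_add T : T != 0 -> ord [:: xc T] (fun P => xc (P + T) - xc T) (-1).
Proof.
move=> T0; apply: (@ord_ext _ _ _ (fun P => tangent_x T * (xc P - xc T)^-1
    - tangent_y T * (yc P - yc T) * (xc P - xc T)^-1 ^+ 2)).
  by move=> P P0; rewrite inE => PT; rewrite xc_add_shift //; ring.
ord_tac.
Qed.

Lemma ord_yc_add T : T != 0 -> ord [:: xc T] (fun P => yc (P + T) - yc T) (-1).
Proof.
move=> T0; apply: (@ord_ext _ _ _ (fun P =>
    - tangent_x T * (yc P - yc T) * (xc P - xc T)^-1 ^+ 2 - A1 * tangent_x T * (xc P
      - xc T)^-1
    + (3 * xc T + A2) * tangent_y T * (xc P - xc T)^-1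
    + tangent_y T * tangent_x T * (xc P - xc T)^-1 ^+ 2
    - tangent_y T ^+ 2 * (yc P - yc T) * (xc P - xc T)^-1 ^+ 3)).
  by move=> P P0; rewrite inE => PT; rewrite yc_add_shift //; ring.
ord_tac.
Qed.

(* A pole of s/d at b would make s(x(P + S)) = d(x(P + S)) g(P + S) tend both
   to s(b) and to 0 as P tends to infinity, S being a point above b. *)
Lemma even_rigidity B g d s : d \is monic -> (forall x, root d x -> x \in B) ->
    weight_le ((2 * dg d)%N%:Z - 1) s ->
    (forall P, P != 0 -> xc P \notin B -> g P * d.[xc P] = s.[xc P]) ->
    (forall S, S != 0 -> xc S \in B -> exists B', ord B' (fun P => g (P + S)) 0) ->
  s = 0.
Proof.
move=> dm dB sw gE gS; apply/eqP/negP => /negP s0.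
have d0 := monic_neq0 dm.
(* In lowest terms s / d has a nonconstant denominator, because deg s < deg d; the numerator does
   not vanish at a root [b] of it. *)
pose c := gcdp s d; pose s' := s %/ c; pose d' := d %/ c.
have sE : s = s' * c by rewrite divpK ?dvdp_gcdl.
have dE : d = d' * c by rewrite divpK ?dvdp_gcdr.
have c0 : c != 0 by rewrite gcdp_eq0 negb_and s0.
have d'0 : d' != 0 by apply: contraNneq d0 => z; rewrite dE z mul0r.
have s'0 : s' != 0 by apply: contraNneq s0 => z; rewrite sE z mul0r.
have sd : (size s < size d)%N.
  have : (size s <= dg d)%N by apply: size_weight_le sw; lia.
  by move/leq_ltn_trans; apply; rewrite prednK ?size_poly_gt0.
have /closed_rootP[b db] : size d' != 1%N.
  apply: contraTneq sd => d1; rewrite sE dE !size_mul // d1 -leqNgt add1n /=.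
  by rewrite -ltnS prednK ?addn_gt0 ?size_poly_gt0 ?s'0 // -add1n leq_add2r size_poly_gt0.
have s'b : s'.[b] != 0.
  have cop : coprimep s' d' by rewrite coprimep_div_gcd ?s0.
  by rewrite -rootE; apply: (coprimep_root _ db); rewrite coprimep_sym.
have bB : b \in B by apply: dB; rewrite dE rootM db.
have [S S0 Sb] := point_at E b.
have [B' gSB] : exists B', ord B' (fun P => g (P + S)) 0 by apply: gS; rewrite ?Sb.
pose B2 := b :: B'.
have {gSB}ord_g : ord B2 (fun P => g (P + S)) 0.
  by apply: (ord_subset _ gSB) => x xB; rewrite inE xB orbT.
have ord_x1 : ord B2 (fun P => xc (P + S) - b) (-1).
  have o := ord_xc_add S0; rewrite Sb in o; apply: (ord_subset _ o) => x.
  by rewrite !inE => /eqP ->; rewrite eqxx.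
have ord_x : ord B2 (fun P => xc (P + S)) 0.
  have o : ord B2 (fun P => (xc (P + S) - b) + b) 0 by ord_tac.
  by apply: ord_ext o => P _ _; rewrite subrK.
have ord_sub q : ord B2 (fun P => q.[xc (P + S)] - q.[b]) (-1).
  have /factor_theorem[q' q'E] : root (q - q.[b]%:P) b.
    by rewrite rootE !(hornerD, hornerN, hornerC) subrr.
  have o : ord B2 (fun P => q'.[xc (P + S)] * (xc (P + S) - b)) (-1).
    have oq := ord_horner q' ord_x; exact: ordM oq ord_x1.
  apply: ord_ext o => P _ _.
  have -> : q = q' * ('X - b%:P) + q.[b]%:P by rewrite -q'E subrK.
  by rewrite !(hornerD, hornerN, hornerM, hornerX, hornerC); ring.
have ord_d : ord B2 (fun P => d'.[xc (P + S)]) (-1).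
  by apply: ord_ext (ord_sub d') => P _ _; rewrite (eqP db) subr0.
pose f P := s'.[xc (P + S)] - g (P + S) * d'.[xc (P + S)].
have fN : generically (fun P => f P != 0).
  apply: (@generically_neq0 _ _ B2 _ (s'.[b]%:P)); first by rewrite polyC_eq0.
  have := ord_sub s' => os.
  have o : ord B2 (fun P =>
    (s'.[xc (P + S)] - s'.[b]) - g (P + S) * d'.[xc (P + S)]) (-1) by ord_tac.
  apply: (ordW _ (ord_ext _ o)); first by rewrite size_polyC s'b.
  by move=> P _ _; rewrite /f hornerC; ring.
have f0 : generically (fun P => f P = 0).
  have g1 : generically (fun P => P + S != 0) :=
    generically_shift S (generically_neq (0 : point E)).
  have g2 : generically (fun P => xc (P + S) \notin B) :=
    generically_shift S (generically_xc E B).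
  have g3 : generically (fun P => c.[xc (P + S)] != 0) :=
    generically_shift S (generically_root E c0).
  apply: generically_impl (generically_and g1 (generically_and g2 g3)) => P [P1 [P2 P3]].
  apply: (mulIf P3); have := gE _ P1 P2.
  rewrite {1}dE {1}sE !hornerM mul0r /f => e.
  by apply: (lincomb1 (c := -1) e); ring.
have [P [/eqP fP]] := generically_point (generically_and fN f0).
by [].
Qed.

Lemma rigidity B h : ord B h (-1) ->
    (forall S, S != 0 -> xc S \in B -> exists B', ord B' (fun P => h (P + S)) 0) ->
  forall P, P != 0 -> xc P \notin B -> h P = 0.
Proof.
move=> [d [u [v [dm dB [uw vw] hE]]]] hS.
have hSN S : S != 0 -> xc S \in B ->
    exists B', ord B' (fun P => h (P + S)) 0 /\ ord B' (fun P => h (- (P + S))) 0.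
  move=> S0 SB; have [B1 h1] := hS S S0 SB.
  have [B2 h2] : exists B2, ord B2 (fun P => h (P - S)) 0.
    by apply: hS; rewrite ?oppr_eq0 ?xcN.
  exists (B1 ++ B2); split.
    by apply: (ord_subset _ h1) => x; rewrite mem_cat => ->.
  have {}h2 : ord (B1 ++ B2) (fun P => h (P - S)) 0.
    by apply: (ord_subset _ h2) => x; rewrite mem_cat => ->; rewrite orbT.
  by apply: ord_ext (ord_opp h2) => P _ _; rewrite opprD.
have hNE P : P != 0 -> xc P \notin B -> h (- P) * d.[xc P]
    = u.[xc P] - v.[xc P] * (linear_part E).[xc P] - v.[xc P] * yc P.
  move=> P0 PB; rewrite -{1}(xcN P) hE ?oppr_eq0 ?xcN // ycN //.
  by rewrite linear_partE; ring.
have lw := weight_linear E; have cw := weight_cubic E.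
have tr0 : u + u - v * linear_part E = 0.
  apply: (@even_rigidity B (fun P => h P + h (- P)) d) => //.
  - apply: weight_leD; first exact: weight_leD.
    by apply/weight_leN/(weight_leW _ (weight_leM vw lw)); lia.
  - move=> P P0 PB; rewrite mulrDl hE // hNE //.
    by rewrite !(hornerD, hornerN, hornerM); ring.
  by move=> S S0 SB; have [B' [? ?]] := hSN S S0 SB; exists B'; apply: ordD.
have nm0 : u ^+ 2 - u * v * linear_part E - v ^+ 2 * cubic_part E = 0.
  apply: (@even_rigidity B (fun P => h P * h (- P)) (d * d)) => //.
  - exact: rpredM.
  - by move=> x; rewrite rootM orbb; apply: dB.
  - rewrite dgM // !expr2; apply: weight_leD; first apply: weight_leD.
    + by apply: weight_leW _ (weight_leM uw uw); lia.
    + by apply/weight_leN/(weight_leW _ (weight_leM (weight_leM uw vw) lw)); lia.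
    + by apply/weight_leN/(weight_leW _ (weight_leM (weight_leM vw vw) cw)); lia.
  - move=> P P0 PB; rewrite hornerM mulrACA hE // hNE //.
    move: (curve_eq2 P0); move: (cubic_part E) (linear_part E) => C L cE.
    rewrite !(hornerD, hornerN, hornerM, horner_exp).
    by apply: (lincomb1 (c := - v.[xc P] ^+ 2) cE); ring.
  move=> S S0 SB; have [B' [? ?]] := hSN S S0 SB; exists B'.
  by rewrite -[0]addr0; apply: ordM.
move=> P P0 PB; have dP : d.[xc P] != 0 by apply: contra PB => dP; apply: dB.
(* [h] is a root of the polynomial Z^2 - trace Z + norm, which has become Z^2. *)
apply: (mulIf dP); rewrite mul0r; suff /eqP : (h P * d.[xc P]) ^+ 2 = 0.
  by rewrite expf_eq0 => /eqP.
have e1 := hE P P0 PB; have e2 := hNE P P0 PB.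
have t : (u + u - v * linear_part E).[xc P] = 0 by rewrite tr0 horner0.
have n : (u ^+ 2 - u * v * linear_part E - v ^+ 2 * cubic_part E).[xc P] = 0
  by rewrite nm0 horner0.
move: (curve_eq2 P0) t n e1 e2; move: (cubic_part E) (linear_part E) => C L.
rewrite !(hornerD, hornerN, hornerM, horner_exp) => cE t n -> _.
by apply: (lincomb3 (c := v.[xc P] ^+ 2) (c' := u.[xc P] + v.[xc P] * yc P) (c'' :=
  -1) cE t n); ring.
Qed.
End EvenRigidity.

(** * Velu's isogeny *)

Section PointSlope.
Variables (k : closedFieldType) (E : elliptic_curve k).
Implicit Types P Q R S T : point E.

Definition pslope P Q : k := slope E (xc P) (yc P) (xc Q) (yc Q).

Lemma pslope_rel P Q : P != 0 -> Q != 0 -> P + Q != 0 ->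
  slope_rel E (xc P) (yc P) (xc Q) (yc Q) (pslope P Q)
  /\ ~ (xc P = xc Q /\ yc P = neg_y E (xc Q) (yc Q)).
Proof.
move=> P0 Q0 PQ.
have nopp : ~ (xc P = xc Q /\ yc P = neg_y E (xc Q) (yc Q)).
  move=> [ex ey]; move/eqP: PQ; apply; apply/eqP; rewrite addr_eq0; apply/eqP.
  by apply: point_ext; rewrite ?oppr_eq0 ?xcN ?ycN.
split=> //; apply: slopeP => //.
  by rewrite -(val_affine P0) (valP P).
by rewrite -(val_affine Q0) (valP Q).
Qed.

Lemma val_add P Q (m := pslope P Q) (x := m ^+ 2 + a1 E * m - a2 E - xc P - xc Q) :
    P != 0 -> Q != 0 -> P + Q != 0 ->
  val (P + Q) = Some (x, neg_y E x (m * (x - xc P) + yc P)).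
Proof.
move=> P0 Q0 PQ; have [rel nopp] := pslope_rel P0 Q0 PQ.
have oP : on_curve E (Some (xc P, yc P)) by rewrite -(val_affine P0) (valP P).
have oQ : on_curve E (Some (xc Q, yc Q)) by rewrite -(val_affine Q0) (valP Q).
have := raw_addE nopp oP oQ rel.
by rewrite -(val_affine P0) -(val_affine Q0).
Qed.

Lemma pslope_cocycle P Q R : P != 0 -> Q != 0 -> R != 0 ->
    P + Q != 0 -> Q + R != 0 -> P + Q + R != 0 ->
  pslope P Q + pslope (P + Q) R = pslope Q R + pslope P (Q + R).
Proof.
move=> P0 Q0 R0 PQ QR PQR.
have on T : T != 0 -> on_curve E (Some (xc T, yc T)).
  by move=> T0; rewrite -(val_affine T0) (valP T).
have add S T : S != 0 -> T != 0 -> S + T != 0 ->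
    raw_add E (Some (xc S, yc S)) (Some (xc T, yc T)) = Some (xc (S + T), yc (S + T)).
  by move=> S0 T0 ST; rewrite -(val_affine S0) -(val_affine T0) -(val_affine ST).
by have [] := raw_add_cocycle (on _ P0) (on _ Q0) (on _ R0) (add _ _ P0 Q0 PQ)
  (add _ _ Q0 R0 QR) (add _ _ PQ R0 PQR).
Qed.

Lemma pslope_third P Q : P != 0 -> Q != 0 -> P + Q != 0 ->
  pslope (- (P + Q)) Q = pslope P Q.
Proof.
move=> P0 Q0 PQ; have [rel _] := pslope_rel P0 Q0 PQ.
have rel3 := slope_rel_third rel.
have NPQ : - (P + Q) != 0 by rewrite oppr_eq0.
have NP : - (P + Q) + Q != 0 by rewrite opprD addrNK oppr_eq0.
have [rel' nopp'] := pslope_rel NPQ Q0 NP.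
apply: (slope_uniq nopp' rel'); rewrite xcN ycN //.
have v := val_add P0 Q0 PQ; rewrite (xcE v) (ycE v) /neg_y.
move: rel3; set y3 := _ + yc P; set x3 := _ - xc Q.
by congr (slope_rel _ _ _ _ _ _); rewrite /y3 -/x3; ring.
Qed.

Lemma pslope_chord P Q : xc P != xc Q ->
  pslope P Q = (yc P - yc Q) * (xc P - xc Q)^-1.
Proof.
move=> ne; rewrite /pslope /slope (negPf ne) -opprB -(opprB (xc P)).
by rewrite invrN mulrN mulNr opprK.
Qed.
End PointSlope.

Lemma sum_pairs (V : zmodType) (f : nat -> V) (d : nat) :
  \sum_(1 <= i < d) f i = \sum_(1 <= i < uphalf d) (f i + f (d - i)%N)
    + (if odd d || (d == 0)%N then 0 else f d./2).
Proof.
case: (posnP d) => [->|d0]; first by rewrite !big_geq // addr0.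
have dE := odd_double_half d; rewrite -mul2n in dE.
have uE : uphalf d = (odd d + d./2)%N by rewrite uphalf_half.
have u1 : (1 <= uphalf d)%N by rewrite uE; lia.
have u2 : (uphalf d <= d)%N by rewrite uE; lia.
rewrite big_split /= (big_cat_nat u1 u2) /=.
rewrite -!addrA; congr (_ + _).
have -> : \sum_(uphalf d <= i < d) f i
    = \sum_(d./2.+1 <= i < d) f i + (if odd d then 0 else f d./2).
  have lt : (d./2 < d)%N by lia.
  rewrite uE; case: (odd d); first by rewrite add1n addr0.
  by rewrite add0n (big_ltn lt) addrC.
rewrite orbF; congr (_ + _); rewrite -(add1n d./2) big_addn.
have -> : (d - d./2 = uphalf d)%N by rewrite uE; lia.
rewrite big_nat_rev /= big_nat [RHS]big_nat; apply: eq_bigr => i /andP[i0 im].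
by congr f; rewrite uE in im *; lia.
Qed.

Section Velu.
Variables (k : closedFieldType) (E : elliptic_curve k) (G : point E) (N : nat).
Hypotheses (N0 : (0 < N)%N) (GN : G *+ N = 0)
  (G_order : forall m, (0 < m < N)%N -> G *+ m != 0)
  (N_odd_or_char : odd N \/ 2 != 0 :> k).
Implicit Types (P Q S T : point E) (F : point E -> k).

Local Notation A1 := (a1 E).
Local Notation A2 := (a2 E).
Local Notation A3 := (a3 E).
Local Notation A4 := (a4 E).
Local Notation A6 := (a6 E).

Definition in_kernel P : Prop := exists i, P = G *+ i.

Lemma in_kernelP P : in_kernel P -> exists2 i, (i < N)%N & P = G *+ i.
Proof.
move=> [i ->]; exists (i %% N)%N; first by rewrite ltn_mod.
by rewrite {1}(divn_eq i N) mulrnDr mulnC mulrnA GN mul0rn add0r.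
Qed.

Lemma in_kernel0 : in_kernel 0. Proof. by exists 0%N. Qed.

Lemma in_kernelD P Q : in_kernel P -> in_kernel Q -> in_kernel (P + Q).
Proof. by move=> [i ->] [j ->]; exists (i + j)%N; rewrite mulrnDr. Qed.

Lemma kernel_opp i : (i <= N)%N -> - (G *+ i) = G *+ (N - i).
Proof. by move=> iN; rewrite mulrnBr // GN sub0r. Qed.

Lemma in_kernelN P : in_kernel (- P) <-> in_kernel P.
Proof.
suff H Q : in_kernel Q -> in_kernel (- Q) by split=> /H; rewrite ?opprK.
by move=> /in_kernelP[i /ltnW iN ->]; exists (N - i)%N; rewrite kernel_opp.
Qed.

Lemma in_kernelDr P Q : in_kernel Q -> in_kernel (P + Q) <-> in_kernel P.
Proof.
move=> CQ; split=> [CPQ|CP]; last exact: in_kernelD.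
by rewrite -(addrK Q P); apply: in_kernelD => //; apply/in_kernelN.
Qed.

Definition kernel_xs : seq k := [seq xc (G *+ i) | i <- index_iota 1 N].

Lemma kernel_xsP P : P != 0 -> (xc P \in kernel_xs) <-> in_kernel P.
Proof.
move=> P0; split=> [/mapP[i]|].
  rewrite mem_index_iota => iN Px; have Gi := G_order iN.
  have [->|->] := same_xc P0 Gi Px; first by exists i.
  by apply/in_kernelN; exists i.
move=> /in_kernelP[i iN PE]; apply/mapP; exists i; rewrite ?PE //.
by rewrite mem_index_iota iN andbT lt0n; apply: contraNneq P0 => i0; rewrite PE i0.
Qed.

Lemma kernel_xs_mem i : (i \in index_iota 1 N) -> xc (G *+ i) \in kernel_xs.
Proof. exact: map_f. Qed.

Lemma kernel_sum_opp F : \sum_(1 <= i < N) F (- (G *+ i)) = \sum_(1 <= i < N) F (G *+ i).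
Proof.
rewrite [RHS]big_nat_rev /= big_nat [RHS]big_nat; apply: eq_bigr => i /andP[i0 iN].
by rewrite kernel_opp ?(ltnW iN) // add1n subSS.
Qed.

Lemma kernel_sum0_opp F : \sum_(0 <= i < N) F (- (G *+ i)) = \sum_(0 <= i < N) F (G *+ i).
Proof. by rewrite !(big_ltn N0) kernel_sum_opp oppr0. Qed.

Lemma kernel_sum_shift F P i :
  \sum_(0 <= j < N) F (P + G *+ i + G *+ j) = \sum_(0 <= j < N) F (P + G *+ j).
Proof.
elim: i => [|i IH]; first by rewrite addr0.
rewrite -IH; pose f j := F (P + G *+ i + G *+ j).
have e : \sum_(0 <= j < N) F (P + G *+ i.+1 + G *+ j) = \sum_(0 <= j < N) f j.+1.
  by apply: eq_bigr => j _; rewrite /f [G *+ i.+1]mulrSr [G *+ j.+1]mulrS !addrA.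
rewrite e; apply: (@addrI _ (f 0%N)).
have fN : f N = f 0%N by rewrite /f GN.
by rewrite -big_nat_recl // big_nat_recr //= addrC fN.
Qed.

(** For odd N the nonzero elements pair off as T and - T. For even N one of them is its own
    opposite; there twice the sum is 0, and 2 is invertible. *)
Lemma kernel_sum_odd F : (forall i, (0 < i < N)%N -> F (- (G *+ i)) = - F (G *+ i)) ->
  \sum_(1 <= i < N) F (G *+ i) = 0.
Proof.
move=> Fodd; case: N_odd_or_char => [oN|two0]; last first.
  apply: (mulfI two0); rewrite mulr0 mulr_natl mulr2n -{1}kernel_sum_opp -big_split /=.
  by rewrite big_nat big1 // => i iN; rewrite Fodd // addNr.
rewrite sum_pairs oN addr0 big_nat big1 // => i /andP[i0 iN].
have lt : (i < N)%N by have := odd_double_half N;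
  rewrite oN uphalf_half oN -mul2n in iN *; lia.
by rewrite -kernel_opp ?(ltnW lt) // Fodd ?subrr // i0.
Qed.

Definition velu_t : k := \sum_(1 <= i < N) tangent_x (G *+ i).
Definition velu_w : k := \sum_(1 <= i < N)
  (tangent_y (G *+ i) * yc (G *+ i) + xc (G *+ i) * tangent_x (G *+ i)).

(* Velu's formulas. Summing over all nonzero T in the kernel, instead of over
   representatives modulo T ~ - T and the 2-torsion, makes t and w uniform:
   psi_T y_T + psi_{-T} y_{-T} = psi_T^2. *)
Definition velu : weierstrass k :=
  Weierstrass A1 A2 A3 (A4 - 5 * velu_t) (A6 - b2 E * velu_t - 7 * velu_w).

Definition velu_x P : k :=
  \sum_(0 <= i < N) xc (P + G *+ i) - \sum_(1 <= i < N) xc (G *+ i).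
Definition velu_y P : k :=
  \sum_(0 <= i < N) yc (P + G *+ i) - \sum_(1 <= i < N) yc (G *+ i).

Lemma velu_xD P T : in_kernel T -> velu_x (P + T) = velu_x P.
Proof. by move=> [i ->]; rewrite /velu_x kernel_sum_shift. Qed.

Lemma velu_yD P T : in_kernel T -> velu_y (P + T) = velu_y P.
Proof. by move=> [i ->]; rewrite /velu_y kernel_sum_shift. Qed.

Lemma velu_xN P : velu_x (- P) = velu_x P.
Proof.
rewrite /velu_x; congr (_ - _).
rewrite -[LHS](kernel_sum0_opp (fun T => xc (- P + T))).
by apply: eq_bigr => i _; rewrite -opprD xcN.
Qed.

Lemma notin_kernelD P i : ~ in_kernel P -> P + G *+ i != 0.
Proof.
move=> CP; apply/eqP => e; apply: CP.
by apply/(in_kernelDr P (ex_intro _ i erefl)); rewrite e; apply: in_kernel0.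
Qed.

Lemma velu_yN P : ~ in_kernel P -> velu_y (- P) = neg_y E (velu_x P) (velu_y P).
Proof.
move=> CP; rewrite /neg_y /velu_x /velu_y.
rewrite -[X in X - _ = _](kernel_sum0_opp (fun T => yc (- P + T))).
rewrite -[X in _ - X = _](kernel_sum_opp (@yc k E)).
rewrite (eq_bigr (fun i => - yc (P + G *+ i) - A1 * xc (P + G *+ i) - A3)); last first.
  by move=> i _; rewrite -opprD ycN ?notin_kernelD.
rewrite [X in _ - X = _](_ : _ = \sum_(1 <= i < N) (- yc (G *+ i) - A1 * xc (G *+ i)
  - A3)); last first.
  by rewrite big_nat [RHS]big_nat; apply: eq_bigr => i iN; rewrite ycN ?G_order.
rewrite !sumrB !sumrN -!mulr_sumr !sumr_const_nat subn0 subn1.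
(* The first sum has N terms and the second N - 1: exactly one a3 survives, as the negation formula
   requires. *)
have -> : A3 *+ N = A3 + A3 *+ N.-1 by rewrite -mulrS prednK.
ring.
Qed.

Lemma velu_x_shift P : P != 0 ->
  velu_x P = xc P + \sum_(1 <= i < N) (xc (P + G *+ i) - xc (G *+ i)).
Proof. by move=> P0; rewrite /velu_x (big_ltn N0) addr0 sumrB addrA. Qed.

Lemma velu_y_shift P : P != 0 ->
  velu_y P = yc P + \sum_(1 <= i < N) (yc (P + G *+ i) - yc (G *+ i)).
Proof. by move=> P0; rewrite /velu_y (big_ltn N0) addr0 sumrB addrA. Qed.

Lemma tangent_yN T : T != 0 -> tangent_y (- T) = - tangent_y T.
Proof. by move=> T0; rewrite /tangent_y xcN ycN //; ring. Qed.

Lemma kernel_neq P i : P != 0 -> xc P \notin kernel_xs -> i \in index_iota 1 N ->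
  [/\ G *+ i != 0, xc P != xc (G *+ i) & xc P - xc (G *+ i) != 0].
Proof.
move=> P0 PB iN; have ne : xc P != xc (G *+ i).
  by apply: contra PB => /eqP ->; apply: kernel_xs_mem.
split=> //; last by rewrite subr_eq0.
by apply: G_order; rewrite mem_index_iota in iN.
Qed.

Definition velu_dx P : k := \sum_(1 <= i < N)
  (tangent_x (G *+ i) * (xc P - xc (G *+ i))^-1
   + tangent_y (G *+ i) * yc (G *+ i) * (xc P - xc (G *+ i))^-1 ^+ 2).

(** The terms in y_P are odd in T and cancel. What is left is a function of x_P alone, which
    separability needs, and has order -2 at infinity instead of -1. *)
Lemma velu_xE P : P != 0 -> xc P \notin kernel_xs -> velu_x P = xc P + velu_dx P.
Proof.
move=> P0 PB; rewrite velu_x_shift //; congr (_ + _); apply/eqP.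
rewrite -subr_eq0 -sumrB; apply/eqP.
rewrite -[RHS](kernel_sum_odd (F := fun T =>
    - yc P * (tangent_y T * (xc P - xc T)^-1 ^+ 2))); last first.
  by move=> i iN; rewrite tangent_yN ?G_order // xcN; ring.
rewrite big_seq [RHS]big_seq; apply: eq_bigr => i iN.
have [T0 ne _] := kernel_neq P0 PB iN.
by rewrite xc_add_shift //; ring.
Qed.

Lemma ord_velu_dx : ord kernel_xs velu_dx (-2).
Proof.
apply: ord_sum => i iN; have iB := kernel_xs_mem iN.
have o := ord_inv E iB.
ord_tac.
Qed.

Definition velu_dy P : k := \sum_(1 <= i < N) (yc (P + G *+ i) - yc (G *+ i)).

Lemma ord_velu_dy : ord kernel_xs velu_dy (-1).
Proof.
apply: ord_sum => i iN; have iB := kernel_xs_mem iN.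
have T0 : G *+ i != 0 by apply: G_order; rewrite mem_index_iota in iN.
apply: (ord_subset _ (ord_yc_add T0)) => x.
by rewrite inE => /eqP ->.
Qed.

Lemma velu_yE P : P != 0 -> velu_y P = yc P + velu_dy P.
Proof. exact: velu_y_shift. Qed.

Lemma kernel_xsN P : ~ in_kernel P -> P != 0 /\ xc P \notin kernel_xs.
Proof.
move=> CP; have P0 : P != 0 by apply/eqP => P0; apply: CP; rewrite P0; exact: in_kernel0.
by split=> //; apply/negP => /(kernel_xsP P0).
Qed.

Definition velu_eqn P : k :=
  velu_y P ^+ 2 + A1 * velu_x P * velu_y P + A3 * velu_y P
  - (velu_x P ^+ 3 + A2 * velu_x P ^+ 2 + (A4 - 5 * velu_t) * velu_x P
     + (A6 - b2 E * velu_t - 7 * velu_w)).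

Section Remainder.
Variables (x y a b g psi : k).
Let i := (x - a)^-1.
Let Y := y - b.
Let c := 3 * a + A2.
Let e := 3 * a ^+ 2 + 2 * A2 * a.

(** Every term has order at most -1 at infinity, [i] counting for -2 and [Y] for 3. *)
Definition velu_rem : k :=
  - 2 * g ^+ 2 * i + 4 * g * psi * Y * i ^+ 2 - 2 * psi ^+ 2 * c * i
  - 2 * psi ^+ 2 * g * i ^+ 2 + 2 * A1 * psi ^+ 2 * Y * i ^+ 2
  + 2 * psi ^+ 3 * Y * i ^+ 3 + A1 * psi * g * i - A1 * psi ^+ 2 * Y * i ^+ 2
  - g * psi * Y * i ^+ 2 - A1 * g * psi * i + c * psi ^+ 2 * i
  + psi ^+ 2 * g * i ^+ 2 - psi ^+ 3 * Y * i ^+ 3 - A1 * psi * g * i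
  + A1 * psi ^+ 2 * Y * i ^+ 2 + A1 * b * g * i - A1 * b * psi * Y * i ^+ 2
  - e * g * i + e * psi * Y * i ^+ 2 - (4 * c + A1 ^+ 2) * psi * b * i.
End Remainder.

(** The part of the Weierstrass equation that is linear in the increments of x and y due to T, apart
    from a term in a4 of negative order. The multiples 5 t, b2 t and 7 w in Velu's coefficients
    cancel what it has of order at least 0, up to terms odd in T, which vanish on summation. *)
Lemma velu_summand P T : P != 0 -> T != 0 -> xc P != xc T ->
  (2 * yc P + A1 * xc P + A3) * (yc (P + T) - yc T)
   + (A1 * yc P - 3 * xc P ^+ 2 - 2 * A2 * xc P) * (xc (P + T) - xc T)
   + 5 * tangent_x T * xc P + b2 E * tangent_x T
   + 7 * (tangent_y T * yc T + xc T * tangent_x T)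
  = tangent_y T * (- A1 * (xc P - xc T) + 3 * yc P
      + (12 * xc T + 4 * A2 + A1 ^+ 2) * yc P * (xc P - xc T)^-1
      - 2 * (A1 * xc T + A3))
    + velu_rem (xc P) (yc P) (xc T) (yc T) (tangent_x T) (tangent_y T).
Proof.
move=> P0 T0 ne; rewrite xc_add_shift // yc_add_shift // /velu_rem.
have d0 : xc P - xc T != 0 by rewrite subr_eq0.
pose c := - 2 * tangent_x T * (xc P - xc T)^-1 ^+ 2
   - 2 * tangent_y T ^+ 2 * (xc P - xc T)^-1 ^+ 3
   - A1 * tangent_y T * (xc P - xc T)^-1 ^+ 2.
apply: (lincomb2 (c := c) (c' := - c) (curve_eq P0) (curve_eq T0)).
rewrite /c /tangent_x /tangent_y /b2.
by field.
Qed.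

Lemma ord_velu_eqn : ord kernel_xs velu_eqn (-1).
Proof.
have ox := ord_velu_dx; have oy := ord_velu_dy.
pose R P := \sum_(1 <= i < N) velu_rem (xc P) (yc P) (xc (G *+ i)) (yc (G *+ i))
  (tangent_x (G *+ i)) (tangent_y (G *+ i)).
have oR : ord kernel_xs R (-1).
  apply: ord_sum => i iN; have iB := kernel_xs_mem iN; have o := ord_inv E iB.
  rewrite /velu_rem; ord_tac.
apply: (@ord_ext _ _ _ (fun P => R P + (velu_dy P ^+ 2 + A1 * velu_dx P * velu_dy P
   - 3 * xc P * velu_dx P ^+ 2 - velu_dx P ^+ 3 - A2 * velu_dx P ^+ 2
   - A4 * velu_dx P + 5 * velu_t * velu_dx P))); last by ord_tac.
move=> P P0 PB; rewrite /velu_eqn velu_xE // velu_yE //.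
have dxE : velu_dx P = \sum_(1 <= i < N) (xc (P + G *+ i) - xc (G *+ i)).
  by apply: (@addrI _ (xc P)); rewrite -velu_xE // velu_x_shift.
have RE : R P = (2 * yc P + A1 * xc P + A3) * velu_dy P
   + (A1 * yc P - 3 * xc P ^+ 2 - 2 * A2 * xc P) * velu_dx P
   + 5 * velu_t * xc P + b2 E * velu_t + 7 * velu_w.
  rewrite dxE /velu_dy /velu_t /velu_w ![in RHS]mulr_sumr mulr_suml -!big_split /=.
  apply/eqP; rewrite eq_sym -subr_eq0 -sumrB; apply/eqP.
  rewrite -[RHS](kernel_sum_odd (F := fun T =>
    tangent_y T * (- A1 * (xc P - xc T) + 3 * yc P
      + (12 * xc T + 4 * A2 + A1 ^+ 2) * yc P * (xc P - xc T)^-1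
      - 2 * (A1 * xc T + A3)))); last first.
    by move=> i iN; rewrite tangent_yN ?G_order // xcN mulNr.
  rewrite big_seq [RHS]big_seq; apply: eq_bigr => i iN.
  have [T0 ne _] := kernel_neq P0 PB iN.
  by rewrite velu_summand // addrK.
rewrite RE; apply: (lincomb1 (c := -1) (curve_eq P0)); ring.
Qed.

Lemma velu_eqnP P : ~ in_kernel P -> velu_eqn P = 0.
Proof.
move=> /kernel_xsN[P0 PB]; apply: (rigidity ord_velu_eqn) => // S S0 /(kernel_xsP S0) CS.
exists kernel_xs; apply: ordW (ord_ext _ ord_velu_eqn) => // Q _ _.
by rewrite /velu_eqn velu_xD // velu_yD.
Qed.

Local Notation inC := in_kernel.
Local Notation X := velu_x.
Local Notation Y := velu_y.

(** * The line through the images of two points *)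

Section FixedQ.
Variable Q : point E.
Hypotheses (CQ : ~ inC Q) (C2Q : ~ inC (Q + Q)).

(* The slope of the line through the images of P and Q under Velu's map. *)
Definition velu_slope P : k :=
  \sum_(0 <= i < N) pslope (P + G *+ i) Q - \sum_(1 <= i < N) pslope (G *+ i) Q.

Lemma velu_slopeD P T : inC T -> velu_slope (P + T) = velu_slope P.
Proof. by move=> [i ->]; rewrite /velu_slope (kernel_sum_shift (fun R =>
  pslope R Q)). Qed.

Let Q_shift i : Q + G *+ i != 0. Proof. exact: notin_kernelD. Qed.
Let Q0 : Q != 0. Proof. by have := Q_shift 0; rewrite addr0. Qed.

Lemma velu_slope_third P : ~ inC P -> ~ inC (P + Q) ->
  velu_slope (- (P + Q)) = velu_slope P.
Proof.
move=> CP CPQ; rewrite /velu_slope; congr (_ - _).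
rewrite -[RHS](kernel_sum0_opp (fun T => pslope (P + T) Q)) big_nat [RHS]big_nat.
apply: eq_bigr => i /andP[_ iN].
have -> : - (P + Q) + G *+ i = - (P - G *+ i + Q) by rewrite !opprD opprK addrAC.
rewrite pslope_third //.
- by rewrite kernel_opp ?(ltnW iN) // notin_kernelD.
- by rewrite addrAC kernel_opp ?(ltnW iN) // notin_kernelD.
Qed.

(** The cocycle relation for (P, T, Q) trades slopes at P + T for slopes at P itself, whose
    behaviour at infinity is explicit. *)
Lemma velu_slope_chords P : ~ inC P -> ~ inC (P + Q) ->
  velu_slope P = pslope P Q + \sum_(1 <= i < N) (pslope P (Q + G *+ i) - pslope P
    (G *+ i)).
Proof.
move=> CP CPQ; rewrite /velu_slope (big_ltn N0) addr0 -addrA; congr (_ + _).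
rewrite -sumrB big_nat [RHS]big_nat; apply: eq_bigr => i iN.
have P0 : P != 0 by have := notin_kernelD 0 CP; rewrite addr0.
have := pslope_cocycle P0 (G_order iN) Q0 (notin_kernelD i CP).
rewrite (addrC (G *+ i) Q) addrAC => /(_ (Q_shift i) (notin_kernelD i CPQ)) e.
by apply: (lincomb1 (c := 1) e); ring.
Qed.

Definition slope_xs : seq k := kernel_xs ++ [seq xc (Q + G *+ i) | i <- index_iota 0 N].

Lemma slope_xsP P : P != 0 -> xc P \notin slope_xs <-> [/\ ~ inC P,
  ~ inC (P + Q) & ~ inC (P - Q)].
Proof.
move=> P0; rewrite mem_cat negb_or; split=> [/andP[PB PQB]|[CP CPQ CPQ']].
  have Qxs T : inC T -> xc (Q + T) \in [seq xc (Q + G *+ i) | i <- index_iota 0 N].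
    move=> /in_kernelP[i iN ->]; apply/mapP; exists i => //.
    by rewrite mem_index_iota.
  split.
  - by move/(kernel_xsP P0); apply/negP.
  - move=> /in_kernelN /Qxs; rewrite opprD addrCA subrr addr0 xcN.
    by apply/negP.
  - by move/Qxs; rewrite addrCA subrr addr0; apply/negP.
apply/andP; split; first by apply/negP => /(kernel_xsP P0).
apply/negP => /mapP[i _] /(same_xc P0 (Q_shift i))[] PE.
  by apply: CPQ'; rewrite PE addrAC subrr add0r; exists i.
by apply: CPQ; rewrite PE opprD addrAC addNr add0r; apply/in_kernelN; exists i.
Qed.

Definition velu_line P : k := velu_slope P * (X P - X Q) - (Y P - Y Q).

Section LineRemainder.
Variables (x y aQ bQ a b a' b' : k).
Let iQ := (x - aQ)^-1.
Let i := (x - a)^-1.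
Let i' := (x - a')^-1.
(** The slopes at P of chords to two fixed points are both about y / x. These forms of their
    difference, and of the corresponding part of [velu_line], display an order of at most -1. *)
Definition slope_rem : k := y * (a' - a) * i * i' - b' * i' + b * i.
Definition line_rem : k := (a' - a) * (y * (a' - aQ) * i' * iQ + y * a * i * i' + bQ * iQ)
  - b' * a' * i' + b * a * i.

Lemma slope_remE : x - a != 0 -> x - a' != 0 ->
  (y - b') * i' - (y - b) * i = slope_rem.
Proof. by move=> d0 d0'; rewrite /slope_rem /i /i'; field; rewrite d0 d0'. Qed.

Lemma line_remE : x - aQ != 0 -> x - a != 0 -> x - a' != 0 ->
  x * ((y - b') * i' - (y - b) * i) + (b' - b) - (y - bQ) * iQ * (a' - a) = line_rem.
Proof.
by move=> dQ d0 d0'; rewrite /line_rem /i /i' /iQ; field; rewrite dQ d0 d0'.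
Qed.
End LineRemainder.

Lemma velu_xQ : X Q = xc Q + \sum_(1 <= i < N) (xc (Q + G *+ i) - xc (G *+ i)).
Proof. exact: velu_x_shift. Qed.
Lemma velu_yQ : Y Q = yc Q + \sum_(1 <= i < N) (yc (Q + G *+ i) - yc (G *+ i)).
Proof. exact: velu_y_shift. Qed.

Lemma ord_velu_line : ord slope_xs velu_line (-1).
Proof.
have sub : {subset kernel_xs <= slope_xs} by move=> x xB; rewrite mem_cat xB.
have ox := ord_subset sub ord_velu_dx; have oy := ord_subset sub ord_velu_dy.
have Qxs i : (i < N)%N -> xc (Q + G *+ i) \in slope_xs.
  move=> iN; rewrite mem_cat; apply/orP; right; apply/mapP; exists i => //.
  by rewrite mem_index_iota.
have oQ : ord slope_xs (fun P => (xc P - xc Q)^-1) (-2).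
  by apply: ord_inv; have := Qxs 0%N N0; rewrite addr0.
pose D P := \sum_(1 <= i < N) slope_rem (xc P) (yc P) (xc (G *+ i)) (yc (G *+ i))
    (xc (Q + G *+ i)) (yc (Q + G *+ i)).
pose R P := \sum_(1 <= i < N) line_rem (xc P) (yc P) (xc Q) (yc Q) (xc (G *+ i)) (yc
  (G *+ i))
    (xc (Q + G *+ i)) (yc (Q + G *+ i)).
have inv_i i : i \in index_iota 1 N -> ord slope_xs (fun P : point E =>
  (xc P - xc (G *+ i))^-1) (-2)
    /\ ord slope_xs (fun P : point E => (xc P - xc (Q + G *+ i))^-1) (-2).
  move=> iN; split; apply: ord_inv; first by apply/sub/kernel_xs_mem.
  by apply: Qxs; move: iN; rewrite mem_index_iota => /andP[].
have oD : ord slope_xs D (-1).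
  apply: ord_sum => i /inv_i[o o']; rewrite /slope_rem; ord_tac.
have oR : ord slope_xs R (-1).
  apply: ord_sum => i /inv_i[o o']; rewrite /line_rem; ord_tac.
apply: (@ord_ext _ _ _ (fun P => R P + (yc P - yc Q) * (xc P - xc Q)^-1 * velu_dx P
   + D P * velu_dx P - D P * X Q - velu_dy P)); last by ord_tac.
move=> P P0 PB; have [CP CPQ CPQ'] := (slope_xsP P0).1 PB.
have PK : xc P \notin kernel_xs by apply: contra PB => /sub.
have neQ i : (i < N)%N -> xc P - xc (Q + G *+ i) != 0.
  by move=> iN; rewrite subr_eq0; apply: contraNneq PB => ->; apply: Qxs.
have neQ0 : xc P - xc Q != 0 by have := neQ 0%N N0; rewrite addr0.
rewrite /velu_line velu_slope_chords // (velu_xE P0 PK) (velu_yE P0).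
rewrite pslope_chord; last by rewrite -subr_eq0.
have chords i : i \in index_iota 1 N ->
  pslope P (Q + G *+ i) - pslope P (G *+ i) = slope_rem (xc P) (yc P) (xc (G *+ i))
    (yc (G *+ i))
    (xc (Q + G *+ i)) (yc (Q + G *+ i)).
  move=> iN; have [_ ne ne'] := kernel_neq P0 PK iN.
  have nQ : xc P - xc (Q + G *+ i) != 0.
    by apply: neQ; move: iN; rewrite mem_index_iota => /andP[].
  by rewrite -slope_remE // (pslope_chord ne) pslope_chord // -subr_eq0.
have -> : \sum_(1 <= i < N) (pslope P (Q + G *+ i) - pslope P (G *+ i)) = D P.
  by rewrite big_seq [RHS]big_seq; apply: eq_bigr.
have RE : R P = xc P * D P + (Y Q - yc Q) - (yc P - yc Q) * (xc P - xc Q)^-1 * (X Q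
  - xc Q).
  have -> : X Q - xc Q = \sum_(1 <= i < N) (xc (Q + G *+ i) - xc (G *+ i)).
    by rewrite velu_xQ addrAC subrr add0r.
  have -> : Y Q - yc Q = \sum_(1 <= i < N) (yc (Q + G *+ i) - yc (G *+ i)).
    by rewrite velu_yQ addrAC subrr add0r.
  rewrite /D /R !mulr_sumr -!big_split -sumrB /= big_seq [RHS]big_seq.
  apply: eq_bigr => i iN; have [_ ne ne'] := kernel_neq P0 PK iN.
  have nQ : xc P - xc (Q + G *+ i) != 0.
    by apply: neQ; move: iN; rewrite mem_index_iota => /andP[].
  by rewrite -slope_remE // -line_remE.
rewrite RE.
have lam : (yc P - yc Q) * (xc P - xc Q)^-1 * (xc P - xc Q) = yc P - yc Q
  by rewrite divfK.
by apply: (lincomb1 (c := -1) lam); ring.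
Qed.

Lemma ord_chord B T : xc T \in B -> ord B (fun P => pslope P T) 1.
Proof.
move=> TB; have o := ord_inv E TB.
apply: (@ord_ext _ _ _ (fun P => (yc P - yc T) * (xc P - xc T)^-1)); last by ord_tac.
by move=> P _ PB; rewrite pslope_chord //; apply: contraNneq PB => ->.
Qed.

Lemma ord_velu_slope : ord slope_xs velu_slope 1.
Proof.
have Qxs i : (i < N)%N -> xc (Q + G *+ i) \in slope_xs.
  move=> iN; rewrite mem_cat; apply/orP; right; apply/mapP; exists i => //.
  by rewrite mem_index_iota.
have := Qxs 0%N N0; rewrite addr0 => /ord_chord oQ.
have oD : ord slope_xs
    (fun P => \sum_(1 <= i < N) (pslope P (Q + G *+ i) - pslope P (G *+ i))) 1.
  apply: ord_sum => i iN.
  have o1 : ord slope_xs (fun P => pslope P (G *+ i)) 1.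
    by apply: ord_chord; rewrite mem_cat kernel_xs_mem.
  have o2 : ord slope_xs (fun P => pslope P (Q + G *+ i)) 1.
    by apply: ord_chord; apply: Qxs; move: iN; rewrite mem_index_iota => /andP[].
  ord_tac.
apply: (ord_ext _ (ordD oQ oD)) => P P0 PB.
by have [CP CPQ _] := (slope_xsP P0).1 PB; rewrite velu_slope_chords.
Qed.

Let xs2 : seq k := [seq xc (Q + G *+ i) | i <- index_iota 0 N]
  ++ [seq xc (Q + G *+ i + Q) | i <- index_iota 0 N].

Let xs2_1 i : i \in index_iota 0 N -> xc (Q + G *+ i) \in xs2.
Proof.
move=> iN; rewrite mem_cat; apply/orP; left.
exact: (map_f (fun i => xc (Q + G *+ i))).
Qed.

Let xs2_2 i : i \in index_iota 0 N -> xc (Q + G *+ i + Q) \in xs2.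
Proof.
move=> iN; rewrite mem_cat; apply/orP; right.
exact: (map_f (fun i => xc (Q + G *+ i + Q))).
Qed.

Let xs2_neq P T : xc T \in xs2 -> xc P \notin xs2 -> P + T != 0.
Proof.
move=> TB PB; rewrite addr_eq0; apply: contraNneq PB => ->.
by rewrite xcN.
Qed.

Lemma ord_velu_x_at : ord xs2 (fun P => X (P + Q) - X Q) (-1).
Proof.
have o : ord xs2 (fun P =>
  \sum_(0 <= i < N) (xc (P + (Q + G *+ i)) - xc (Q + G *+ i))) (-1).
  apply: ord_sum => i iN; apply: (ord_subset _ (ord_xc_add (Q_shift i))) => x.
  by rewrite inE => /eqP ->; apply: xs2_1.
apply: (ord_ext _ o) => P _ _; rewrite sumrB /velu_x.
have -> : \sum_(0 <= i < N) xc (P + Q + G *+ i) = \sum_(0 <= i < N) xc (P + (Q + G *+ i)).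
  by apply: eq_bigr => i _; rewrite addrA.
ring.
Qed.

Lemma ord_velu_y_at : ord xs2 (fun P => Y (P + Q) - Y Q) (-1).
Proof.
have o : ord xs2 (fun P =>
  \sum_(0 <= i < N) (yc (P + (Q + G *+ i)) - yc (Q + G *+ i))) (-1).
  apply: ord_sum => i iN; apply: (ord_subset _ (ord_yc_add (Q_shift i))) => x.
  by rewrite inE => /eqP ->; apply: xs2_1.
apply: (ord_ext _ o) => P _ _; rewrite sumrB /velu_y.
have -> : \sum_(0 <= i < N) yc (P + Q + G *+ i) = \sum_(0 <= i < N) yc (P + (Q + G *+ i)).
  by apply: eq_bigr => i _; rewrite addrA.
ring.
Qed.

Lemma ord_velu_slope_at : ord xs2 (fun P => velu_slope (P + Q)) 1.
Proof.
have o : ord xs2 (fun P => \sum_(0 <= i < N) (pslope (Q + G *+ i) Q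
   + pslope P (Q + G *+ i + Q) - pslope P (Q + G *+ i))) 1.
  apply: ord_sum => i iN; have o1 := ord_chord (xs2_1 iN); have o2 :=
    ord_chord (xs2_2 iN).
  ord_tac.
have o' : ord xs2 (fun P => \sum_(0 <= i < N) (pslope (Q + G *+ i) Q
   + pslope P (Q + G *+ i + Q) - pslope P (Q + G *+ i))
   - \sum_(1 <= i < N) pslope (G *+ i) Q) 1 by ord_tac.
apply: (ord_ext _ o') => P P0 PB; rewrite /velu_slope; congr (_ - _).
rewrite big_seq [RHS]big_seq; apply: eq_bigr => i iN.
rewrite -(pslope_cocycle P0 (Q_shift i) Q0).
- by rewrite addrAC subrr add0r addrA.
- exact: xs2_neq (xs2_1 iN) PB.
- by rewrite addrAC; apply: notin_kernelD.
- by rewrite -addrA; apply: xs2_neq (xs2_2 iN) PB.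
Qed.

Lemma velu_lineP P : ~ inC P -> ~ inC (P + Q) -> ~ inC (P - Q) ->
  velu_slope P * (X P - X Q) = Y P - Y Q.
Proof.
move=> CP CPQ CPQ'; apply/eqP; rewrite -subr_eq0; apply/eqP; rewrite -/(velu_line P).
have [P0 _] := kernel_xsN CP.
have velu_lineD R T : inC T -> velu_line (R + T) = velu_line R.
  by move=> CT; rewrite /velu_line velu_slopeD // velu_xD // velu_yD.
have ox := ord_velu_x_at; have oy := ord_velu_y_at.
apply: (rigidity ord_velu_line) => //; last by apply/slope_xsP.
move=> S S0; rewrite mem_cat => /orP[/(kernel_xsP S0) CS|/mapP[i _]].
  exists slope_xs; apply: ordW (ord_ext _ ord_velu_line) => // R _ _.
  by rewrite velu_lineD.
move=> /(same_xc S0 (Q_shift i))[] ->.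
  (* At the points Q + T the slope has at most a simple pole, which the zero of X - X(Q)
     compensates. *)
  have os := ord_velu_slope_at.
  have o : ord xs2 (fun P =>
    velu_slope (P + Q) * (X (P + Q) - X Q) - (Y (P + Q) - Y Q)) 0.
    by ord_tac.
  exists xs2; apply: (ord_ext _ o) => R _ _; rewrite addrA velu_lineD //.
  by exists i.
(* At the points - (Q + T), [velu_slope_third] replaces the slope at R - Q by the slope at - R, of
   order at most 1 in R, and the zero of X - X(Q) compensates again. *)
pose B := slope_xs ++ xs2.
have s1 : {subset slope_xs <= B} by move=> x xB; rewrite mem_cat xB.
have s2 : {subset xs2 <= B} by move=> x xB; rewrite mem_cat xB orbT.
have os := ord_opp (ord_subset s1 ord_velu_slope).
have ox' := ord_opp (ord_subset s2 ox); have oy' := ord_opp (ord_subset s2 oy).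
have o : ord B (fun P => velu_slope (- P) * (X (- P + Q) - X Q)
   - (- (Y (- P + Q) - Y Q) - A1 * (X (- P + Q) - X Q) - 2 * Y Q - A1 * X Q - A3)) 0.
  by ord_tac.
exists B; apply: (ord_ext _ o) => R R0 RB.
have [CR CRQ CRQ'] := (slope_xsP R0).1 (contra (@s1 _) RB).
rewrite (_ : R - (Q + G *+ i) = R - Q - G *+ i); last by rewrite opprD addrA.
rewrite velu_lineD; last by apply: (in_kernelN _).2; exists i.
have NRQ : R - Q = - (- R + Q) by rewrite opprD opprK.
have CNRQ : ~ inC (- R + Q) by move=> c; apply: CRQ'; rewrite NRQ;
  apply: (in_kernelN _).2.
have CNR : ~ inC (- R) by move=> /(in_kernelN _).1.
rewrite /velu_line NRQ (velu_slope_third CNR CNRQ).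
by rewrite velu_xN velu_yN // /neg_y; ring.
Qed.

End FixedQ.

(** * Genericity of the auxiliary conditions *)

Lemma generically_all (I : eqType) (r : seq I) (U : I -> point E -> Prop) :
  (forall i, i \in r -> generically (U i)) -> generically (fun P => forall i,
    i \in r -> U i P).
Proof.
elim: r => [|i r IH] gU; first by exists [::].
have gi : generically (U i) by apply: gU; rewrite inE eqxx.
have gr : generically (fun P => forall j, j \in r -> U j P).
  by apply: IH => j jr; apply: gU; rewrite inE jr orbT.
apply: generically_impl (generically_and gi gr) => P [Ui Ur] j.
by rewrite inE => /orP[/eqP ->|/Ur].
Qed.

(** [q] is the 2-division polynomial, equal to psi^2 on the curve. Should it vanish identically, 4 =
    b2 = b6 = 0 would annihilate every term of the discriminant. *)
Lemma generically_tangent_y : generically (fun S : point E => tangent_y S != 0).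
Proof.
pose q : {poly k} := 4%:P * 'X^3 + (b2 E)%:P * 'X^2 + (2 * b4 E)%:P * 'X + (b6 E)%:P.
have qE x : q.[x] = 4 * x ^+ 3 + b2 E * x ^+ 2 + 2 * b4 E * x + b6 E.
  by rewrite !(hornerD, hornerM, hornerC, hornerXn, hornerX).
have q0 : q != 0.
  apply/eqP => q0; have qi i : q`_i = 0 by rewrite q0 coef0.
  have := qi 0%N; have := qi 2%N; have := qi 3%N.
  rewrite /q !coefD !coefCM !coefXn !coefX !coefC /= !(mulr0, mulr1, add0r, addr0).
  move=> four b20 b60; have := discriminant_neq0 E; rewrite /discriminant b20 b60.
  have -> : 8 = 2 * 4 :> k by rewrite -natrM.
  by rewrite four !(mulr0, mul0r, expr0n) /= !(oppr0, subr0, addr0, mul0r, mulr0) eqxx.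
apply: generically_impl (generically_and (generically_neq (0 : point E))
  (generically_root E q0)).
move=> S [S0]; apply: contra => /eqP psi; rewrite qE; apply/eqP.
have e := curve_eq S0; rewrite /tangent_y in psi; rewrite /b2 /b4 /b6.
apply: (lincomb2 (c := tangent_y S) (c' := -4) psi e); rewrite /tangent_y; ring.
Qed.

Lemma generically_xc_shift U : U != 0 -> generically (fun S => xc (S + U) != xc S).
Proof.
move=> U0; have gn := @generically_neq0 k E [:: xc U] (fun S => xc S - xc (S + U)) 'X.
apply: generically_impl (gn _ _) => [S||].
- by apply: contra => /eqP ->; rewrite subrr.
- by rewrite polyX_eq0.
have o := ord_xc_add U0.
have o' : ord [:: xc U] (fun P => - (xc (P + U) - xc U) - xc U) 1 by ord_tac.
apply: ordW (ord_ext _ o'); first by rewrite size_polyX.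
by move=> S _ _; rewrite hornerX; ring.
Qed.

(** 2 S = U gives S - U = - S, hence x(S - U) = x(S); for nonzero U this fails generically, since
    only the right side has a pole at infinity. *)
Lemma generically_double U : generically (fun S : point E => S + S != U).
Proof.
case: (eqVneq U 0) => [->|U0].
  apply: generically_impl (generically_and (generically_neq
    (0 : point E)) generically_tangent_y).
  move=> S [S0]; apply: contra; rewrite addr_eq0 => /eqP SN.
  by rewrite /tangent_y; have := ycN S0; rewrite -SN => e; apply/eqP;
    apply: (lincomb1 (c := 1) e); ring.
have gU : generically (fun S => xc (S + (- U)) != xc S).
  by apply: generically_xc_shift; rewrite oppr_eq0.
apply: generically_impl gU => S; apply: contra => /eqP SU.
by rewrite -SU opprD addrA subrr add0r xcN.
Qed.

Lemma generically_velu_x c : generically (fun S => X S != c).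
Proof.
have gn := @generically_neq0 k E kernel_xs (fun S => X S - c) ('X - c%:P).
apply: generically_impl (gn _ _) => [S||].
- by apply: contra => /eqP ->; rewrite subrr.
- exact: monic_neq0 (monicXsubC c).
apply: ordW (ord_ext _ ord_velu_dx); first by rewrite size_XsubC.
by move=> S S0 SB; rewrite velu_xE // !(hornerD, hornerN, hornerX, hornerC); ring.
Qed.

Lemma generically_velu_x_shift P : ~ inC P -> generically (fun S => X (S + P) != X S).
Proof.
move=> CP; have [B o] : exists B, ord B (fun S => X (S + P) - X P) (-1).
  by eexists; apply: ord_velu_x_at.
pose B' := B ++ kernel_xs.
have s1 : {subset B <= B'} by move=> x xB; rewrite mem_cat xB.
have s2 : {subset kernel_xs <= B'} by move=> x xB; rewrite mem_cat xB orbT.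
have gn := @generically_neq0 k E B' (fun S => X S - X (S + P)) 'X.
apply: generically_impl (gn _ _) => [S||].
- by apply: contra => /eqP ->; rewrite subrr.
- by rewrite polyX_eq0.
have o1 := ord_subset s1 o; have o2 := ord_subset s2 ord_velu_dx.
have o' : ord B' (fun S => velu_dx S - (X (S + P) - X P) - X P) 1 by ord_tac.
apply: ordW (ord_ext _ o'); first by rewrite size_polyX.
move=> S S0 SB; have SK : xc S \notin kernel_xs by apply: contra SB => /s2.
rewrite (velu_xE S0 SK).
by rewrite hornerX; ring.
Qed.

Lemma generically_notin_kernel U : generically (fun S => ~ inC (U + S)).
Proof.
have g : generically (fun S : point E => forall i, i \in index_iota 0 N ->
  S != G *+ i - U).
  by apply: generically_all => i _; apply: generically_neq.
apply: generically_impl g => S SU /in_kernelP[i iN SE].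
by have := SU i; rewrite mem_index_iota -SE addrAC subrr add0r eqxx => /(_ iN).
Qed.

Lemma generically_double_notin_kernel U : generically (fun S => ~ inC (U + (S + S))).
Proof.
have g : generically (fun S : point E => forall i, i \in index_iota 0 N ->
  S + S != G *+ i - U).
  by apply: generically_all => i _; apply: generically_double.
apply: generically_impl g => S SU /in_kernelP[i iN SE].
by have := SU i; rewrite mem_index_iota -SE addrAC subrr add0r eqxx => /(_ iN).
Qed.

(** * Velu's map as a separable isogeny *)

Section Map.
Hypothesis velu_disc : discriminant velu != 0.
Definition velu_curve : elliptic_curve k := EllipticCurve velu_disc.

Definition in_kernelb P : bool := P \in [seq G *+ i | i <- index_iota 0 N].

Lemma in_kernelbP P : reflect (inC P) (in_kernelb P).
Proof.
apply: (iffP mapP) => [[i _ ->]|/in_kernelP[i iN ->]]; first by exists i.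
by exists i; rewrite ?mem_index_iota.
Qed.

Definition velu_raw P : option (k * k) := if in_kernelb P then None else Some (X P, Y P).

Lemma on_curve_velu P : on_curve velu_curve (velu_raw P).
Proof.
rewrite /velu_raw; case: in_kernelbP => // CP; apply/on_curveP.
by apply: (lincomb1 (c := 1) (velu_eqnP CP)); rewrite /velu_eqn /=; ring.
Qed.

Definition velu_map P : point velu_curve := exist _ (velu_raw P) (on_curve_velu P).

Lemma val_velu_map P : ~ inC P -> val (velu_map P) = Some (X P, Y P).
Proof. by move=> CP /=; rewrite /velu_raw; case: in_kernelbP. Qed.

Lemma velu_map_eq0 P : velu_map P = 0 <-> inC P.
Proof.
split=> [/(congr1 val)|CP]; first by rewrite /= /velu_raw; case: in_kernelbP.
by apply: val_inj; rewrite /= /velu_raw; case: in_kernelbP.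
Qed.

Lemma velu_mapN P : velu_map (- P) = - velu_map P.
Proof.
apply: val_inj; rewrite /= /velu_raw.
case: in_kernelbP => [/(in_kernelN _).1 CP|CNP]; case: in_kernelbP => // CP'.
  by case: CNP; apply: (in_kernelN _).2.
by rewrite /= velu_xN velu_yN.
Qed.

Lemma velu_mapDr P T : inC T -> velu_map (P + T) = velu_map P.
Proof.
move=> CT; apply: val_inj; rewrite /= /velu_raw.
have := in_kernelDr P CT; case: in_kernelbP => CPT; case: in_kernelbP => // CP.
- by move=> [H _]; case: CP; apply: H.
- by move=> [_ H]; case: CPT; apply: H.
by rewrite velu_xD // velu_yD.
Qed.

(** The images of P, Q and - (P + Q) lie on one line of slope [m]. Having distinct abscissas, they
    are its three intersections with the image curve, so the third is determined by the first
    two. *)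
Lemma velu_mapD_generic P Q : ~ inC P -> ~ inC Q -> ~ inC (P + Q) -> ~ inC (P - Q) ->
    ~ inC (Q + Q) -> ~ inC (P + (Q + Q)) ->
    X P != X Q -> X (P + Q) != X P -> X (P + Q) != X Q ->
  velu_map (P + Q) = velu_map P + velu_map Q.
Proof.
move=> CP CQ CPQ CPQ' C2Q CP2Q n1 n2 n3.
have lP := velu_lineP CQ C2Q CP CPQ CPQ'.
have CR : ~ inC (- (P + Q)) by move/(in_kernelN _).1.
have CRQ : ~ inC (- (P + Q) + Q) by rewrite opprD addrNK; move/(in_kernelN _).1.
have CRQ' : ~ inC (- (P + Q) - Q) by rewrite -opprD -addrA; move/(in_kernelN _).1.
have lR := velu_lineP CQ C2Q CR CRQ CRQ'.
rewrite (velu_slope_third CQ CP CPQ) velu_xN velu_yN // in lR.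
set m := velu_slope Q P in lP lR.
have oP := on_curve_velu P; have oQ := on_curve_velu Q.
have oR := on_curve_velu (- (P + Q)).
rewrite -[velu_raw _]/(val (velu_map P)) val_velu_map // in oP.
rewrite -[velu_raw _]/(val (velu_map Q)) val_velu_map // in oQ.
rewrite -[velu_raw _]/(val (velu_map _)) val_velu_map // velu_xN velu_yN // in oR.
have nopp : ~ (X P = X Q /\ Y P = neg_y velu_curve (X Q) (Y Q)).
  by move=> [e _]; rewrite e eqxx in n1.
have rel := slopeP oP oQ nopp.
have mE : slope velu_curve (X P) (Y P) (X Q) (Y Q) = m.
  apply: (@mulIf _ (X P - X Q)); first by rewrite subr_eq0.
  by rewrite lP; case: rel.
rewrite mE in rel.
have := raw_addE nopp oP oQ rel; rewrite -!val_velu_map // => add.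
apply: val_inj; rewrite [RHS]add (val_velu_map CPQ) /=.
set XR := X (P + Q) in lR oR n2 n3 *; set YR := Y (P + Q) in lR oR *.
have xE : XR = m ^+ 2 + A1 * m - A2 - X P - X Q.
  apply/eqP; rewrite -subr_eq0; apply/eqP.
  have d1 : XR - X P != 0 by rewrite subr_eq0.
  have d2 : XR - X Q != 0 by rewrite subr_eq0.
  have d3 : X P - X Q != 0 by rewrite subr_eq0.
  apply: (mulIf d1); apply: (mulIf d2); apply: (mulIf d3); rewrite !mul0r.
  have yP : Y P = m * (X P - X Q) + Y Q by rewrite lP subrK.
  have yR : neg_y E XR YR = m * (XR - X Q) + Y Q by rewrite lR subrK.
  rewrite yR in oR.
  rewrite yP in oP.
  move/on_curveP: oP; move/on_curveP: oQ; move/on_curveP: oR => /= oR oQ oP.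
  by apply: (lincomb3 (c := - (X P - X Q)) (c' := - (XR - X P)) (c'' :=
    XR - X Q) oR oQ oP); ring.
rewrite -xE; congr (Some (_, _)); rewrite /neg_y /= in lR *.
by apply: (lincomb2 (c := 1) (c' := -1) lR lP); ring.
Qed.

Lemma velu_mapD_generically P : ~ inC P ->
  generically (fun S => velu_map (P + S) = velu_map P + velu_map S).
Proof.
move=> CP.
have g1 := generically_notin_kernel 0; have g2 := generically_notin_kernel P.
have g3 := generically_opp (generically_notin_kernel P).
have g4 := generically_double_notin_kernel 0; have g5 :=
  generically_double_notin_kernel P.
have g6 := generically_velu_x (X P); have g7 :=
  generically_shift P (generically_velu_x (X P)).
have g8 := generically_velu_x_shift CP.
apply: generically_impl (generically_and g1 (generically_and g2 (generically_and g3
  (generically_and g4 (generically_and g5 (generically_and g6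
    (generically_and g7 g8))))))).
move=> S [h1 [h2 [h3 [h4 [h5 [h6 [h7 h8]]]]]]]; rewrite !add0r in h1 h4.
by rewrite (addrC S) in h7 h8; apply: velu_mapD_generic => //; rewrite eq_sym.
Qed.

Lemma velu_mapD P Q : velu_map (P + Q) = velu_map P + velu_map Q.
Proof.
case: (in_kernelbP P) => [CP|CP].
  by rewrite (velu_map_eq0 P).2 // add0r addrC velu_mapDr.
case: (in_kernelbP Q) => [CQ|CQ].
  by rewrite (velu_map_eq0 Q).2 // addr0 velu_mapDr.
case: (in_kernelbP (P + Q)) => [CPQ|CPQ].
  rewrite (velu_map_eq0 _).2 //; apply/eqP; rewrite eq_sym addr_eq0 -velu_mapN.
  by rewrite -(velu_mapDr (- Q) CPQ) addrC addrK.
(* Generic additivity determines the remaining case: Q - S is also (P + Q) - (S + P), and a generic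
   S lets the map be expanded on P + S and on both forms of Q - S. *)
have gP := velu_mapD_generically CP.
have gQ := generically_opp (velu_mapD_generically CQ).
have gPQ := generically_shift P (generically_opp (velu_mapD_generically CPQ)).
have [S [hP [hQ hPQ]]] := generically_point (generically_and gP (generically_and gQ gPQ)).
have e : P + Q - (S + P) = Q - S by rewrite (addrC S) opprD addrA (addrC P Q) addrK.
rewrite e hQ !velu_mapN (addrC S) hP opprD addrA in hPQ.
apply: (@addIr _ (- velu_map P - velu_map S)).
by rewrite addrA -hPQ -[RHS]addrA (addrCA (velu_map Q)) [RHS]addrA subrr add0r.
Qed.

Lemma velu_isogeny : isogeny velu_map.
Proof.
split; first exact: velu_mapD.
have [d [u [v [dm dB _ dxE]]]] := ord_velu_dx.
have [d' [u' [v' [dm' dB' _ dyE]]]] := ord_velu_dy.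
(* The factor [q] makes the common denominator vanish above the whole kernel, so that the map has
   affine values wherever the denominator is nonzero. *)
pose q := \prod_(b <- kernel_xs) ('X - b%:P) : {poly k}.
pose D := d * d' * q.
have D0 : D != 0.
  rewrite !mulf_neq0 ?monic_neq0 //; exact: monic_prod_XsubC.
pose FX : {poly {poly k}} := (('X * d + u) * (d' * q))%:P + (v * (d' * q))%:P * 'X.
pose FY : {poly {poly k}} := (u' * (d * q))%:P + (d * d' * q + v' * (d * q))%:P * 'X.
exists FX, FY, D%:P; split.
  have [P [P0 PD]] := generically_point (generically_and (generically_neq (0 : point E))
    (generically_root E D0)).
  exists P, (xc P), (yc P); split; first exact: val_affine.
  by rewrite /eval2 hornerC.
move=> P x y VP; rewrite {1}/eval2 hornerC => Dx.
have P0 := affine_neq0 VP; have xP := xcE VP; have yP := ycE VP.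
have := Dx; rewrite /D !hornerM !mulf_eq0 !negb_or => /andP[/andP[dx d'x] qx].
have PK : xc P \notin kernel_xs by rewrite xP -root_prod_XsubC -/q rootE.
have CP : ~ inC P by move/(kernel_xsP P0); apply/negP.
rewrite val_velu_map // (velu_xE P0 PK) (velu_yE P0).
have e1 := dxE P P0 PK; have e2 := dyE P P0 PK; rewrite xP yP in e1 e2 *.
have e1' : velu_dx P = (u.[x] + v.[x] * y) / d.[x] by rewrite -e1 mulfK.
have e2' : velu_dy P = (u'.[x] + v'.[x] * y) / d'.[x] by rewrite -e2 mulfK.
rewrite e1' e2' /eval2 /FX /FY /D !(hornerD, hornerM, hornerC, hornerX).
by congr (Some (_, _)); field; rewrite dx d'x qx.
Qed.

(* Velu's abscissa is x + u(x)/d(x) with deg u < deg d, and the numerator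
   d^2 + u' d - u d' of its derivative has leading term that of d^2. *)
Lemma velu_separable : separable velu_map.
Proof.
pose proper (f : k -> k) := exists d u : {poly k},
  [/\ d \is monic, forall x, root d x -> x \in kernel_xs, (size u < size d)%N &
      forall x, x \notin kernel_xs -> f x * d.[x] = u.[x]].
have properD f g : proper f -> proper g -> proper (fun x => f x + g x).
  move=> [d [u [dm dB ud fE]]] [d' [u' [dm' dB' ud' gE]]].
  exists (d * d'), (u * d' + u' * d); split.
  - exact: rpredM.
  - by move=> x; rewrite rootM => /orP[/dB|/dB'].
  - have lt (a b c : {poly k}) : (size a < size b)%N -> c \is monic ->
        (size (a * c)%R < size (b * c)%R)%N.
      move=> ab cm; have b0 : b != 0 by rewrite -size_poly_gt0; apply: leq_trans ab.
      apply: leq_ltn_trans (size_polyMleq _ _) _; rewrite size_Mmonic //.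
      have := monic_neq0 cm; rewrite -size_poly_gt0; move: ab.
      by case: (size c) (size b) => [|z] [|y] // ab _; rewrite !addnS /= ltn_add2r.
    rewrite (leq_ltn_trans (size_polyD _ _)) // gtn_max lt //=.
    by rewrite [d * d']mulrC lt.
  by move=> x xB; rewrite hornerM mulrDl mulrA fE // (mulrC d.[_]) mulrA gE //
    hornerD !hornerM.
have [d [u [dm dB ud fE]]] : proper (fun x => \sum_(1 <= i < N)
    (tangent_x (G *+ i) * (x - xc (G *+ i))^-1
     + tangent_y (G *+ i) * yc (G *+ i) * (x - xc (G *+ i))^-1 ^+ 2)).
  have : {subset index_iota 1 N <= index_iota 1 N} by [].
  elim: {-2}(index_iota 1 N) => [|i r IH] sub.
    exists 1, 0; split; [exact: rpred1 | by move=> x; rewrite (negPf (root1 x)) | |].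
      by rewrite size_poly0 size_poly1.
    by move=> x _; rewrite big_nil mul0r horner0.
  have {}IH : proper (fun x => \sum_(i <- r) (tangent_x (G *+ i) * (x - xc (G *+ i))^-1
     + tangent_y (G *+ i) * yc (G *+ i) * (x - xc (G *+ i))^-1 ^+ 2)).
    by apply: IH => j jr; apply: sub; rewrite inE jr orbT.
  have hi : proper (fun x => tangent_x (G *+ i) * (x - xc (G *+ i))^-1
     + tangent_y (G *+ i) * yc (G *+ i) * (x - xc (G *+ i))^-1 ^+ 2).
    set a := xc (G *+ i); set g := tangent_x _; set c := _ * yc _.
    exists (('X - a%:P) ^+ 2), (g%:P * ('X - a%:P) + c%:P); split.
    - by rewrite rpredX // monicXsubC.
    - move=> x; rewrite rootE horner_exp expf_eq0 /= -rootE root_XsubC => /eqP ->.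
      by apply: kernel_xs_mem; apply: sub; rewrite inE eqxx.
    - rewrite size_exp_XsubC (leq_ltn_trans (size_polyD _ _)) // gtn_max.
      rewrite !ltnS (leq_trans (size_polyC_leq1 c)) // andbT.
      by rewrite (leq_trans (size_polyMleq _ _)) //
        size_XsubC addn2 /= ltnS size_polyC_leq1.
    move=> x xB; have ne : x - a != 0.
      rewrite subr_eq0; apply: contraNneq xB => ->.
      by apply: kernel_xs_mem; apply: sub; rewrite inE eqxx.
    by rewrite horner_exp !(hornerD, hornerN, hornerM, hornerX, hornerC); field.
  have [d [u [dm dB ud fE]]] := properD _ _ hi IH.
  by exists d, u; split=> // x xB; rewrite big_cons fE.
have d0 := monic_neq0 dm.
pose q := \prod_(b <- kernel_xs) ('X - b%:P) : {poly k}.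
have qm : q \is monic by apply: monic_prod_XsubC.
exists (('X * d + u) * q), (d * q); split.
- by rewrite mulf_neq0 ?monic_neq0.
- move=> P x y VP; rewrite !hornerM mulf_eq0 negb_or => /andP[dx qx].
  have P0 := affine_neq0 VP; have xP := xcE VP.
  have PK : xc P \notin kernel_xs by rewrite xP -root_prod_XsubC -/q rootE.
  have CP : ~ inC P by move/(kernel_xsP P0); apply/negP.
  exists (Y P); rewrite val_velu_map // (velu_xE P0 PK).
  have := fE _ PK; rewrite -/(velu_dx P) xP => e.
  have e' : velu_dx P = u.[x] / d.[x] by rewrite -e mulfK.
  rewrite e' !(hornerD, hornerM, hornerX); congr (Some (_, _)); field.
  by rewrite dx qx.
have -> : (('X * d + u) * q)^`() * (d * q) - (('X * d + u) * q) * (d * q)^`()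
    = q ^+ 2 * (d ^+ 2 + (u^`() * d - u * d^`())).
  by rewrite !derivE; ring.
rewrite mulf_eq0 negb_or expf_eq0 /= (negPf (monic_neq0 qm)) /=.
have sd : (0 < size d)%N by rewrite size_poly_gt0.
have lt2 : (size (u^`() * d - u * d^`())%R < size (d ^+ 2)%R)%N.
  rewrite expr2 size_Mmonic // (leq_ltn_trans (size_polyD _ _)) // size_opp gtn_max.
  have der (c : {poly k}) : (size c^`() <= size c)%N.
    have [->|c0] := eqVneq c 0; first by rewrite deriv0.
    exact: ltnW (lt_size_deriv c0).
  have lt a b : (a < size d)%N -> (b <= size d)%N ->
    ((a + b).-1 < (size d + size d).-1)%N.
    by case: (size d) sd a => // n _ a an bn; rewrite addSn /=; lia.
  apply/andP; split; apply: leq_ltn_trans (size_polyMleq _ _) (lt _ _ _ _) => //.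
  exact: leq_ltn_trans (der u) ud.
rewrite -size_poly_gt0 size_polyDl //.
by rewrite size_poly_gt0 expf_neq0.
Qed.

Lemma velu_quotient : is_quotient velu_curve inC.
Proof.
exists velu_map; split; [exact: velu_isogeny | exact: velu_separable |].
by move=> P; apply: iff_sym; exact: velu_map_eq0.
Qed.
End Map.

End Velu.

(** * Points on plane curves *)

Section PlaneCurve.
Variable k : closedFieldType.
Implicit Types (F : {poly {poly k}}) (s al : k).

Lemma eval2D F F' s al : eval2 (F + F') s al = eval2 F s al + eval2 F' s al.
Proof. by rewrite /eval2 !hornerD. Qed.

Lemma eval2N F s al : eval2 (- F) s al = - eval2 F s al.
Proof. by rewrite /eval2 !hornerN. Qed.

Lemma eval2M F F' s al : eval2 (F * F') s al = eval2 F s al * eval2 F' s al.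
Proof. by rewrite /eval2 !hornerM. Qed.

Lemma eval2X F n s al : eval2 (F ^+ n) s al = eval2 F s al ^+ n.
Proof. by rewrite /eval2 !horner_exp. Qed.

Lemma eval2C (c : {poly k}) s al : eval2 c%:P s al = c.[s].
Proof. by rewrite /eval2 hornerC. Qed.

Lemma eval2_map F s al : eval2 F s al = (map_poly (horner_eval s) F).[al].
Proof. by rewrite /eval2 -horner_evalE -[al in RHS](hornerC al s) -horner_evalE
  horner_map. Qed.

(** The variable s is prime and does not divide Phi, so it divides Q; its powers cancel one at a
    time. *)
Lemma eval2_divX F Q Phi (e : nat) : ('X^e)%:P * F = Q * Phi ->
  map_poly (horner_eval 0) Phi != 0 -> exists Q', F = Q' * Phi.
Proof.
move=> eq Phi0; elim: e Q eq => [|e IH] Q; first by rewrite expr0 mul1r; exists Q.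
rewrite exprS polyCM -mulrA => eq.
have Q0 : map_poly (horner_eval 0) Q = 0.
  have := congr1 (map_poly (horner_eval 0)) eq.
  rewrite !rmorphM /= map_polyC /= horner_evalE hornerX mul0r => /esym/eqP.
  by rewrite mulf_eq0 (negPf Phi0) orbF => /eqP.
pose Q1 : {poly {poly k}} := \poly_(i < size Q) (Q`_i %/ 'X).
have QE : Q = 'X%:P * Q1.
  apply/polyP => i; rewrite coefCM coef_poly; case: ltnP => iQ;
    last by rewrite mulr0 nth_default.
  rewrite mulrC divpK //.
  have := congr1 (fun p : {poly k} => p`_i) Q0;
    rewrite coef_map coef0 /= horner_evalE => Qi.
  by rewrite -['X]subr0 -polyC0 dvdp_XsubCl rootE Qi.
apply: (IH Q1); apply: (@mulfI _ 'X%:P); first by rewrite polyC_eq0 polyX_eq0.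
by rewrite eq {1}QE mulrA.
Qed.

(* If Psi vanished on Phi = 0 off the line s = 0, pseudo-division would make Phi
   divide c(s) Psi^n for some c <> 0, and then, s not dividing Phi, also
   c0(s) Psi^n with c0(0) <> 0. *)
Lemma point_on_curve Phi Psi al0 al1 :
    eval2 Phi 0 al0 = 0 -> eval2 Phi 0 al1 != 0 -> eval2 Psi 0 al0 != 0 ->
  exists s al, [/\ s != 0, eval2 Phi s al = 0 & eval2 Psi s al != 0].
Proof.
move=> Phi0 Phi1 Psi0.
have Phi0n : map_poly (horner_eval 0) Phi != 0.
  by apply: contraNneq Phi1 => z; rewrite eval2_map z horner0.
have Phin : Phi != 0 by apply: contraNneq Phi1 => ->; rewrite /eval2 !horner0.
(* The exponent bounds the number of roots of any specialization of Phi: were all of them roots of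
   Psi, that specialization would divide Psi^M. *)
pose M := size Phi; pose R := (Psi ^+ M) %% Phi.
pose Q := (Psi ^+ M) %/ Phi; pose c := lead_coef Phi ^+ scalp (Psi ^+ M) Phi.
have eq : c%:P * Psi ^+ M = Q * Phi + R by rewrite mul_polyC Pdiv.Idomain.divp_eq.
have c0 : c != 0 by rewrite expf_neq0 // lead_coef_eq0.
have [RE|R0] := eqVneq R 0.
  rewrite RE addr0 in eq; have [e [c1 c1n cE]] := multiplicity_XsubC c 0.
  rewrite c0 /= in c1n; rewrite polyC0 subr0 in cE.
  have [Q' Q'E] : exists Q', c1%:P * Psi ^+ M = Q' * Phi.
    by apply: (eval2_divX (e := e) (Q := Q)) => //;
      rewrite -eq mulrA -polyCM cE (mulrC c1).
  have := congr1 (fun F => eval2 F 0 al0) Q'E; rewrite !eval2M eval2C eval2X Phi0 mulr0.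
  by move/eqP; rewrite mulf_eq0 expf_eq0 (negPf Psi0) andbF orbF -rootE (negPf c1n).
(* Away from the roots of this product, specializing s preserves the degrees of Phi and R. The
   remainder stays nonzero and smaller than Phi, so divisibility fails. *)
have u0 : 'X * lead_coef Phi * lead_coef R != 0
  by rewrite !mulf_neq0 ?polyX_eq0 ?lead_coef_eq0.
have [L uL] := finite_roots u0; have [s /(contra (@uL s))] := infinite_field L.
rewrite rootE !hornerM hornerX !mulf_eq0 !negb_or => /andP[/andP[s0 Phis] Rs].
pose ev := map_poly (horner_eval s) : {poly {poly k}} -> {poly k}.
have size_ev F : (lead_coef F).[s] != 0 -> size (ev F) = size F.
  by move=> Fs; rewrite /ev size_map_poly_id0.
have evR : ev R != 0.
  apply: contraNneq Rs => evR; have := congr1 (fun p : {poly k} => p`_(size R).-1) evR.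
  by rewrite coef_map coef0 /= horner_evalE => ->.
have [rs evPhiE] := closed_field_poly_normal (ev Phi).
have evPhi0 : ev Phi != 0 by rewrite -size_poly_eq0 size_ev // size_poly_eq0.
have ndiv : ~~ (ev Phi %| ev Psi ^+ M).
  apply/negP => dv; have : ev Phi %| ev R.
    have e : ev c%:P * ev Psi ^+ M = ev Q * ev Phi + ev R.
      by rewrite /ev -rmorphXn -!rmorphM -rmorphD eq.
    have -> : ev R = ev c%:P * ev Psi ^+ M - ev Q * ev Phi by rewrite e addrC addKr.
    by rewrite dvdp_sub ?dvdp_mull.
  move/(dvdp_leq evR); rewrite leqNgt !size_ev // => /negP; apply.
  exact: Pdiv.CommonIdomain.ltn_modpN0.
case: (altP (@allP _ (root (ev Psi)) rs)) => [all_root|/allPn[al alr nroot]].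
  case/negP: ndiv; rewrite evPhiE dvdpZl ?lead_coef_eq0 //.
  have le : (size rs <= M)%N.
    rewrite /M -(size_ev Phi) // evPhiE size_scale ?lead_coef_eq0 // size_prod_XsubC.
    exact: leqnSn.
  apply: dvdp_trans (_ : _ %| ev Psi ^+ size rs) (dvdp_exp2l _ le).
  elim: (rs) all_root => [|r rs' IH] all_root; first by rewrite big_nil dvd1p.
  rewrite big_cons exprS; apply: dvdp_mul.
    by rewrite dvdp_XsubCl all_root // inE eqxx.
  by apply: IH => z zr; apply: all_root; rewrite inE zr orbT.
exists s, al; split=> //; rewrite eval2_map -/(ev _); last by [].
by rewrite evPhiE hornerZ; apply/eqP; rewrite mulf_eq0 -rootE root_prod_XsubC alr orbT.
Qed.
End PlaneCurve.

(** * Orders along s = 0 *)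

Section Lead.
Variables (k : closedFieldType) (al0 : k).
Implicit Types (f g : k -> k -> k) (c : k) (T U : k -> k -> Prop) (n d : {poly {poly k}}).

Definition near T : Prop := exists d, eval2 d 0 al0 != 0 /\
  forall s al, s != 0 -> eval2 d s al != 0 -> T s al.

(* [f s al = s^j (c + ...)], where the dots stand for a rational function of s
   and al that vanishes at (0, al0); c may be 0. *)
Definition lead f (j : nat) c : Prop := exists n d,
  [/\ eval2 d 0 al0 != 0, eval2 n 0 al0 = c * eval2 d 0 al0 &
      forall s al, s != 0 -> eval2 d s al != 0 ->
        f s al * eval2 d s al = s ^+ j * eval2 n s al].

Arguments lead f j%_N c.

Lemma near_all T : (forall s al, s != 0 -> T s al) -> near T.
Proof. by move=> H; exists 1%:P; split=> [|s al s0 _];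
  [rewrite eval2C hornerC oner_eq0 | apply: H]. Qed.

Lemma near_and T U : near T -> near U -> near (fun s al => T s al /\ U s al).
Proof.
move=> [d [d0 H]] [d' [d0' H']]; exists (d * d'); rewrite eval2M mulf_neq0 //.
split=> // s al s0; rewrite eval2M mulf_eq0 negb_or => /andP[dn dn'].
by split; [apply: H | apply: H'].
Qed.

Lemma near_impl T U : (forall s al, s != 0 -> T s al -> U s al) -> near T -> near U.
Proof. by move=> TU [d [d0 H]]; exists d; split=> // s al s0 ds; apply/TU/H. Qed.

Lemma near_seq (I : eqType) (r : seq I) (F : I -> k -> k -> Prop) :
  (forall i, i \in r -> near (F i)) -> near (fun s al => forall i, i \in r -> F i s al).
Proof.
elim: r => [|i r IH] nF; first exact: near_all.
have Fi : near (F i) by apply: nF; rewrite inE eqxx.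
have Fr : near (fun s al => forall i, i \in r -> F i s al).
  by apply: IH => j jr; apply: nF; rewrite inE jr orbT.
apply: near_impl (near_and Fi Fr) => s al s0 [Hi Hr] j.
by rewrite inE => /orP[/eqP ->|/Hr].
Qed.

Lemma lead_ext f g j c : near (fun s al => f s al = g s al) -> lead f j c -> lead g j c.
Proof.
move=> [d [d0 H]] [n [d' [d0' n0 fE]]]; exists (n * d), (d' * d).
rewrite !eval2M mulf_neq0 //; split=> //; first by rewrite n0 mulrA.
move=> s al s0; rewrite !eval2M mulf_eq0 negb_or => /andP[ds' ds].
by rewrite -H // !mulrA fE.
Qed.

Lemma lead_eq f j c c' : c = c' -> lead f j c -> lead f j c'.
Proof. by move=> ->. Qed.

Lemma lead_const c : lead (fun _ _ => c) 0 c.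
Proof.
exists c%:P%:P, 1%:P; rewrite !eval2C !hornerC oner_eq0 mulr1; split=> // s al _ _.
by rewrite !eval2C !hornerC expr0 mulr1 mul1r.
Qed.

Lemma lead_s : lead (fun s _ => s) 1 1.
Proof.
exists 1%:P, 1%:P; rewrite !eval2C !hornerC oner_eq0 mulr1; by split.
Qed.

Lemma lead_al : lead (fun _ al => al) 0 al0.
Proof.
exists 'X, 1%:P; rewrite !eval2C !hornerC oner_eq0 mulr1 /eval2 hornerX hornerC.
by split=> // s al _ _; rewrite hornerX !hornerC expr0 mulr1 mul1r.
Qed.

Lemma leadM f g i j c c' : lead f i c -> lead g j c' ->
  lead (fun s al => f s al * g s al) (i + j) (c * c').
Proof.
move=> [n [d [d0 n0 fE]]] [n' [d' [d0' n0' gE]]]; exists (n * n'), (d * d').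
rewrite !eval2M mulf_neq0 //; split=> //; first by rewrite n0 n0' mulrACA.
move=> s al s0; rewrite !eval2M mulf_eq0 negb_or => /andP[ds ds'].
by rewrite mulrACA fE // gE // exprD mulrACA.
Qed.

Lemma leadD f g j c c' : lead f j c -> lead g j c' ->
  lead (fun s al => f s al + g s al) j (c + c').
Proof.
move=> [n [d [d0 n0 fE]]] [n' [d' [d0' n0' gE]]]; exists (n * d' + n' * d), (d * d').
rewrite !eval2D !eval2M mulf_neq0 //; split=> //; first by rewrite n0 n0'; ring.
move=> s al s0; rewrite !eval2D !eval2M mulf_eq0 negb_or => /andP[ds ds'].
have e := fE s al s0 ds; have e' := gE s al s0 ds'.
by apply: (lincomb2 (c := eval2 d' s al) (c' := eval2 d s al) e e'); ring.
Qed.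

Lemma leadN f j c : lead f j c -> lead (fun s al => - f s al) j (- c).
Proof.
move=> fl; apply: (lead_eq _ (lead_ext _ (leadM (lead_const (-1)) fl)));
  first by rewrite mulN1r.
by apply: near_all => s al _; rewrite mulN1r.
Qed.

Lemma leadB f g j c c' : lead f j c -> lead g j c' ->
  lead (fun s al => f s al - g s al) j (c - c').
Proof. by move=> fl /leadN; apply: leadD. Qed.

Lemma leadW f i j c : (i < j)%N -> lead f j c -> lead f i 0.
Proof.
move=> ij [n [d [d0 n0 fE]]]; exists (('X^(j - i))%:P * n), d; split=> //.
  by rewrite eval2M eval2C hornerXn expr0n subn_eq0 leqNgt ij !mul0r.
move=> s al s0 ds; rewrite eval2M eval2C hornerXn mulrA -exprD subnKC ?(ltnW ij) //.
exact: fE.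
Qed.

Lemma lead_le f i j c c' : (i <= j)%N -> c' = (if i == j then c else 0) ->
  lead f j c -> lead f i c'.
Proof.
by rewrite leq_eqVlt => /orP[/eqP -> ->|ij ->]; rewrite ?eqxx // ltn_eqF //; apply: leadW.
Qed.

Lemma leadX f j c (i : nat) : lead f j c -> lead (fun s al =>
  f s al ^+ i) (i * j) (c ^+ i).
Proof.
move=> fl; elim: i => [|i IH].
  by apply: lead_ext (lead_const 1); apply: near_all => s al _; rewrite expr0.
rewrite mulSn exprS; apply: lead_ext (leadM fl IH).
by apply: near_all => s al _; rewrite exprS.
Qed.

Lemma lead_sn (i : nat) : lead (fun s _ => s ^+ i) i 1.
Proof. by have := leadX i lead_s; rewrite expr1n muln1. Qed.

Lemma lead_neq0 f j c : c != 0 -> lead f j c -> near (fun s al => f s al != 0).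
Proof.
move=> c0 [n [d [d0 n0 fE]]]; exists (d * n); rewrite eval2M n0 !mulf_neq0 //.
split=> // s al s0; rewrite eval2M mulf_eq0 negb_or => /andP[ds ns].
apply: contraNneq ns => f0; have := fE s al s0 ds; rewrite f0 mul0r => /esym/eqP.
by rewrite mulf_eq0 expf_eq0 (negPf s0) andbF.
Qed.

Lemma lead_div f g i j c c' : c' != 0 -> lead f (j + i) c -> lead g j c' ->
  lead (fun s al => f s al / g s al) i (c / c').
Proof.
move=> c0 [n [d [d0 n0 fE]]] gl; have [e [e0 gN]] := lead_neq0 c0 gl.
case: gl => [n' [d' [d0' n0' gE]]].
(* The common factors [e] and [d'] restrict to the open set where g is nonzero and its expansion is
   valid. *)
exists (n * d' * e * d'), (d * n' * e * d'); rewrite !eval2M n0 n0' !mulf_neq0 //;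
  split=> //.
  by rewrite -!mulrA; congr (_ * _); rewrite [in RHS](mulrCA _ c') mulKf // mulrA.
move=> s al s0; rewrite !eval2M !mulf_eq0 !negb_or => /andP[/andP[/andP[ds ns'] es] ds'].
have gs := gN s al s0 es; have e1 := fE s al s0 ds; have e2 := gE s al s0 ds'.
apply: (mulIf gs).
transitivity (f s al * eval2 d s al * eval2 n' s al * eval2 e s al * eval2 d' s al);
  first by field.
rewrite e1 exprD; transitivity
  (s ^+ i * eval2 n s al * eval2 e s al * eval2 d' s al *
  (s ^+ j * eval2 n' s al)); first by ring.
by rewrite -e2; ring.
Qed.

Lemma lead_sum (I : eqType) (r : seq I) (F : I -> k -> k -> k) j (c : I -> k) :
  (forall i, i \in r -> lead (F i) j (c i)) ->
  lead (fun s al => \sum_(i <- r) F i s al) j (\sum_(i <- r) c i).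
Proof.
elim: r => [|i r IH] Fc.
  rewrite big_nil; apply: (@lead_ext (fun _ _ => 0)).
    by apply: near_all => s al _; rewrite big_nil.
  have z : lead (fun _ _ => 0) j.+1 0.
    exists 0, 1%:P; rewrite eval2C hornerC oner_neq0 mul0r /eval2 !horner0.
    by split=> // s al _ _; rewrite !horner0 mulr0 mul0r.
  exact: leadW z.
have Fi : lead (F i) j (c i) by apply: Fc; rewrite inE eqxx.
have Fr : lead (fun s al => \sum_(j <- r) F j s al) j (\sum_(j <- r) c j).
  by apply: IH => j' jr; apply: Fc; rewrite inE jr orbT.
rewrite big_cons; apply: lead_ext (leadD Fi Fr).
by apply: near_all => s al _; rewrite big_cons.
Qed.

Lemma lead_prod (I : Type) (r : seq I) (F : I -> k -> k -> k) (c : I -> k) :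
  (forall i, lead (F i) 0 (c i)) ->
  lead (fun s al => \prod_(i <- r) F i s al) 0 (\prod_(i <- r) c i).
Proof.
move=> Fc; elim: r => [|i r IH].
  rewrite big_nil; apply: lead_ext (lead_const 1).
  by apply: near_all => s al _; rewrite big_nil.
rewrite big_cons; apply: lead_ext (leadM (Fc i) IH).
by apply: near_all => s al _; rewrite big_cons.
Qed.
End Lead.
Arguments lead {k} al0 f j%_N c.

(** * Torsion points near the nodal cubic *)

Section ChordAlgebra.
Variables (k : fieldType) (a : k).

Definition nodal_eq (x y : k) : Prop := y ^+ 2 + x * y = x ^+ 3 + a.

(** Substituting y = l x + mu gives a cubic in x whose roots have product mu^2 - a. This yields the
    order of [x'] directly, where its expression as a sum loses the leading terms. *)
Lemma nodal_chord x1 y1 x y l (mu := y - l * x) (x' := l ^+ 2 + l - x - x1)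
    (y' := - (l * (x' - x) + y) - x') :
    x != x1 -> l * (x - x1) = y - y1 -> nodal_eq x1 y1 -> nodal_eq x y ->
  [/\ x' * (x1 * x) = mu ^+ 2 - a, y' = - ((l + 1) * x') - mu & nodal_eq x' y'].
Proof.
rewrite -subr_eq0 => d0 le e1 e.
have y1E : y1 = y - l * (x - x1) by rewrite le; ring.
rewrite /nodal_eq y1E in e1.
have pr : x' * (x1 * x) = mu ^+ 2 - a.
  apply: (mulIf d0).
  by apply: (lincomb2 (c := - x) (c' := x1) e1 e); rewrite /mu /x'; ring.
split=> //; first by rewrite /y' /mu; ring.
rewrite /nodal_eq; apply: (mulIf d0).
by apply: (lincomb2 (c := x - x') (c' := x' - x1) e1 e); rewrite /y' /x'; ring.
Qed.
End ChordAlgebra.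

Section Sequence.
Variables (k : closedFieldType) (N : nat).
Hypothesis N5 : (5 <= N)%N.
Implicit Types (s al : k).

(* Near the nodal fibre of y^2 + x y = x^3 + a the abscissa of a point y = s x
   is s + s^2 - a / x^2, and (up to higher order terms) s is multiplicative. *)
Definition base_dl s al : k := al * s ^+ (N - 2).
Definition base_x s al : k := s + s ^+ 2 - base_dl s al.
Definition base_y s al : k := s * base_x s al.
Definition curve_a s al : k := base_x s al ^+ 2 * base_dl s al.

Definition line_next (s al : k) (l x y : k) : k * k :=
  let x' := l ^+ 2 + l - x - base_x s al in (x', - (l * (x' - x) + y) - x').

Definition tangent_slope s al : k :=
  (3 * base_x s al ^+ 2 - base_y s al) / (2 * base_y s al + base_x s al).
Definition chord_slope s al (p : k * k) : k := (p.2 - base_y s al) / (p.1 - base_x s al).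

(* The value at [i = 0] is a dummy. *)
Fixpoint mult (i : nat) s al : k * k :=
  match i with
  | 0 | 1 => (base_x s al, base_y s al)
  | i'.+1 => if i' == 1%N
             then line_next s al (tangent_slope s al) (base_x s al) (base_y s al)
             else line_next s al (chord_slope s al (mult i' s al)) (mult i' s al).1
               (mult i' s al).2
  end.

Definition mx i s al := (mult i s al).1.
Definition my i s al := (mult i s al).2.

Lemma mult1 s al : mult 1 s al = (base_x s al, base_y s al). Proof. by []. Qed.
Lemma mult2 s al : mult 2 s al = line_next s al (tangent_slope s al) (base_x s al)
  (base_y s al).
Proof. by []. Qed.
Lemma multS i s al : (2 <= i)%N ->
  mult i.+1 s al = line_next s al (chord_slope s al (mult i s al)) (mx i s al)
    (my i s al).
Proof. by case: i => [|[|i]]. Qed.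

Lemma base_eq s al : nodal_eq (curve_a s al) (base_x s al) (base_y s al).
Proof.
have e : base_x s al = s + s ^+ 2 - base_dl s al by [].
by rewrite /nodal_eq /curve_a /base_y; apply: (lincomb1 (c :=
  - base_x s al ^+ 2) e); ring.
Qed.

Section AtBase.
Variable al0 : k.
Local Notation lead f j c := (lead al0 f j%N c).
Local Notation near := (near al0).

Lemma lead_dl : lead base_dl (N - 2) al0.
Proof.
have := leadM (lead_al al0) (lead_sn al0 (N - 2)); rewrite mulr1 add0n.
exact: lead_ext (near_all _ _).
Qed.

Lemma lead_x1 : lead base_x 1 1.
Proof.
have l1 := lead_s al0.
have l2 : lead (fun s _ => s ^+ 2) 1 0 by apply: leadW (lead_sn al0 2).
have l3 : lead base_dl 1 0 by apply: leadW lead_dl; lia.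
by apply: lead_eq (leadB (leadD l1 l2) l3); ring.
Qed.

Lemma lead_y1 : lead base_y 2 1.
Proof. by apply: lead_eq (leadM (lead_s al0) lead_x1); ring. Qed.

Lemma lead_a : lead curve_a N al0.
Proof.
have := leadM (leadX 2 lead_x1) lead_dl; rewrite expr1n mul1r.
by have -> : (2 * 1 + (N - 2) = N)%N by lia.
Qed.

(* The ordinate of i times the base point has order at least i + 1, with
   coefficient 0 except at the two ends of the range. *)
Definition my_coef (i : nat) : k := (i == 1%N)%:R + (N == (2 * i).+1)%:R * al0.

Lemma my_coef0 i : i != 1%N -> N != (2 * i).+1 -> my_coef i = 0.
Proof. by rewrite /my_coef => /negPf -> /negPf ->; rewrite mul0r addr0. Qed.

Definition mult_lead (i : nat) : Prop :=
  [/\ lead (mx i) i 1, lead (my i) i.+1 (my_coef i)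
   & near (fun s al => nodal_eq (curve_a s al) (mx i s al) (my i s al))].

Lemma mult_lead1 : mult_lead 1.
Proof.
split; [exact: lead_x1 | | by apply: near_all => s al _; apply: base_eq].
apply: lead_eq lead_y1; rewrite /my_coef eqxx (_ : (N == _) = false) ?mul0r ?addr0 //.
by apply/eqP; lia.
Qed.

(* y (x + y) = x^3 + a determines the order of y from that of x. *)
Lemma lead_my i : (2 <= i)%N -> (2 * i < N)%N -> lead (mx i) i 1 -> lead (my i) i 0 ->
    near (fun s al => nodal_eq (curve_a s al) (mx i s al) (my i s al)) ->
  mult_lead i.
Proof.
move=> i2 iN lx ly eq; split=> //.
have lxy : lead (fun s al => mx i s al + my i s al) i 1.
  by apply: lead_eq (leadD lx ly); ring.
have lx3 : lead (fun s al => mx i s al ^+ 3) (2 * i).+1 0.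
  by apply: leadW (leadX 3 lx); lia.
have la : lead curve_a (2 * i).+1 (my_coef i).
  apply: lead_le lead_a; first by [].
  rewrite /my_coef (_ : (i == 1%N) = false) ?add0r; last by apply/eqP; lia.
  by rewrite eq_sym; case: eqP; rewrite ?mul1r ?mul0r.
have := lead_div (oner_neq0 k) (i := i.+1) (j := i) _ lxy.
move=> /(_ (fun s al => mx i s al ^+ 3 + curve_a s al) (my_coef i)).
have -> : (i + i.+1 = (2 * i).+1)%N by lia.
move=> H; have {H} := H _; rewrite divr1 => H.
apply: (lead_ext _ (H _)); last by apply: lead_eq (leadD lx3 la); rewrite add0r.
apply: near_impl (near_and eq (lead_neq0 (oner_neq0 k) lxy)) => s al s0 [e n0].
by apply: (mulIf n0); rewrite divfK // -e; ring.
Qed.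

(** As a = x^2 dl at the base point, the product of abscissas on the tangent turns l^2 + l - 2 x
    into (s - l)^2 - dl. With l about 2 s this is about s^2 in every characteristic. *)
Lemma mult_lead2 : mult_lead 2.
Proof.
have lx := lead_x1; have ly := lead_y1.
have num : lead (fun s al => 3 * base_x s al ^+ 2 - base_y s al) 2 2.
  by apply: lead_eq (leadB (leadM (lead_const al0 3) (leadX 2 lx)) ly);
    rewrite expr1n; ring.
have den : lead (fun s al => 2 * base_y s al + base_x s al) 1 1.
  apply: lead_eq (leadD (leadM (lead_const al0 2) (leadW _ ly)) lx); last by [].
  by ring.
have lt : lead tangent_slope 1 2.
  by have := lead_div (oner_neq0 k) (i := 1) (j := 1) num den; rewrite divr1.
have x0 := lead_neq0 (oner_neq0 k) lx; have den0 := lead_neq0 (oner_neq0 k) den.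
have facts : near (fun s al =>
  [/\ mx 2 s al = (s - tangent_slope s al) ^+ 2 - base_dl s al,
    my 2 s al = - ((tangent_slope s al + 1) * mx 2 s al) - base_x s al * (s
      - tangent_slope s al)
  & nodal_eq (curve_a s al) (mx 2 s al) (my 2 s al)]).
  apply: near_impl (near_and x0 den0) => s al s0 [x1n dn].
  have le : tangent_slope s al * (2 * s + 1) = 3 * base_x s al - s.
    apply: (mulIf x1n).
    have := divfK dn (3 * base_x s al ^+ 2 - base_y s al);
      rewrite -/(tangent_slope s al) => e.
    by apply: (lincomb1 (c := 1) e); rewrite /base_y; ring.
  rewrite /mx /my mult2 /line_next /=; move: (tangent_slope s al) le => l le.
  have xE : l ^+ 2 + l - base_x s al - base_x s al = (s - l) ^+ 2 - base_dl s al.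
    by apply: (lincomb1 (c := 1) le); rewrite /base_x; ring.
  rewrite xE; split=> //; first by rewrite /base_y; ring.
  rewrite /nodal_eq /curve_a; pose x' := (s - l) ^+ 2 - base_dl s al.
  by apply: (lincomb1 (c := x' * (x' - base_x s al)) le);
    rewrite /x' /base_y /base_x; ring.
have lx2 : lead (mx 2) 2 1.
  have lsl := leadB (lead_s al0) lt.
  have ldl : lead base_dl 2 0 by apply: leadW lead_dl; lia.
  apply: (@lead_ext _ _ (fun s al => (s - tangent_slope s al) ^+ 2 - base_dl s al)).
    by apply: near_impl facts => s al _ [-> _ _].
  by apply: lead_eq (leadB (leadX 2 lsl) ldl); ring.
apply: lead_my => //.
  apply: (@lead_ext _ _ (fun s al => - ((tangent_slope s al + 1) * mx 2 s al)
     - base_x s al * (s - tangent_slope s al))).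
    by apply: near_impl facts => s al _ [_ -> _].
  have l1 := leadD (leadW (ltn0Sn 0) lt) (lead_const al0 1).
  by apply: lead_eq (leadB (leadN (leadM l1 lx2)) (leadM lx (leadB
    (lead_s al0) lt))); ring.
by apply: near_impl facts => s al _ [].
Qed.

(** For i at least 2 the base point dominates both differences, y_i - y_1 about - s^2 and x_i - x_1
    about - s, so the slope is about s. *)
Lemma chord_lead i (mu := fun s al =>
  my i s al - chord_slope s al (mult i s al) * mx i s al) :
    (2 <= i)%N -> mult_lead i ->
  [/\ lead (fun s al => chord_slope s al (mult i s al)) 1 1,
      lead mu i.+1 (my_coef i - 1),
      near (fun s al => mx i s al != base_x s al)
    & near (fun s al => [/\ mx i.+1 s al * (base_x s al * mx i s al) = mu s al ^+ 2
      - curve_a s al,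
        my i.+1 s al = - ((chord_slope s al (mult i s al) + 1) * mx i.+1 s al) - mu s al
      & nodal_eq (curve_a s al) (mx i.+1 s al) (my i.+1 s al)])].
Proof.
move=> i2 [lx ly eq].
have num : lead (fun s al => my i s al - base_y s al) 2 (-1).
  by apply: lead_eq (leadB (leadW _ ly) lead_y1); [ring | lia].
have den : lead (fun s al => mx i s al - base_x s al) 1 (-1).
  by apply: lead_eq (leadB (leadW _ lx) lead_x1); [ring | lia].
have N1 : -1 != 0 :> k by rewrite oppr_eq0 oner_eq0.
have ll : lead (fun s al => chord_slope s al (mult i s al)) 1 1.
  by have := lead_div N1 (i := 1) (j := 1) num den; rewrite divff.
have d0 := lead_neq0 N1 den.
split=> //.
- by apply: lead_eq (leadB ly (leadM ll lx)); ring.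
- by apply: near_impl d0 => s al _; rewrite subr_eq0.
apply: near_impl (near_and d0 eq) => s al s0 [dn e].
have le : chord_slope s al (mult i s al) * (mx i s al - base_x s al) = my i s al
  - base_y s al.
  exact: divfK.
have ne : mx i s al != base_x s al by rewrite -subr_eq0.
have [e1 e2 e3] := nodal_chord ne le (base_eq s al) e.
by rewrite [mx i.+1]/mx [my i.+1]/my multS //=; split.
Qed.

(** In the product formula mu^2 counts from order 2 (i + 1) and a from order N. Before the middle
    the former decides, past it the latter, and at 2 (i + 1) = N both contribute; hence the two
    conditionals. *)
Lemma lead_next i : (2 <= i)%N -> mult_lead i -> forall j c,
    (i.+1 + j <= N)%N -> (i.+1 + j <= 2 * i.+1)%N ->
    c = (if (i.+1 + j == 2 * i.+1)%N then (my_coef i - 1) ^+ 2 else 0)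
        - (if (i.+1 + j == N)%N then al0 else 0) ->
  lead (mx i.+1) j c.
Proof.
move=> i2 li j c jN ji cE; have [lx _ _] := li.
have [_ lmu _ facts] := chord_lead i2 li.
have lnum := leadB (lead_le ji erefl (leadX 2 lmu)) (lead_le jN erefl lead_a).
have lden := leadM lead_x1 lx.
have := lead_div _ lnum lden; rewrite mulr1 oner_neq0 divr1 -cE => /(_ isT) l.
apply: (lead_ext _ l).
have n0 : near (fun s al => base_x s al * mx i s al != 0).
  by apply: lead_neq0 lden; rewrite mulr1 oner_neq0.
apply: near_impl (near_and facts n0) => s al s0 [[e _ _] n].
by apply: (mulIf n); rewrite divfK // e.
Qed.

Lemma mult_leadS i : (2 <= i)%N -> (2 * i.+1 < N)%N -> mult_lead i -> mult_lead i.+1.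
Proof.
move=> i2 iN li; have [ll lmu _ facts] := chord_lead i2 li.
have c0 : my_coef i = 0.
  by apply: my_coef0; apply/eqP; lia.
have lx : lead (mx i.+1) i.+1 1.
  apply: lead_next => //; [by lia | by lia |].
  rewrite c0 (_ : (i.+1 + i.+1 == 2 * i.+1)%N = true); last by apply/eqP; lia.
  rewrite (_ : (i.+1 + i.+1 == N)%N = false); last by apply/eqP; lia.
  by rewrite sub0r sqrrN expr1n subr0.
apply: lead_my => //; [by lia | |].
  apply: (@lead_ext _ _ (fun s al =>
    - ((chord_slope s al (mult i s al) + 1) * mx i.+1 s al)
     - (my i s al - chord_slope s al (mult i s al) * mx i s al))).
    by apply: near_impl facts => s al _ [_ -> _].
  have l1 := leadD (leadW (ltn0Sn 0) ll) (lead_const al0 1).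
  by apply: lead_eq (leadB (leadN (leadM l1 lx)) lmu); rewrite c0; ring.
by apply: near_impl facts => s al _ [].
Qed.

Lemma mult_leadP i : (0 < i)%N -> (2 * i < N)%N -> mult_lead i.
Proof.
elim: i => [|[|[|i]] IH] // _ iN; [exact: mult_lead1 | exact: mult_lead2 |].
by apply: mult_leadS => //; apply: IH => //; lia.
Qed.

Lemma lead_middle : ~~ odd N -> lead (mx N./2) N./2 (1 - al0) /\ lead (my N./2) N./2 al0.
Proof.
move=> oN; have NE := odd_double_half N; rewrite -mul2n (negPf oN) add0n in NE.
have [m mE] : exists m, N./2 = m.+1 by exists N./2.-1; lia.
rewrite mE in NE *.
have lm : mult_lead m by apply: mult_leadP; lia.
have m2 : (2 <= m)%N by lia.
have [ll lmu _ facts] := chord_lead m2 lm.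
have c0 : my_coef m = 0 by apply: my_coef0; apply/eqP; lia.
have lx : lead (mx m.+1) m.+1 (1 - al0).
  apply: lead_next => //; [by lia | by lia |].
  rewrite c0 (_ : (m.+1 + m.+1 == 2 * m.+1)%N = true); last by apply/eqP; lia.
  rewrite (_ : (m.+1 + m.+1 == N)%N = true); last by apply/eqP; lia.
  by rewrite sub0r sqrrN expr1n.
split=> //; apply: (@lead_ext _ _ (fun s al =>
  - ((chord_slope s al (mult m s al) + 1) * mx m.+1 s al)
     - (my m s al - chord_slope s al (mult m s al) * mx m s al))).
  by apply: near_impl facts => s al _ [_ -> _].
have l1 := leadD (leadW (ltn0Sn 0) ll) (lead_const al0 1).
by apply: lead_eq (leadB (leadN (leadM l1 lx)) lmu); rewrite c0; ring.
Qed.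

(* [torsion] vanishes if and only if N times the base point is the origin. *)
Definition torsion s al : k :=
  if odd N then mx N./2.+1 s al - mx N./2 s al else 2 * my N./2 s al + mx N./2 s al.

(** The factor 1 + al0 singles out the base point (0, -1). The other values of al0 serve to show
    that the torsion curve does not contain the line s = 0. *)
Lemma lead_torsion : lead torsion N./2 ((-1) ^+ odd N * (1 + al0)).
Proof.
rewrite /torsion; case: (boolP (odd N)) => oN /=; last first.
  have [lx ly] := lead_middle oN.
  by apply: lead_eq (leadD (leadM (lead_const al0 2) ly) lx); ring.
have NE := odd_double_half N; rewrite -mul2n oN add1n in NE.
have lm : mult_lead N./2 by apply: mult_leadP; lia.
have [lx _ _] := lm; rewrite expr1.
have l1 : lead (mx N./2.+1) N./2 (- al0).
  apply: lead_next => //; try lia.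
  rewrite (_ : (N./2.+1 + N./2 == N)%N = true); last by apply/eqP; lia.
  by rewrite (_ : (_ == (2 * _)%N) = false) ?sub0r //; apply/eqP; lia.
by apply: lead_eq (leadB l1 lx); ring.
Qed.

End AtBase.
End Sequence.

Section NodalCurve.
Variables (k : closedFieldType) (N : nat).
Hypothesis N5 : (5 <= N)%N.
Implicit Types (s al : k).
Local Notation b0 := (-1 : k).

Definition nodal_weierstrass (a : k) : weierstrass k := Weierstrass 1 0 0 0 a.

Lemma nodal_discriminant a : discriminant (nodal_weierstrass a) = - a * (1 + 432 * a).
Proof. by rewrite /discriminant /b2 /b4 /b6 /b8 /=; ring. Qed.

(** Smoothness, and nonzero denominators in the recursion [mult], so that it computes multiples of
    an actual point instead of default values of division by zero. *)
Record generic_param s al : Prop := GenericParam {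
  nd_disc : discriminant (nodal_weierstrass (curve_a N s al)) != 0;
  nd_tangent : 2 * base_y N s al + base_x N s al != 0;
  nd_chord : forall i, (2 <= i)%N -> (2 * i < N)%N -> mx N i s al != base_x N s al }.

Lemma near_generic_param : near b0 generic_param.
Proof.
have N1 : -1 != 0 :> k by rewrite oppr_eq0 oner_eq0.
have la := lead_a N5 b0.
have l1 : lead b0 (fun s al => - curve_a N s al * (1 + 432 * curve_a N s al)) N 1.
  have la0 : lead b0 (curve_a N) 0 0 by apply: (leadW _ la); lia.
  have := leadM (leadN la) (leadD (lead_const b0 1) (leadM (lead_const b0 432) la0)).
  by rewrite addn0; apply: lead_eq; ring.
have l2 : lead b0 (fun s al => 2 * base_y N s al + base_x N s al) 1 1.
  apply: lead_eq (leadD (leadM (lead_const b0 2) (leadW _ (lead_y1 N5 b0)))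
    (lead_x1 N5 b0)).
    by ring.
  by [].
have l3 : near b0 (fun s al => forall i, i \in index_iota 2 (uphalf N) ->
  mx N i s al != base_x N s al).
  apply: near_seq => i; rewrite mem_index_iota => /andP[i2 iN].
  have iN' : (2 * i < N)%N by move: iN; rewrite gtn_uphalf_double -mul2n.
  by have [] := chord_lead N5 i2 (mult_leadP N5 b0 (ltnW i2) iN').
have g := near_and (lead_neq0 (oner_neq0 k) l1) (near_and (lead_neq0
  (oner_neq0 k) l2) l3).
apply: near_impl g => s al _ [h1 [h2 h3]]; split=> //;
  first by rewrite nodal_discriminant.
by move=> i i2 iN; apply: h3; rewrite mem_index_iota i2 gtn_uphalf_double -mul2n.
Qed.

Section Points.
Variables s al : k.
Hypotheses (nd : generic_param s al) (tors : torsion N s al = 0).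

Definition nodal_curve : elliptic_curve k := EllipticCurve (nd_disc nd).

Lemma on_curve_base : on_curve nodal_curve (Some (base_x N s al, base_y N s al)).
Proof.
by apply/on_curveP; have e := base_eq N s al; apply: (lincomb1 (c := 1) e) => /=; ring.
Qed.

Definition base_point : point nodal_curve :=
  exist (on_curve nodal_curve) (Some (base_x N s al, base_y N s al)) on_curve_base.
Local Notation T := base_point.

Lemma val_mult i : (0 < i)%N -> (2 * i < N.+2)%N -> val (T *+ i) = Some (mult N i s al).
Proof.
elim: i => // i IH _ iN; case: (posnP i) => [->|i0]; first by rewrite mulr1n.
have IHi : val (T *+ i) = Some (mult N i s al) by apply: IH => //; lia.
rewrite mulrSr; change (raw_add nodal_curve (val (T *+ i)) (Some (base_x N s al,
  base_y N s al)) = Some (mult N i.+1 s al)).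
have oi := valP (T *+ i); have oT := on_curve_base.
rewrite IHi in oi *.
have [i1|i1] := eqVneq i 1%N.
  rewrite i1 mult1 mult2 in oi *.
  have nopp : ~ (base_x N s al = base_x N s al /\ base_y N s al = neg_y nodal_curve
    (base_x N s al) (base_y N s al)).
    move=> [_ e]; move/eqP: (nd_tangent nd); apply.
    by apply: (lincomb1 (c := 1) e); rewrite /neg_y /=; ring.
  case: (raw_addP oT oT) => [? ?|m _ mE _]; first by case: nopp.
  have -> : m = tangent_slope N s al.
    rewrite mE /slope eqxx /= /tangent_slope; congr (_ / _); ring.
  by rewrite /line_next /neg_y /=; congr (Some (_, _)); ring.
have i2 : (2 <= i)%N by lia.
have ne : mx N i s al != base_x N s al by apply: (nd_chord nd); lia.
have pE : Some (mult N i s al) = Some (mx N i s al, my N i s al).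
  by rewrite [mult _ _ _ _]surjective_pairing.
rewrite multS // pE in oi *.
case: (raw_addP oi oT) => [e|m _ mE _]; first by rewrite e eqxx in ne.
have -> : m = chord_slope N s al (mult N i s al).
  rewrite mE /slope (negPf ne) /chord_slope -/(mx N i s al) -/(my N i s al).
  by rewrite -opprB -(opprB (mx _ _ _ _)) invrN mulrN mulNr opprK.
by rewrite /line_next /neg_y /=; congr (Some (_, _)); ring.
Qed.

Lemma mult_neq0 i : (0 < i)%N -> (2 * i < N.+2)%N -> T *+ i != 0.
Proof. by move=> i0 iN; apply: affine_neq0 (val_mult i0 iN). Qed.

Lemma base_torsion : T *+ N = 0.
Proof.
have NE := odd_double_half N; rewrite -addnn in NE.
have h0 : (0 < N./2)%N by lia.
have hN : (2 * N./2 < N.+2)%N by lia.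
have vh := val_mult h0 hN; have nh := mult_neq0 h0 hN.
have xh : xc (T *+ N./2) = mx N N./2 s al by rewrite /xc vh.
have yh : yc (T *+ N./2) = my N N./2 s al by rewrite /yc vh.
move: tors; rewrite /torsion; case: (boolP (odd N)) NE => oN NE.
  have hN' : (2 * N./2.+1 < N.+2)%N by lia.
  have nh' := mult_neq0 (ltn0Sn _) hN'.
  move=> /eqP; rewrite subr_eq0 => /eqP e.
  have xh' : xc (T *+ N./2.+1) = xc (T *+ N./2) by rewrite xh -e /xc (val_mult _ hN').
  (* With h = N./2, equal abscissas mean (h + 1) T = h T, which would give T = 0, or (h + 1) T = - h
     T, which is N T = 0. *)
  have [e'|e'] := same_xc nh' nh xh'.
    have T0 : T *+ 1 = 0 by apply: (@addrI _ (T *+ N./2)); rewrite -mulrSr e' addr0.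
    have lt1 : (2 * 1 < N.+2)%N by lia.
    by have := mult_neq0 (ltn0Sn 0) lt1; rewrite T0 eqxx.
  rewrite -NE add1n -addSn mulrnDr e' addNr //.
move=> e; have TN : T *+ N./2 = - (T *+ N./2).
  apply: point_ext; rewrite ?oppr_eq0 ?xcN // ycN // xh yh /=.
  by apply: (lincomb1 (c := 1) e); ring.
by rewrite -NE add0n mulrnDr {1}TN addNr.
Qed.

Lemma base_order i : (0 < i < N)%N -> T *+ i != 0.
Proof.
move=> /andP[i0 iN]; have [lt|le] := ltnP (2 * i) N.+2; first exact: mult_neq0.
have e : T *+ (N - i) = - (T *+ i) by rewrite mulrnBr ?(ltnW iN) // base_torsion sub0r.
by rewrite -oppr_eq0 -e mult_neq0 //; lia.
Qed.
End Points.
End NodalCurve.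

(** * The quotient curves *)

Section NodalQuotients.
Variables (k : closedFieldType) (N : nat).
Hypothesis N5 : (5 <= N)%N.
Implicit Types (s al : k) (n d : nat).
Local Notation b0 := (-1 : k).

(** Joint contributions of T and - T to t and w: the ordinates drop out because y_T + y_{-T} = - x
    and psi_T^2 = 4 x^3 + x^2 + 4 a. *)
Definition pair_t (x : k) : k := 6 * x ^+ 2 + x.
Definition pair_w (a x : k) : k := 10 * x ^+ 3 + 2 * x ^+ 2 + 4 * a.

(* Velu's sums for the subgroup of order d generated by n times the base point,
   over representatives modulo T ~ - T. *)
Definition quot_t n d s al : k :=
  \sum_(1 <= i < uphalf d) pair_t (mx N (n * i) s al)
  + (if odd d then 0 else 3 * mx N N./2 s al ^+ 2 - my N N./2 s al).
Definition quot_w n d s al : k :=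
  \sum_(1 <= i < uphalf d) pair_w (curve_a N s al) (mx N (n * i) s al)
  + (if odd d then 0 else mx N N./2 s al * (3 * mx N N./2 s al ^+ 2 - my N N./2 s al)).

(** The unreduced coefficients 0 and 1 ^+ 2 + 4 * 0, which is b2, match the unfolding of [velu] for
    the nodal equation. *)
Definition quot_curve n d s al : weierstrass k :=
  let t := quot_t n d s al in
  Weierstrass 1 0 0 (0 - 5 * t)
    (curve_a N s al - (1 ^+ 2 + 4 * 0) * t - 7 * quot_w n d s al).

Definition quot_j n d s al : k :=
  c4 (quot_curve n d s al) ^+ 3 / discriminant (quot_curve n d s al).

Section Leads.
Variables (n d : nat).
Hypotheses (n0 : (0 < n)%N) (d3 : (3 <= d)%N) (ndN : (n * d = N)%N).

Let lead_mult i : (0 < i < uphalf d)%N -> lead b0 (mx N (n * i)) (n * i) 1.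
Proof.
move=> /andP[i0 id]; have [] // := mult_leadP N5 b0 (i := (n * i)%N) _ _.
  by rewrite muln_gt0 n0.
by rewrite -ndN mulnCA ltn_pmul2l // mul2n -gtn_uphalf_double.
Qed.

Let half_gt : ~~ odd d -> ~~ odd N /\ (n < N./2)%N.
Proof.
move=> od; split; first by rewrite -ndN oddM negb_and od orbT.
have dE := odd_double_half d; rewrite (negPf od) add0n in dE.
by rewrite -ndN -dE -muln2 mulnA muln2 doubleK -{1}(muln1 n) ltn_pmul2l //; lia.
Qed.

Let lead_half : ~~ odd d -> lead b0 (fun s al =>
  3 * mx N N./2 s al ^+ 2 - my N N./2 s al) n 0.
Proof.
move=> od; have [oN nN] := half_gt od; have [lx ly] := lead_middle N5 b0 oN.
have lx2 : lead b0 (fun s al =>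
  mx N N./2 s al ^+ 2) n 0 by apply: leadW (leadX 2 lx); lia.
by apply: lead_eq (leadB (leadM (lead_const b0 3) lx2) (leadW nN ly)); ring.
Qed.

Let lead_an : lead b0 (curve_a N) n 0.
Proof.
by apply: leadW (lead_a N5 b0); rewrite -ndN -{1}(muln1 n) ltn_pmul2l //; lia.
Qed.

(** Only the linear term of the pair of n T and - n T counts at order n. The squares and the other
    multiples contribute nothing there, nor does the point of order two, since n < N/2. *)
Lemma lead_quot_t : lead b0 (quot_t n d) n 1.
Proof.
have pair i : (0 < i < uphalf d)%N -> lead b0 (fun s al =>
  pair_t (mx N (n * i) s al)) n (i == 1%N)%:R.
  move=> id; have l := lead_mult id; have i0 : (0 < i)%N by case/andP: id.
  have l2 : lead b0 (fun s al => mx N (n * i) s al ^+ 2) n 0.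
    by apply: leadW (leadX 2 l); nia.
  have l1 : lead b0 (mx N (n * i)) n (i == 1%N)%:R.
    apply: lead_le l; first by nia.
    by rewrite -{1}(muln1 n) eqn_pmul2l // eq_sym; case: eqP.
  by apply: lead_eq (leadD (leadM (lead_const b0 6) l2) l1); ring.
have sum := @lead_sum _ b0 _ (index_iota 1 (uphalf d)) (fun i s al =>
  pair_t (mx N (n * i) s al)) n
   (fun i => (i == 1%N)%:R).
have {sum} l : lead b0 (fun s al =>
  \sum_(1 <= i < uphalf d) pair_t (mx N (n * i) s al)) n 1.
  apply: lead_eq (sum _) => [|i]; last by rewrite mem_index_iota; apply: pair.
  have u2 : (1 < uphalf d)%N by rewrite uphalf_half; have := odd_double_half d; lia.
  rewrite (big_ltn u2) eqxx big_nat big1 ?addr0 // => i /andP[i2 _].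
  by rewrite (_ : (i == 1%N) = false) //; apply/eqP; lia.
rewrite /quot_t; case: (boolP (odd d)) => od.
  by apply: lead_ext l; apply: near_all => s al _; rewrite addr0.
by apply: lead_eq (leadD l (lead_half od)); rewrite addr0.
Qed.

Lemma lead_quot_w : lead b0 (quot_w n d) n 0.
Proof.
have pair i : (0 < i < uphalf d)%N ->
    lead b0 (fun s al => pair_w (curve_a N s al) (mx N (n * i) s al)) n 0.
  move=> id; have l := lead_mult id; have i0 : (0 < i)%N by case/andP: id.
  have l2 : lead b0 (fun s al => mx N (n * i) s al ^+ 2) n 0.
    by apply: leadW (leadX 2 l); nia.
  have l3 : lead b0 (fun s al => mx N (n * i) s al ^+ 3) n 0.
    by apply: leadW (leadX 3 l); nia.
  apply: lead_eq (leadD (leadD (leadM (lead_const b0 10) l3) (leadM (lead_const b0 2) l2))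
    (leadM (lead_const b0 4) lead_an)); ring.
have sum := @lead_sum _ b0 _ (index_iota 1 (uphalf d))
  (fun i s al => pair_w (curve_a N s al) (mx N (n * i) s al)) n (fun=> 0).
have {sum} l : lead b0 (fun s al =>
  \sum_(1 <= i < uphalf d) pair_w (curve_a N s al) (mx N (n * i) s al)) n 0.
  apply: lead_eq (sum _) => [|i]; first by rewrite big1.
  by rewrite mem_index_iota; apply: pair.
rewrite /quot_w; case: (boolP (odd d)) => od.
  by apply: lead_ext l; apply: near_all => s al _; rewrite addr0.
have [oN nN] := half_gt od; have [lx _] := lead_middle N5 b0 oN.
have lx0 : lead b0 (mx N N./2) 0 0 by apply: leadW lx; lia.
by apply: lead_eq (leadD l (leadM lx0 (lead_half od))); ring.
Qed.

(** The only term of the discriminant of degree one in a4 and a6 is - a6, and a6 is about - t, as a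
    and w contribute nothing at order n. *)
Lemma lead_quot_disc : lead b0 (fun s al => discriminant (quot_curve n d s al)) n 1.
Proof.
have lt := lead_quot_t; have lw := lead_quot_w.
pose v s al := curve_a N s al - quot_t n d s al - 7 * quot_w n d s al.
have lv : lead b0 v n (-1).
  by apply: lead_eq (leadB (leadB lead_an lt) (leadM (lead_const b0 7) lw)); ring.
have drop f g c c' : lead b0 f n c -> lead b0 g n c' -> lead b0 (fun s al =>
  f s al * g s al) n 0.
  by move=> lf lg; apply: leadW (leadM lf lg); lia.
have ltt := drop _ _ _ _ lt lt; have lttt := drop _ _ _ _ lt ltt.
have lvv := drop _ _ _ _ lv lv; have ltv := drop _ _ _ _ lt lv.
have l := leadB (leadB (leadD (leadD (leadN lv) (leadM (lead_const b0 25) ltt))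
  (leadM (lead_const b0 8000) lttt)) (leadM (lead_const b0 432) lvv))
  (leadM (lead_const b0 360) ltv).
apply: (lead_ext _ (lead_eq _ l)); last by ring.
apply: near_all => s al _; rewrite /discriminant /b2 /b4 /b6 /b8 /quot_curve /= /v.
by move: (quot_t _ _ _ _) (quot_w _ _ _ _) (curve_a _ _ _) => t w a; ring.
Qed.

Lemma lead_quot_c4 : lead b0 (fun s al => c4 (quot_curve n d s al)) 0 1.
Proof.
have lt : lead b0 (quot_t n d) 0 0 by apply: leadW lead_quot_t.
apply: (lead_ext _ (lead_eq _ (leadD (lead_const b0 1) (leadM
  (lead_const b0 240) lt)))); last by ring.
apply: near_all => s al _; rewrite /c4 /b2 /b4 /quot_curve /=.
by move: (quot_t _ _ _ _) => t; ring.
Qed.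

Lemma lead_quot_j : lead b0 (fun s al => s ^+ n * quot_j n d s al) 0 1.
Proof.
have ln : lead b0 (fun s _ => s ^+ n) (n + 0) 1 by rewrite addn0; apply: lead_sn.
have l := leadM (leadX 3 lead_quot_c4) (lead_div (oner_neq0 k) ln lead_quot_disc).
apply: (lead_ext _ (lead_eq _ l)); last by rewrite expr1n divr1 mulr1.
by apply: near_all => s al _; rewrite /quot_j mulrCA.
Qed.
End Leads.

Section Quotient.
Variables (s al : k) (nd : generic_param N s al) (tors : torsion N s al = 0).
Variables (n d : nat).
Hypotheses (n0 : (0 < n)%N) (d0 : (0 < d)%N) (ndN : (n * d = N)%N).
Hypothesis d_odd_or_char : odd d \/ 2 != 0 :> k.
Hypothesis disc : discriminant (quot_curve n d s al) != 0.
Local Notation T := (base_point nd).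
Local Notation G := (T *+ n).

Lemma velu_quot_curve : velu G d = quot_curve n d s al.
Proof.
have multE i : (0 < i)%N -> (2 * i <= d)%N ->
    [/\ xc (G *+ i) = mx N (n * i) s al, yc (G *+ i) = my N (n * i) s al & G *+ i != 0].
  move=> i0 id; have v : val (G *+ i) = Some (mult N (n * i) s al).
    rewrite -mulrnA; apply: (val_mult N5) => //; first by rewrite muln_gt0 n0.
    by rewrite -ndN mulnCA ltnS; apply: leqW; rewrite leq_mul2l id orbT.
  by rewrite /xc /yc v (affine_neq0 v) /mx /my; case: (mult _ _ _ _).
have G_opp i : (0 < i < uphalf d)%N ->
    [/\ G *+ (d - i) = - (G *+ i), G *+ i != 0, xc (G *+ i) = mx N (n * i) s al
      & nodal_eq (curve_a N s al) (xc (G *+ i)) (yc (G *+ i))].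
  move=> /andP[i0 id]; have id' : (2 * i < d)%N by rewrite mul2n -gtn_uphalf_double.
  have [xE _ Gi] := multE i i0 (ltnW id'); split=> //.
    have id2 : (i <= d)%N by lia.
    by rewrite mulrnBr // -mulrnA ndN (base_torsion N5) // sub0r.
  by have e := curve_eq Gi; rewrite /nodal_eq; apply: (lincomb1 (c := 1) e) => /=; ring.
have middle : ~~ odd d -> [/\ G *+ d./2 != 0, xc (G *+ d./2) = mx N N./2 s al,
    yc (G *+ d./2) = my N N./2 s al & 2 * yc (G *+ d./2) + xc (G *+ d./2) = 0].
  move=> od; have dE := odd_double_half d; rewrite (negPf od) add0n -mul2n in dE.
  have h0 : (0 < d./2)%N by lia.
  have hE : (n * d./2 = N./2)%N by rewrite -ndN -{2}dE mulnCA mul2n doubleK.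
  have [xE yE Gh] := multE _ h0 (eq_leq dE); rewrite hE in xE yE; split=> //.
  have oN : ~~ odd N by rewrite -ndN oddM negb_and od orbT.
  by move: tors; rewrite /torsion (negPf oN) xE yE.
have tE : velu_t G d = quot_t n d s al.
  rewrite /velu_t sum_pairs (gtn_eqF d0) orbF /quot_t; congr (_ + _); last first.
    case: (boolP (odd d)) => // /middle[_ xE yE _].
    by rewrite /tangent_x xE yE /=; ring.
  rewrite big_nat [RHS]big_nat; apply: eq_bigr => i /G_opp[-> Gi xE _].
  by rewrite /tangent_x xcN ycN // -xE /pair_t /=; ring.
have wE : velu_w G d = quot_w n d s al.
  rewrite /velu_w sum_pairs (gtn_eqF d0) orbF /quot_w; congr (_ + _); last first.
    case: (boolP (odd d)) => // /middle[_ xE yE e].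
    rewrite /tangent_x /tangent_y -xE -yE /=.
    by apply: (lincomb1 (c := yc (G *+ d./2)) e); ring.
  rewrite big_nat [RHS]big_nat; apply: eq_bigr => i /G_opp[-> Gi xE e].
  rewrite /tangent_x /tangent_y xcN ycN // -xE /pair_w /=.
  by apply: (lincomb1 (c := 4) e); ring.
by rewrite /velu tE wE.
Qed.

Lemma nodal_quotient : exists E' : elliptic_curve k,
  is_quotient E' (in_kernel G) /\ quot_j n d s al = j_invariant E'.
Proof.
have disc' := disc; rewrite -velu_quot_curve in disc'.
have Gd : G *+ d = 0 by rewrite -mulrnA ndN (base_torsion N5).
have G_order m : (0 < m < d)%N -> G *+ m != 0.
  move=> /andP[m0 md]; rewrite -mulrnA; apply: (base_order N5) => //.
  by rewrite muln_gt0 n0 m0 -ndN ltn_pmul2l.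
exists (velu_curve disc'); split; first exact: velu_quotient.
by rewrite /quot_j /j_invariant /= velu_quot_curve.
Qed.
End Quotient.
End NodalQuotients.

(** * Weights and dominant monomials *)

Section Digits.
Variables (B : nat).

Lemma digits_inj g (m m' : 'I_g -> nat) : (forall i, m i < B)%N -> (forall i,
  m' i < B)%N ->
  (\sum_(i < g) B ^ i * m i = \sum_(i < g) B ^ i * m' i)%N -> m =1 m'.
Proof.
elim: g m m' => [|g IH] m m' mB mB'; first by move=> _ [].
rewrite !big_ord_recl !expn0 !mul1n.
have shift (f : 'I_g.+1 -> nat) : (\sum_(i < g) B ^ lift ord0 i * f (lift ord0 i)
    = (\sum_(i < g) B ^ i * f (lift ord0 i)) * B)%N.
  by rewrite big_distrl; apply: eq_bigr => i _; rewrite expnS mulnAC mulnC mulnA mulnAC.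
rewrite !shift => e.
have B0 : (0 < B)%N by apply: leq_ltn_trans (mB ord0).
have e0 : m ord0 = m' ord0.
  by have := congr1 (modn^~ B) e; rewrite !(addnC _ (_ * B)%N) !modnMDl !modn_small.
have e1 : (\sum_(i < g) B ^ i * m (lift ord0 i) = \sum_(i < g) B ^ i * m'
  (lift ord0 i))%N.
  by move/eqP: e; rewrite e0 eqn_add2l eqn_pmul2r // => /eqP.
have := IH _ _ (fun i => mB _) (fun i => mB' _) e1 => H i.
by case: (unliftP ord0 i) => [j ->|->].
Qed.
End Digits.

Section DominantMonomial.
Variables (k : closedFieldType) (al0 : k) (g : nat) (e : 'I_g -> nat).

(* Monomials of distinct weights cannot cancel near s = 0. *)
Lemma near_meval_neq0 (p : {mpoly k[g]}) (v : 'I_g -> k -> k -> k) : p != 0 ->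
    {in msupp p &, injective (fun m : 'X_{1.. g} => \sum_i e i * m i)%N} ->
    (forall i, lead al0 (fun s al => s ^+ e i * v i s al) 0 1) ->
  near al0 (fun s al => p.@[fun i => v i s al] != 0).
Proof.
move=> p0 inj lv; pose wt (m : 'X_{1.. g}) := (\sum_i e i * m i)%N.
have [m mp mmax] : exists2 m, m \in msupp p & forall m', m' \in msupp p ->
  (wt m' <= wt m)%N.
  move: p0; rewrite -msupp_eq0; elim: (msupp p) => // m r IH _.
  have [->|/IH[m1 m1r m1max]] := eqVneq r [::].
    by exists m; rewrite ?inE // => m'; rewrite inE => /eqP ->.
  have [le|lt] := leqP (wt m1) (wt m).
    exists m; rewrite ?inE ?eqxx // => m'; rewrite inE => /orP[/eqP -> //|/m1max].
    by move/leq_trans; apply.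
  exists m1; rewrite ?inE ?m1r ?orbT // => m'; rewrite inE => /orP[/eqP ->|/m1max //].
  exact: ltnW.
(* Multiplied by s to the largest weight, each monomial becomes s^(wt m - wt m') times a function
   with value 1 at the base point; only m' = m survives there. *)
pose F (m' : 'X_{1.. g}) s al := p@_m' * (s ^+ (wt m - wt m')
  * \prod_i (s ^+ e i * v i s al) ^+ m' i).
have lF m' : m' \in msupp p -> lead al0 (F m') 0 (if m' == m then p@_m else 0).
  move=> m'p; have lp : lead al0 (fun s al => \prod_i (s ^+ e i * v i s al) ^+ m' i) 0 1.
    have := @lead_prod _ al0 _ (index_enum _) (fun i s al =>
      (s ^+ e i * v i s al) ^+ m' i) (fun=> 1).
    rewrite big1 // => H; apply: H => i.
    by have := leadX (m' i) (lv i); rewrite muln0 expr1n.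
  have ls : lead al0 (fun s _ => s ^+ (wt m - wt m')) 0 (m' == m)%:R.
    apply: (lead_le (leq0n _) _ (lead_sn al0 _)).
    have [->|ne] := eqVneq m' m; first by rewrite subnn.
    rewrite eq_sym (_ : (_ == 0)%N = false) //; apply/negP; rewrite subn_eq0 => le.
    by case/negP: ne; apply/eqP/inj => //; apply/eqP; rewrite eqn_leq mmax.
  apply: lead_eq (leadM (lead_const al0 p@_m') (leadM ls lp)).
  by case: eqP => [->|_]; rewrite !(mulr1, mulr0).
have lsum : lead al0 (fun s al => \sum_(m' <- msupp p) F m' s al) 0 p@_m.
  apply: lead_eq (lead_sum lF); rewrite -big_mkcond /= (big_rem m mp) /= eqxx.
  rewrite big_seq_cond big1 ?addr0 // => m' /andP[m'r /eqP m'm].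
  by move: m'r; rewrite m'm mem_rem_uniqF // msupp_uniq.
have pm : p@_m != 0 by rewrite -mcoeff_msupp.
apply: near_impl (lead_neq0 pm lsum) => s al s0; apply: contraNneq => pv; apply/eqP.
transitivity (s ^+ wt m * p.@[fun i => v i s al]); last by rewrite pv mulr0.
rewrite mevalE mulr_sumr big_seq [RHS]big_seq; apply: eq_bigr => m' m'p.
rewrite /F [RHS]mulrCA; congr (_ * _).
under eq_bigr => i _ do rewrite exprMn -exprM.
by rewrite big_split /= prodrXr mulrA -exprD subnK // mmax.
Qed.
End DominantMonomial.

(** * Comparing expansions at two base points *)

Section TwoBasePoints.
Variable k : closedFieldType.
Implicit Types (F : {poly {poly k}}) (s al : k).

Lemma poly_non_root (u : {poly k}) : u != 0 -> exists x, u.[x] != 0.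
Proof.
move=> /finite_roots[L uL]; have [x xL] := infinite_field L.
by exists x; apply: contra xL => /eqP ux; apply/uL/eqP.
Qed.

Lemma eval2_eq0 F : (forall s al, s != 0 -> eval2 F s al = 0) -> F = 0.
Proof.
move=> F0; apply/eqP/negPn/negP => Fn.
have [s] : exists s, ('X * lead_coef F).[s] != 0.
  by apply: poly_non_root; rewrite mulf_neq0 ?polyX_eq0 ?lead_coef_eq0.
rewrite hornerM hornerX mulf_eq0 negb_or => /andP[s0 ls].
have [al] : exists al, (map_poly (horner_eval s) F).[al] != 0.
  apply: poly_non_root; apply: contraNneq ls => z.
  have := congr1 (fun q : {poly k} => q`_(size F).-1) z.
  by rewrite coef_map coef0 /= horner_evalE => ->.
by rewrite -eval2_map F0 ?eqxx.
Qed.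

Lemma eval2_non_root F a : eval2 F 0 a != 0 -> map_poly (horner_eval 0) F != 0.
Proof. by apply: contraNneq => z; rewrite eval2_map z horner0. Qed.

(* The numerator of [f / s^j] does not depend, up to units, on the base point;
   hence it does not vanish identically on s = 0 if [f] has order exactly [j]
   at some other base point. *)
Lemma lead_zero_numerator (f : k -> k -> k) a b j c : c != 0 ->
    lead a f j 0 -> lead b f j c ->
  exists n d al, [/\ eval2 d 0 a != 0, eval2 n 0 a = 0, eval2 n 0 al != 0 &
    forall s al', s != 0 -> eval2 d s al' != 0 ->
      f s al' * eval2 d s al' = s ^+ j * eval2 n s al'].
Proof.
move=> c0 [n [d [d0 n0 fE]]] [n' [d' [d0' n0' fE']]].
have [al ald] : exists al, (map_poly (horner_eval 0) (n' * d)).[al] != 0.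
  apply: poly_non_root; rewrite rmorphM mulf_neq0 //; last exact: eval2_non_root d0.
  by apply: (@eval2_non_root _ b); rewrite n0' mulf_neq0.
rewrite -eval2_map in ald.
exists n, d, al; split=> //; first by rewrite n0 mul0r.
have dn : d != 0 by apply: contraNneq d0 => ->; rewrite /eval2 !horner0.
have dn' : d' != 0 by apply: contraNneq d0' => ->; rewrite /eval2 !horner0.
have /eqP : (n * d' - n' * d) * (d * d') = 0.
  apply: eval2_eq0 => s al' s0; rewrite eval2M [eval2 (d * d') _ _]eval2M.
  have [->|ds] := eqVneq (eval2 d s al') 0; first by rewrite mul0r mulr0.
  have [->|ds'] := eqVneq (eval2 d' s al') 0; first by rewrite !mulr0.
  rewrite eval2D eval2N !eval2M.
  have e := fE s al' s0 ds; have e' := fE' s al' s0 ds'.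
  apply: (mulfI (expf_neq0 j s0)); rewrite mulr0.
  apply: (lincomb2 (c := - (eval2 d' s al') * (eval2 d s al' * eval2 d' s al'))
    (c' := eval2 d s al' * (eval2 d s al' * eval2 d' s al')) e e'); ring.
rewrite !mulf_eq0 (negPf dn) (negPf dn') !orbF subr_eq0 => /eqP nd.
apply: contraNneq ald => z; have := congr1 (fun F => eval2 F 0 al) nd.
by rewrite /= !eval2M z mul0r => <-.
Qed.
End TwoBasePoints.

(** * Density of the union *)

Lemma is_quotient_iff (k : fieldType) (E E' : elliptic_curve k) (D D' : point E -> Prop) :
  (forall P, D P <-> D' P) -> is_quotient E' D -> is_quotient E' D'.
Proof.
by move=> DD' [phi [iso sep ker]]; exists phi; split=> // P; rewrite -DD'.
Qed.

Lemma multiple_subgroupE (k : closedFieldType) (E : elliptic_curve k) (T P : point E) n :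
  in_kernel (T *+ n) P <-> multiple_subgroup n (in_kernel T) P.
Proof.
split=> [[i ->]|[_ [i ->] ->]]; last by exists i; rewrite mulnpE -!mulrnA mulnC.
by exists (T *+ i); [exists i | rewrite mulnpE -!mulrnA mulnC].
Qed.

Theorem theorem3p2 (k : closedFieldType) (g l : nat) :
  (1 <= g)%N -> prime l -> l \notin [pchar k] ->
  zariski_dense (fun x : 'I_g -> k => exists A : 'M[int]_g, W l A /\ X1 A x).
Proof.
move=> g1 lp lchar Z [I ZI] SZ x; apply/ZI => p Ip.
suff -> : p = 0 by rewrite meval0.
apply/eqP/negPn/negP => p0.
have l2 := prime_gt1 lp; have l0 := prime_gt0 lp.
(* Exponents in p are below [M], hence below the base l^M of the digits. As [nn] decreases in steps
   of [M], [e i] is l^(S - K) (l^M)^i. The summand 3 keeps every [nn i] at least 3, so that [d i]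
   and [N] are at least 8. *)
pose M := msize p; pose K := (3 + M * g)%N.
pose nn (i : 'I_g) := (K - M * i)%N.
have Mi (i : 'I_g) : (M * i <= M * g)%N by rewrite leq_mul2l (ltnW (ltn_ord i)) orbT.
have nn3 i : (3 <= nn i)%N by rewrite /nn /K; have := Mi i; lia.
pose S := (\sum_i nn i)%N; pose N := (l ^ S)%N.
have nnS i : (nn i <= S)%N by rewrite /S (bigD1 i) //= leq_addr.
have KS : (K <= S)%N by have := nnS (Ordinal g1); rewrite /nn /= muln0 subn0.
pose d i := (l ^ nn i)%N; pose e i := (l ^ (S - nn i))%N.
have e0 i : (0 < e i)%N by rewrite expn_gt0 l0.
have edN i : (e i * d i = N)%N by rewrite -expnD subnK.
have pow8 m : (3 <= m)%N -> (8 <= l ^ m)%N.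
  move=> m3; apply: leq_trans (leq_pexp2l l0 m3).
  by have : (2 ^ 3 <= l ^ 3)%N by rewrite leq_exp2r.
have d3 i : (3 <= d i)%N by apply: leq_trans (pow8 _ (nn3 i)).
have N5 : (5 <= N)%N by apply: leq_trans (pow8 S _) => //; apply: leq_trans KS;
  rewrite leq_addr.
(* Here l <> char(k) enters: l = 2 makes 2 invertible, and any other l makes the kernel orders
   odd. *)
have d_char i : odd (d i) \/ 2 != 0 :> k.
  case: (even_prime lp) => [lE|lo]; last by left; rewrite oddX lo orbT.
  by right; move: lchar; rewrite !inE lE /=.
pose v (i : 'I_g) (s al : k) := quot_j N (e i) (d i) s al.
have lv i : lead (-1 : k) (fun s al => s ^+ e i * v i s al) 0 1.
  by apply: lead_quot_j.
have inj : {in msupp p &, injective (fun m : 'X_{1.. g} => \sum_i e i * m i)%N}.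
  move=> m m' mp mp' eq.
  have small (m1 : 'X_{1.. g}) : m1 \in msupp p -> forall i, (m1 i < l ^ M)%N.
    move=> /msize_mdeg_lt mM i; apply: leq_ltn_trans (ltn_trans mM (ltn_expl _ l2)).
    by rewrite mdegE (bigD1 i) //= leq_addr.
  have wtE (m1 : 'X_{1.. g}) : (\sum_i e i * m1 i = l ^ (S - K) * \sum_(i < g)
    (l ^ M) ^ i * m1 i)%N.
    rewrite big_distrr /=; apply: eq_bigr => i _; rewrite mulnA; congr (_ * _)%N.
    by rewrite -expnM -expnD /e /nn; congr (_ ^ _)%N; have := Mi i;
      rewrite /K in KS *; lia.
  apply/mnmP; apply: (digits_inj (small _ mp) (small _ mp')).
  by move/eqP: eq; rewrite !wtE eqn_pmul2l ?expn_gt0 ?l0 // => /eqP.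
have near_p := near_meval_neq0 p0 inj lv.
have near_disc : near (-1 : k) (fun s al => forall i, i \in enum 'I_g ->
    discriminant (quot_curve N (e i) (d i) s al) != 0).
  apply: near_seq => i _.
  exact: lead_neq0 (oner_neq0 k) (lead_quot_disc k N5 (e0 i) (d3 i) (edN i)).
have [Psi [Psi0 nearE]] := near_and (near_generic_param k N5) (near_and near_p near_disc).
(* At al0 = -1 the coefficient vanishes, so the torsion curve passes through (0, -1); at al0 = 0 it
   is a sign, so the curve does not contain s = 0. *)
have tors_at (a : k) := lead_torsion N5 a.
have sgn0 : (-1) ^+ odd N != 0 :> k by rewrite signr_eq0.
have tors1 : lead (-1) (torsion (k := k) N) N./2 0.
  by apply: lead_eq (tors_at (-1)); rewrite subrr mulr0.
have tors0 : lead 0 (torsion (k := k) N) N./2 ((-1) ^+ odd N).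
  by apply: lead_eq (tors_at 0); rewrite addr0 mulr1.
have [n [dn [al1 [dn0 n0 n1 torsE]]]] := lead_zero_numerator sgn0 tors1 tors0.
(* The factor [dn] is included so that a zero of the numerator [n] is a zero of [torsion] itself. *)
have PsiN0 : eval2 (Psi * dn) 0 (-1) != 0 by rewrite eval2M mulf_neq0.
have [s [al [s0 nz]]] := point_on_curve n0 n1 PsiN0.
rewrite eval2M mulf_eq0 negb_or => /andP[Psi_s dn_s].
have [nd [pv disc]] := nearE s al s0 Psi_s.
have tors : torsion N s al = 0.
  by apply: (mulIf dn_s); rewrite mul0r torsE // nz mulr0.
case/eqP: pv; apply: (ZI (fun i => v i s al)).1 Ip; apply: SZ.
pose A : 'M[int]_g := diag_mx (\row_i (l ^ nn i)%N%:Z).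
have AE i : `|A i i|%N = d i by rewrite !mxE eqxx mulr1n.
have levelE : level A = N.
  rewrite /level det_diag (eq_bigr (fun i => (l ^ nn i)%N%:Z)) => [|i _];
    last by rewrite mxE.
  by rewrite -(big_morph Posz PoszM (erefl _)) /= -expn_sum.
pose T := base_point nd.
have cyc : cyclic_of_order (level A) (in_kernel T).
  exists T; split; rewrite ?levelE.
  - by move=> Q; split=> -[m ->]; exists m; rewrite mulnpE.
  - by rewrite mulnpE (base_torsion N5).
  - by move=> m mN; rewrite mulnpE; apply/eqP; apply: (base_order N5).
exists A; split.
  by exists nn; split=> // i; apply: leq_trans (nn3 i).
exists (Y0Point cyc) => i /=.
have d0 : (0 < d i)%N by apply: leq_trans (d3 i).
have disc_i : discriminant (quot_curve N (e i) (d i) s al) != 0.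
  by apply: disc; rewrite mem_enum.
have [E' [quot jE]] := nodal_quotient N5 nd tors (e0 i) d0 (edN i) (d_char i) disc_i.
have nE : (level A %/ `|A i i|%N = e i)%N by rewrite levelE AE -(edN i) mulnK.
exists E'; split=> //; apply: is_quotient_iff quot => P.
by rewrite nE; apply: multiple_subgroupE.
Qed.
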